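(* Let $r>0$ and let $\mu$ be the Markov-type measure on the ratio-specified graph directed fractal $E\subset\mathbb{R}^q$ determined by the data $P=(p_{ij})_{N\times N}$, $(c_{ij})_{N\times N}$, $(\chi_i)_{i=1}^N$ and the cylinder sets $J_\sigma$, as described in the context. Assume that every row of $P$ has at least two positive entries and that the separation property of the context holds: there is $t\in(0,1)$ with $d(J_{\sigma\ast i_1},J_{\sigma\ast i_2})\ge t\max\{|J_{\sigma\ast i_1}|,|J_{\sigma\ast i_2}|\}$ for all $\sigma\in\Omega^*$ and all distinct $i_1,i_2$ for which $\sigma\ast i_1,\sigma\ast i_2$ are admissible words. Let $s_r$ be the unique positive number with $\Psi_G(s_r)=1$. Then the quantization dimension $D_r(\mu)$ exists and $$D_r(\mu)=s_r,\qquad \underline{Q}_r^{s_r}(\mu)>0 .$$ Furthermore, $\overline{Q}_r^{s_r}(\mu)<\infty$ if and only if any two distinct elements of $\mathcal{M}:=\{H\in \mathrm{SC}(G): s_r(H)=s_r\}$ are incomparable; otherwise (that is, if $\mathcal{M}$ contains two distinct comparable elements) $\underline{Q}_r^{s_r}(\mu)=\infty$.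
   Context: Quantization. For a Borel probability measure $\nu$ on $\mathbb{R}^q$, $r>0$ and $n\ge1$, let $e_{n,r}(\nu):=\inf\{(\int d(x,\alpha)^r d\nu(x))^{1/r}:\alpha\subset\mathbb{R}^q,\ 1\le \mathrm{card}(\alpha)\le n\}$, where $d(x,\alpha)=\inf_{a\in\alpha}d(x,a)$ and $d$ is the metric induced by an arbitrary fixed norm on $\mathbb{R}^q$. Put $\overline{D}_r(\nu):=\limsup_{n\to\infty}\frac{\log n}{-\log e_{n,r}(\nu)}$, $\underline{D}_r(\nu):=\liminf_{n\to\infty}\frac{\log n}{-\log e_{n,r}(\nu)}$; if they coincide the common value is the quantization dimension $D_r(\nu)$. For $s>0$, $\overline{Q}_r^s(\nu):=\limsup_{n\to\infty}n^{r/s}e_{n,r}(\nu)^r$ and $\underline{Q}_r^s(\nu):=\liminf_{n\to\infty}n^{r/s}e_{n,r}(\nu)^r$. Words. $P=(p_{ij})_{N\times N}$ is a row-stochastic matrix such that for each $i$ there are at least two $j$ with $p_{ij}>0$. $(c_{ij})_{N\times N}$ is a matrix with $0\le c_{ij}<1$ and $c_{ij}>0$ iff $p_{ij}>0$. Let $\theta$ be the empty word, $\Omega_0=\{\theta\}$, $\Omega_1=\{1,\dots,N\}$, $\Omega_k=\{\sigma\in\Omega_1^k: p_{\sigma_1\sigma_2}\cdots p_{\sigma_{k-1}\sigma_k}>0\}$ for $k\ge2$, $\Omega^*=\bigcup_{k\ge0}\Omega_k$ (admissible words), $\Omega_\infty=\{\sigma\in\Omega_1^{\mathbb{N}}:p_{\sigma_h\sigma_{h+1}}>0\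 \forall h\ge1\}$; $\sigma\ast\omega$ denotes concatenation, $|\sigma|$ the length of $\sigma$, and $\sigma|_k$ the prefix of length $k$. Fractal. $|A|$ denotes the diameter of $A\subset\mathbb{R}^q$, and $d(A,B)=\inf\{|x-y|:x\in A,y\in B\}$ (Euclidean). $J_1,\dots,J_N\subset\mathbb{R}^q$ are non-empty compact sets with $J_i=\overline{\mathrm{int}(J_i)}$ and $|J_i|=1$. Inductively, for $\sigma=(i_1,\dots,i_k)\in\Omega_k$, $k\ge1$, with $J_\sigma$ already given, the sets $J_{\sigma\ast i_{k+1}}$ (with $\sigma\ast i_{k+1}\in\Omega_{k+1}$) are arbitrary non-overlapping subsets of $J_\sigma$ such that $J_{\sigma\ast i_{k+1}}$ is geometrically similar to $J_{i_{k+1}}$ and $|J_{\sigma\ast i_{k+1}}|=c_{i_ki_{k+1}}|J_\sigma|$ (the similarity maps are not prescribed). $E:=\bigcap_{k\ge1}\bigcup_{\sigma\in\Omega_k}J_\sigma$. In the separation property, for $\sigma=\theta$ the words $\theta\ast i=i$ are all admissible, so it says $d(J_{i_1},J_{i_2})\ge t$ for $i_1\ne i_2$. Measure. $(\chi_i)_{i=1}^N$ is a probability vector with all $\chi_i>0$. $\widetilde\mu$ is the unique probability measure on $\Omega_\infty$ with $\widetilde\mu(\{\omega\in\Omega_\infty:\omega|_k=\sigma\})=\chi_{\sigma_1}p_{\sigma_1\sigma_2}\cdots p_{\sigma_{k-1}\sigma_k}$ for all $\sigma\in\Omega_k$, $k\geq 1$; $\pi:\Omega_\infty\to E$ maps $\sigma$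 to the unique point of $\bigcap_{k\ge1}J_{\sigma|_k}$; and $\mu:=\widetilde\mu\circ\pi^{-1}$. Thus $\mu(J_\sigma)=\chi_{\sigma_1}p_{\sigma_1\sigma_2}\cdots p_{\sigma_{k-1}\sigma_k}$. Graph and spectral radii. $G$ is the directed graph with vertices $1,\dots,N$ and an edge from $i$ to $j$ iff $p_{ij}>0$. A path is a word $(i_1,\dots,i_k)\in\Omega_k$. A subgraph is a vertex subset $H\subset G$ with the inherited edges; it is strongly connected if for every pair $i_1,i_2\in H$ there is a path in $H$ (using at least one edge) from $i_1$ to $i_2$. $\mathrm{SC}(G)$ is the set of strongly connected components (maximal strongly connected subgraphs). For $H_1,H_2\in\mathrm{SC}(G)$, $H_1\prec H_2$ means there is a path in $G$ starting in $H_1$ and ending in $H_2$; $H_1,H_2$ are incomparable if neither $H_1\prec H_2$ nor $H_2\prec H_1$. For $s>0$ put $b_{ij}(s)=(p_{ij}c_{ij}^r)^{s/(s+r)}$, $A_{G,s}=(b_{ij}(s))_{i,j=1}^N$, $A_{H,s}=(b_{ij}(s))_{i,j\in H}$, and let $\Psi_G(s),\Psi_H(s)$ be the spectral radii of $A_{G,s},A_{H,s}$. There is a unique $s_r>0$ with $\Psi_G(s_r)=1$. For $H\in\mathrm{SC}(G)$, $s_r(H)$ is the unique positive number with $\Psi_H(s_r(H))=1$, if such a number exists; components for which no such positive number exists do not belong to $\mathcal{M}$. *)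

(* Defs.v *)
From HB Require Import structures.
From mathcomp Require Import all_boot all_order all_algebra.
From mathcomp Require Import complex.
From mathcomp Require Import all_classical all_reals all_analysis.

Set Implicit Arguments.
Unset Strict Implicit.
Unset Printing Implicit Defensive.

Import Order.TTheory GRing.Theory Num.Theory numFieldNormedType.Exports.

Local Open Scope classical_set_scope.
Local Open Scope card_scope.
Local Open Scope ring_scope.

Section Euclidean.
Context {R : realType} {q : nat}.
Implicit Types (x y : 'rV[R]_q) (A B : set 'rV[R]_q).

(* The library's norm on 'rV[R]_q is the sup norm; it is only used here through
   the topology that it induces, which is the Euclidean one. *)
Definition enorm x : R := Num.sqrt (\sum_(i < q) x 0 i ^+ 2).

Definition diam A : R := sup [set enorm (xy.1 - xy.2) | xy in A `*` A].

Definition setdist A B : R := inf [set enorm (xy.1 - xy.2) | xy in A `*` B].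

Definition geom_similar A B : Prop :=
  exists (f : 'rV[R]_q -> 'rV[R]_q) (rho : R),
    [/\ 0 < rho, forall x y, enorm (f x - f y) = rho * enorm (x - y)
      & B = f @` A].

Definition is_norm (nrm : 'rV[R]_q -> R) : Prop :=
  [/\ forall x y, nrm (x + y) <= nrm x + nrm y,
      forall (a : R) x, nrm (a *: x) = `|a| * nrm x
    & forall x, nrm x = 0 -> x = 0].

End Euclidean.

Definition borel (R : realType) (q : nat) :=
  g_sigma_algebraType (@open 'rV[R]_q).

Section Quantization.
Context {R : realType} {q : nat}.
Variables (nrm : 'rV[R]_q -> R) (r : R) (nu : probability (borel R q) R).
Local Open Scope ereal_scope.

Definition pointdist (x : 'rV[R]_q) (alpha : set 'rV[R]_q) : R :=
  inf [set nrm (x - a)%R | a in alpha].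

Definition quant_error (n : nat) : \bar R :=
  ereal_inf [set poweR (\int[nu]_x (pointdist x alpha `^ r)%R%:E) r^-1
            | alpha in [set alpha | alpha !=set0 /\ alpha #<= `I_n]].

(* lne is the extended logarithm and 1 / +oo = 0, so that the ratio is 0
   when the error vanishes. *)
Definition quant_ratio (n : nat) : \bar R :=
  (ln n%:R)%R%:E / (- lne (quant_error n)).

Definition upper_quant_dim : \bar R := limn_esup quant_ratio.
Definition lower_quant_dim : \bar R := limn_einf quant_ratio.

Definition has_quant_dim (D : \bar R) : Prop :=
  upper_quant_dim = D /\ lower_quant_dim = D.

Definition scaled_error (s : R) (n : nat) : \bar R :=
  (n%:R `^ (r / s))%R%:E * poweR (quant_error n) r.

Definition upper_quant_coef (s : R) : \bar R := limn_esup (scaled_error s).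
Definition lower_quant_coef (s : R) : \bar R := limn_einf (scaled_error s).

End Quantization.

(* The alphabet {1, ..., N} is 'I_m.+1: it must be visibly non-empty for
   sequences over it to form a measurableType. *)
HB.instance Definition _ (m : nat) := isPointed.Build 'I_m.+1 ord0.

Section Words.
Context {R : realType} {m : nat}.
Variable P : 'M[R]_m.+1.
Implicit Types (sigma : seq 'I_m.+1) (omega : nat -> 'I_m.+1).

Definition edge : rel 'I_m.+1 := fun i j => 0 < P i j.

Definition admissible sigma : bool := sorted edge sigma.

Definition Omega_inf : set (nat -> 'I_m.+1) :=
  [set omega | forall h, edge (omega h) (omega h.+1)].

Definition cylinder sigma : set (nat -> 'I_m.+1) :=
  [set omega | mkseq omega (size sigma) = sigma].

Definition shift_space := g_sigma_algebraType (range cylinder).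

Definition is_transition_matrix : Prop :=
  [/\ forall i j, 0 <= P i j, forall i, \sum_j P i j = 1
    & forall i, (2 <= #|[pred j | (0 < P i j)%R]|)%N].

Definition is_ratio_matrix (c : 'M[R]_m.+1) : Prop :=
  forall i j, 0 <= c i j < 1 /\ (0 < c i j <-> 0 < P i j).

Definition is_positive_probability_vector (chi : 'I_m.+1 -> R) : Prop :=
  (forall i, 0 < chi i) /\ \sum_i chi i = 1.

Definition word_weight (chi : 'I_m.+1 -> R) sigma : R :=
  if sigma is i :: tau
  then chi i * \prod_(e <- zip sigma tau) P e.1 e.2
  else 1.

(* A probability measure on Omega_inf is represented by one on the full
   sequence space for which Omega_inf has mass 1. *)
Definition is_markov_measure (chi : 'I_m.+1 -> R)
    (mut : probability shift_space R) : Prop :=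
  mut Omega_inf = 1%E /\
  forall sigma, sigma != [::] -> admissible sigma ->
    mut (Omega_inf `&` cylinder sigma) = (word_weight chi sigma)%:E.

End Words.

Section Fractal.
Context {R : realType} {q m : nat}.
Variables (P c : 'M[R]_m.+1) (J : seq 'I_m.+1 -> set 'rV[R]_q).

(* The value of J on [::] and on non-admissible words is irrelevant. *)
Definition is_cylinder_system : Prop :=
  [/\ forall i, [/\ J [:: i] !=set0, compact (J [:: i]),
                    J [:: i] = closure (interior (J [:: i]))
                  & diam (J [:: i]) = 1],
      forall sigma i j, admissible P (rcons (rcons sigma i) j) ->
        [/\ J (rcons (rcons sigma i) j) `<=` J (rcons sigma i),
            geom_similar (J [:: j]) (J (rcons (rcons sigma i) j))
          & diam (J (rcons (rcons sigma i) j)) =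
            c i j * diam (J (rcons sigma i))]
    & forall sigma i1 i2, sigma != [::] -> i1 != i2 ->
        admissible P (rcons sigma i1) -> admissible P (rcons sigma i2) ->
        interior (J (rcons sigma i1)) `&` interior (J (rcons sigma i2))
          = set0].

Definition separation_property : Prop :=
  exists t : R, 0 < t < 1 /\
    forall sigma i1 i2, i1 != i2 ->
      admissible P (rcons sigma i1) -> admissible P (rcons sigma i2) ->
      t * Num.max (diam (J (rcons sigma i1))) (diam (J (rcons sigma i2)))
        <= setdist (J (rcons sigma i1)) (J (rcons sigma i2)).

(* For omega in Omega_inf the intersection is a singleton. *)
Definition coding_map (omega : nat -> 'I_m.+1) : 'rV[R]_q :=
  xget 0 (\bigcap_(k in [set k | (0 < k)%N]) J (mkseq omega k)).

Definition is_markov_type_measure (chi : 'I_m.+1 -> R)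
    (mu : probability (borel R q) R) : Prop :=
  exists2 mut : probability (@shift_space m) R,
    is_markov_measure P chi mut &
    forall A : set (borel R q), measurable A ->
      mu A = mut (Omega_inf P `&` coding_map @^-1` A).

End Fractal.

Section Graph.
Context {R : realType} {m : nat}.
Variables (P c : 'M[R]_m.+1) (r : R).
Implicit Types H : {set 'I_m.+1}.

Definition spectral_radius (n : nat) (A : 'M[R]_n) : R :=
  sup [set Normc.normc z | z in
         [set z : R[i] | eigenvalue (map_mx (real_complex R) A) z]].

Definition weight_mx (s : R) : 'M[R]_m.+1 :=
  \matrix_(i, j) (P i j * c i j `^ r) `^ (s / (s + r)).

Definition weight_submx H (s : R) : 'M[R]_#|H| :=
  mxsub enum_val enum_val (weight_mx s).

Definition is_sr (s : R) : Prop :=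
  0 < s /\ spectral_radius (weight_mx s) = 1.

Definition is_sr_of H (s : R) : Prop :=
  0 < s /\ spectral_radius (weight_submx H s) = 1.

Definition edge_in H : rel 'I_m.+1 :=
  fun i j => [&& i \in H, j \in H & edge P i j].

(* A path with at least one edge from i1 to i2 is i1 :: w with w non-empty
   and ending in i2. *)
Definition strongly_connected H : Prop :=
  H != finset.set0 /\
  forall i1 i2, i1 \in H -> i2 \in H ->
    exists w, [/\ w != [::], path (edge_in H) i1 w & last i1 w = i2].

Definition SC H : Prop :=
  strongly_connected H /\
  forall K : {set 'I_m.+1}, strongly_connected K -> H \subset K -> K = H.

Definition precedes H1 H2 : Prop :=
  exists i w, [/\ i \in H1, path (edge P) i w & last i w \in H2].

Definition comparable_components H1 H2 : Prop :=
  precedes H1 H2 \/ precedes H2 H1.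

Definition critical (s : R) H : Prop := SC H /\ is_sr_of H s.

End Graph.

(* Main.v *)
(* Put [E(sigma) = mu(J_sigma) |J_sigma|^r], [a = s_r / (s_r + r)], and let N(e)
   be the number of words sigma at which E first drops below e; these words form
   a finite maximal antichain on which E is comparable to e. One point in each
   of the corresponding cylinders gives [e_n^r <= C N(e) e] for [n >= N(e)].
   Conversely, by the separation property a set of [n <= N(e) / 2] points stays
   away from at least n of these cylinders, so that [e_n^r >= c n e]. Everything
   thus reduces to comparing N(e) with [e^-a], which is a counting problem for
   the matrix [A_{G,s_r}], of spectral radius 1. Counts are compared with sub-
   and supersolutions of their recursion along edges: a positive eigenvector of a
   critical class gives [N(e) >= c e^-a]; incomparable critical classes allow a
   supersolution of order [e^-a]; two comparable ones produce a subsolution of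
   order [e^-a log (1 / e)]; and in all cases [N(e) = O(e^{-a (1 + t)})] for every
   [t > 0], which yields the dimension. *)
Require Import Defs.
From HB Require Import structures.
From mathcomp Require Import all_boot all_order all_algebra.
From mathcomp Require Import complex polyrcf.
From mathcomp Require Import all_classical all_reals all_analysis.
From mathcomp Require Import measurable_realfun.
From mathcomp Require Import ring lra.

Import Order.TTheory GRing.Theory Num.Theory numFieldNormedType.Exports.

Local Open Scope classical_set_scope.
Local Open Scope ring_scope.

Set Implicit Arguments.
Unset Strict Implicit.
Unset Printing Implicit Defensive.

(** * Perron root of a nonnegative matrix *)

Section PerronFrobenius.
Context {R : realType}.

(** The entry [B i j] is [(p_ij c_ij^r)^a], so along a word the quantity [y = (E/e)^a] is multiplied
    by entries of [B], and the stopping rule [E < e] reads [y < 1]; growth of order [y] is growth of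
    order [e^-a]. Since [1/a = 1 + r/s_r], taking [e] of order [n^-(1 + r/s_r)] makes
    [n^(r/s_r) n e] independent of [n]. The obstacle is that [B] may be reducible: a nonnegative
    eigenvector for the eigenvalue 1 can vanish at many vertices, so it gives lower bounds for the
    counts but no upper bounds. Away from the critical classes, supersolutions are therefore built
    from resolvents [(l - B_D)^-1], with [l] above the spectral radius of a restriction [B_D],
    applied to nonnegative vectors. Such a resolvent is nonnegative as soon as [l] is no
    subeigenvalue, which is why the spectral radius is first replaced by a supremum of
    subeigenvalues. *)

Definition subeigenvalue n (B : 'M[R]_n) (l : R) : Prop :=
  exists x : 'I_n -> R, [/\ forall i, 0 <= x i, exists i, 0 < x i
    & forall i, l * x i <= \sum_j B i j * x j].

(** The Collatz-Wielandt form of the spectral radius; it makes sense for reducible matrices, and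
    every nonnegative test vector yields a lower bound for it. *)
Definition perron_root n (B : 'M[R]_n) : R := sup [set l | subeigenvalue B l].

Definition nonneg_mx n (B : 'M[R]_n) : Prop := forall i j, 0 <= B i j.

(* Applied to the negative part of [y]. *)
Lemma resolvent_monotone n (B : 'M[R]_n) (l : R) (y : 'I_n -> R) :
  nonneg_mx B -> 0 < l -> ~ subeigenvalue B l ->
  (forall i, \sum_j B i j * y j <= l * y i) -> forall i, 0 <= y i.
Proof.
move=> B0 l0 nl yl i; rewrite leNgt; apply/negP => yi0; apply: nl.
exists (fun k => Num.max 0 (- y k)); split.
- by move=> k; rewrite le_max lexx.
- by exists i; rewrite lt_max oppr_gt0 yi0 orbT.
move=> k; have [yk0|yk0] := leP 0 (y k).
  rewrite max_l ?oppr_le0// mulr0; apply: sumr_ge0 => j _.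
  by rewrite mulr_ge0// le_max lexx.
have -> : Num.max 0 (- y k) = - y k by apply: max_r; rewrite oppr_ge0 ltW.
rewrite mulrN lerNl -sumrN.
apply: le_trans (yl k); apply: ler_sum => j _.
by rewrite -mulrN ler_wpM2l// lerNl le_max lexx orbT.
Qed.

(** A kernel vector of [l - B] and its opposite both satisfy the hypothesis of [resolvent_monotone],
    so both are nonnegative. The transpose enters because [det0P] yields row vectors. *)
Lemma resolvent_unit n (B : 'M[R]_n) (l : R) :
  nonneg_mx B -> 0 < l -> ~ subeigenvalue B l -> l%:M - B \in unitmx.
Proof.
move=> B0 l0 nl; rewrite unitmxE unitfE -det_tr; apply/negP => /det0P[v v0 vM].
have E i : \sum_j B i j * v 0 j = l * v 0 i.
  have := congr1 (fun w : 'rV_n => w 0 i) vM.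
  rewrite raddfB /= tr_scalar_mx mulmxBr mul_mx_scalar !mxE.
  move/eqP; rewrite subr_eq0 => /eqP ->; apply: eq_bigr => j _.
  by rewrite !mxE mulrC.
have v_ge0 : forall i, 0 <= v 0 i.
  by apply: (resolvent_monotone B0 l0 nl) => i; rewrite E.
have v_le0 : forall i, 0 <= - v 0 i.
  apply: (resolvent_monotone B0 l0 nl) => i.
  by rewrite mulrN -E -sumrN; apply: ler_sum => j _; rewrite mulrN.
case/eqP: v0; apply/rowP => i; rewrite mxE; apply/eqP.
by rewrite eq_le v_ge0 -oppr_ge0 v_le0.
Qed.

(** Each column [y] of the inverse satisfies [l y - B y >= 0], its right-hand side being a unit
    vector. *)
Lemma resolvent_ge0 n (B : 'M[R]_n) (l : R) :
  nonneg_mx B -> 0 < l -> ~ subeigenvalue B l ->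
  forall i j, 0 <= invmx (l%:M - B) i j.
Proof.
move=> B0 l0 nl i j.
have U := resolvent_unit B0 l0 nl.
apply: (resolvent_monotone B0 l0 nl (y := fun i => invmx (l%:M - B) i j)) => k.
have := congr1 (fun w : 'M[R]_n => w k j) (mulmxV U).
rewrite mulmxBl mul_scalar_mx !mxE => /eqP; rewrite subr_eq => /eqP ->.
by rewrite lerDr; case: eqP.
Qed.

Lemma resolvent_solve n (B : 'M[R]_n) (l : R) (G : 'I_n -> R) :
  nonneg_mx B -> 0 < l -> ~ subeigenvalue B l -> (forall i, 0 <= G i) ->
  exists z : 'I_n -> R, (forall i, 0 <= z i) /\
    forall i, l * z i = \sum_j B i j * z j + G i.
Proof.
move=> B0 l0 nl G0.
have U := resolvent_unit B0 l0 nl.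
pose z := invmx (l%:M - B) *m \col_i G i.
have : (l%:M - B) *m z = \col_i G i by rewrite mulKVmx.
move: z => z zG.
have zE i : l * z i 0 = \sum_j B i j * z j 0 + G i.
  have := congr1 (fun w : 'cV_n => w i 0) zG.
  rewrite mulmxBl mul_scalar_mx !mxE => /eqP.
  by rewrite subr_eq addrC => /eqP.
exists (fun i => z i 0); split => // i.
apply: (resolvent_monotone B0 l0 nl (y := fun i => z i 0)) => k.
by rewrite zE lerDl.
Qed.

Lemma subeigenvalue_le n (B : 'M[R]_n) (l : R) :
  nonneg_mx B -> subeigenvalue B l -> l <= \sum_i \sum_j B i j.
Proof.
move=> B0 [x [x0 [i0 xi0] xl]].
have s0 : 0 < \sum_i x i.
  by rewrite (bigD1 i0)//= ltr_pwDl// sumr_ge0.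
rewrite -(ler_pM2r s0) mulr_sumr mulr_suml; apply: ler_sum => i _.
apply: le_trans (xl i) _; rewrite mulr_suml; apply: ler_sum => j _.
rewrite ler_wpM2l// (bigD1 j)//= lerDl sumr_ge0//.
Qed.

Lemma has_sup_subeigenvalue n (B : 'M[R]_n) : (0 < n)%N ->
  nonneg_mx B -> has_sup [set l | subeigenvalue B l].
Proof.
move=> n0 B0; split.
  exists 0; exists (fun=> 1); split => //; first by exists (Ordinal n0).
  by move=> i; rewrite mul0r sumr_ge0// => j _; rewrite mulr1.
by exists (\sum_i \sum_j B i j) => l; apply: subeigenvalue_le.
Qed.

Lemma perron_root_ge n (B : 'M[R]_n) l : (0 < n)%N ->
  nonneg_mx B -> subeigenvalue B l -> l <= perron_root B.
Proof. by move=> n0 B0 ?; apply: (sup_upper_bound (has_sup_subeigenvalue n0 B0)). Qed.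

Lemma perron_root_ge0 n (B : 'M[R]_n) : (0 < n)%N ->
  nonneg_mx B -> 0 <= perron_root B.
Proof.
move=> n0 B0; apply: perron_root_ge => //.
exists (fun=> 1); split => //; first by exists (Ordinal n0).
by move=> i; rewrite mul0r sumr_ge0// => j _; rewrite mulr1.
Qed.

(** Carries the sign of resolvent entries from [l > rho] to [l = rho]: the adjugate and the
    determinant of [l - B] are polynomials in [l]. *)
Lemma horner_ge0_right (p : {poly R}) (a : R) :
  (forall l, a < l -> 0 <= p.[l]) -> 0 <= p.[a].
Proof.
move=> pa; rewrite leNgt; apply/negP => pa0.
have [|d d0 /(_ (a + d / 2))] := @poly_cont _ a p (- p.[a]).
  by rewrite oppr_gt0.
rewrite addrAC subrr add0r ger0_norm; last by rewrite divr_ge0// ltW.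
have -> : d / 2 < d by lra.
move=> /(_ isT); have := pa (a + d / 2); rewrite ltrDl divr_gt0//.
move=> /(_ isT) p0; rewrite ger0_norm; lra.
Qed.

Lemma map_horner_char_poly_mx n (B : 'M[R]_n) l :
  map_mx (horner_eval l) (char_poly_mx B) = l%:M - B.
Proof.
apply/matrixP => i j; rewrite !mxE /horner_eval hornerD hornerN hornerC.
by rewrite hornerMn hornerX.
Qed.

Lemma horner_char_poly n (B : 'M[R]_n) l :
  (char_poly B).[l] = \det (l%:M - B).
Proof.
by rewrite -map_horner_char_poly_mx det_map_mx.
Qed.

Lemma char_poly_tr (F : comNzRingType) n (A : 'M[F]_n) :
  char_poly A^T = char_poly A.
Proof.
rewrite /char_poly -[LHS]det_tr; congr (\det _).
by apply/matrixP => i j; rewrite !mxE eq_sym.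
Qed.

(* If [rho - B] were invertible its inverse would still be nonnegative, as a
   limit of resolvents, and the positive row vector [1 (rho - B)^-1] would
   bound every subeigenvalue away from [rho]. *)
Lemma det_perron_root n (B : 'M[R]_n) : (0 < n)%N -> nonneg_mx B ->
  \det ((perron_root B)%:M - B) = 0.
Proof.
move=> n0 B0; set rho := perron_root B; apply/eqP/negPn/negP => d0.
have rho0 : 0 <= rho by apply: perron_root_ge0.
have hdet := horner_char_poly B.
have hadj l i j : (\adj (char_poly_mx B) i j).[l] = \adj (l%:M - B) i j.
  by rewrite -map_horner_char_poly_mx -map_mx_adj [in RHS]mxE.
(* The product of the adjugate entry and the determinant is a polynomial in [l] with the same sign
   as their quotient, so its nonnegativity for [l > rho] survives at [rho]. *)
have Rge0 i j : 0 <= invmx (rho%:M - B) i j.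
  have := @horner_ge0_right (\adj (char_poly_mx B) i j * \det (char_poly_mx B)) rho.
  rewrite hornerM -[\det (char_poly_mx B)]/(char_poly B) hdet hadj => H.
  rewrite /invmx unitmxE unitfE d0 mxE.
  have -> : (\det (rho%:M - B))^-1 * \adj (rho%:M - B) i j =
     \adj (rho%:M - B) i j * \det (rho%:M - B) * (\det (rho%:M - B))^-1 ^+ 2.
    by rewrite expr2 mulrA mulfK// mulrC.
  rewrite mulr_ge0 ?sqr_ge0//; apply: H => l rl.
  have l0 : 0 < l by apply: le_lt_trans rl.
  have nl : ~ subeigenvalue B l.
    by move/(perron_root_ge n0 B0); rewrite leNgt rl.
  have U := resolvent_unit B0 l0 nl.
  rewrite hornerM hdet hadj.
  have := resolvent_ge0 B0 l0 nl i j.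
  rewrite /invmx U mxE => H.
  have dl : \det (l%:M - B) != 0 by rewrite -unitfE -unitmxE.
  have -> : \adj (l%:M - B) i j * \det (l%:M - B) =
    (\det (l%:M - B))^-1 * \adj (l%:M - B) i j * \det (l%:M - B) ^+ 2.
    by field.
  by rewrite mulr_ge0 ?sqr_ge0.
have U : rho%:M - B \in unitmx by rewrite unitmxE unitfE.
pose v := const_mx 1 *m invmx (rho%:M - B) : 'rV_n.
have vE j : \sum_i v 0 i * B i j = rho * v 0 j - 1.
  have := congr1 (fun w : 'rV_n => w 0 j) (mulmxKV U (const_mx 1 : 'rV_n)).
  rewrite -/v mulmxBr mul_mx_scalar !mxE => /eqP.
  rewrite subr_eq => /eqP ->.
  by rewrite [RHS]addrAC subrr add0r.
have v0 j : 0 <= v 0 j.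
  by rewrite mxE sumr_ge0// => i _; rewrite mxE mul1r.
have vp j : 0 < v 0 j.
  rewrite lt_neqAle v0 andbT eq_sym; apply/eqP => vj0.
  have : 0 <= \sum_i v 0 i * B i j by rewrite sumr_ge0// => i _; rewrite mulr_ge0.
  by rewrite vE vj0; lra.
pose V := \sum_j v 0 j.
have V0 : 0 < V.
  by rewrite /V (bigD1 (Ordinal n0))//= ltr_pwDl ?sumr_ge0.
have vV j : v 0 j <= V by rewrite /V (bigD1 j)//= lerDl sumr_ge0.
(* Pairing [v] with a subeigenvector [x] gives [l (v x) <= sum_j (rho v_j - 1) x_j], and [v_j <= V]
   makes the loss 1 at least [v_j / V]. *)
suff : rho <= rho - V^-1.
  have : 0 < V^-1 by rewrite invr_gt0.
  by lra.
apply: ge_sup; first by have [] := has_sup_subeigenvalue n0 B0.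
move=> l [x [x0 [i0 xi0] xl]].
have vx0 : 0 < \sum_i v 0 i * x i.
  rewrite (bigD1 i0)//= ltr_pwDl ?mulr_gt0// sumr_ge0// => i _.
  by rewrite mulr_ge0.
rewrite -(ler_pM2r vx0) mulr_sumr.
apply: (@le_trans _ _ (\sum_i \sum_j v 0 i * B i j * x j)).
  apply: ler_sum => i _; rewrite mulrCA.
  under eq_bigr do rewrite -mulrA.
  by rewrite -mulr_sumr ler_wpM2l.
rewrite exchange_big mulr_sumr; apply: ler_sum => j _ /=.
rewrite -mulr_suml vE mulrA ler_wpM2r// mulrBl lerD2l lerN2.
by rewrite ler_pdivrMl// mulr1.
Qed.

(** The supremum is attained: the absolute values of an eigenvector for [rho], which exists since
    the determinant vanishes, form a subeigenvector by the triangle inequality. *)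
Lemma perron_subeigenvalue n (B : 'M[R]_n) : (0 < n)%N -> nonneg_mx B ->
  subeigenvalue B (perron_root B).
Proof.
move=> n0 B0; have := det_perron_root n0 B0.
rewrite -det_tr => /eqP/det0P[v v0 vM].
have rho0 := perron_root_ge0 n0 B0.
exists (fun i => `|v 0 i|); split => //.
  have [i vi] : exists i, v 0 i != 0.
    apply/existsP; rewrite -negb_forall; apply: contra v0 => /forallP v0.
    by apply/eqP/rowP => i; rewrite mxE; apply/eqP.
  by exists i; rewrite normr_gt0.
move=> i; have E : \sum_j B i j * v 0 j = perron_root B * v 0 i.
  have := congr1 (fun w : 'rV_n => w 0 i) vM.
  rewrite raddfB /= tr_scalar_mx mulmxBr mul_mx_scalar !mxE.
  move/eqP; rewrite subr_eq0 => /eqP ->; apply: eq_bigr => j _.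
  by rewrite !mxE mulrC.
rewrite -[X in X * _]ger0_norm// -normrM -E.
apply: le_trans (ler_norm_sum _ _ _) _; apply: ler_sum => j _.
by rewrite normrM [X in X * _]ger0_norm.
Qed.

Lemma normc_sum (I : Type) (s : seq I) (F : I -> R[i]) :
  Normc.normc (\sum_(k <- s) F k) <= \sum_(k <- s) Normc.normc (F k).
Proof.
elim/big_ind2 : _ => //; first by rewrite Normc.normc0.
by move=> a b c d ab cd; apply: le_trans (le_normcD _ _) (lerD ab cd).
Qed.

(** The Perron root is itself an eigenvalue, and the moduli of a complex eigenvector for [z] form a
    subeigenvector for [|z|]. Eigenvectors are row vectors here, whence the passage to the
    transpose. *)
Lemma spectral_radiusE n (B : 'M[R]_n) : (0 < n)%N -> nonneg_mx B ->
  spectral_radius B = perron_root B.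
Proof.
move=> n0 B0; rewrite /spectral_radius; set S := (X in sup X).
have normcR (x : R) : 0 <= x -> Normc.normc (real_complex R x) = x.
  by move=> x0; rewrite /= expr0n/= addr0 sqrtr_sqr ger0_norm.
have Srho : S (perron_root B).
  exists (real_complex R (perron_root B)); last exact/normcR/perron_root_ge0.
  rewrite /mkset eigenvalue_map eigenvalue_root_char /root.
  have := det_perron_root n0 B0.
  by rewrite -horner_char_poly => ->.
have ubS : ubound S (perron_root B).
  move=> _ [z zE <-]; apply: perron_root_ge => //.
  move: zE; rewrite /mkset.
  have -> : eigenvalue (map_mx (real_complex R) B) z =
            eigenvalue (map_mx (real_complex R) B)^T z.
    by rewrite !eigenvalue_root_char char_poly_tr.
  move=> /eigenvalueP[v vB v0].
  exists (fun i => Normc.normc (v 0 i)); split => //.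
  - by move=> i; rewrite /Normc.normc; case: (v 0 i) => a b; rewrite sqrtr_ge0.
  - have [i vi] : exists i, v 0 i != 0.
      apply/existsP; rewrite -negb_forall; apply: contra v0 => /forallP v0.
      by apply/eqP/rowP => i; rewrite mxE; apply/eqP.
    exists i; rewrite lt_neqAle; apply/andP; split.
      by apply: contra vi; rewrite eq_sym => /eqP/Normc.eq0_normc ->.
    by rewrite /Normc.normc; case: (v 0 i) => a b; rewrite sqrtr_ge0.
  - move=> i.
    have := congr1 (fun w : 'rV_n => w 0 i) vB; rewrite !mxE => E.
    rewrite -Normc.normcM -E; apply: le_trans (normc_sum _ _) _.
    apply: ler_sum => j _; rewrite Normc.normcM !mxE normcR//.
    by rewrite mulrC.
apply/eqP; rewrite eq_le; apply/andP; split.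
  by apply: ge_sup => //; exists (perron_root B).
by apply: (ub_le_sup (ex_intro _ _ ubS)).
Qed.

End PerronFrobenius.

(** * Communicating classes *)

Section Classes.
Context {R : realType} {m : nat}.
Variables (P B : 'M[R]_m.+1).
Hypothesis B0 : nonneg_mx B.
Hypothesis BP : forall i j, (0 < B i j) = edge P i j.
Implicit Types (D H : {set 'I_m.+1}) (i j k : 'I_m.+1).

(** Restriction to [D] by zeros instead of a submatrix: the size stays fixed, so restrictions to
    different vertex sets act on the same vectors and compare entrywise with [B]. *)
Definition mask_mx D : 'M[R]_m.+1 :=
  \matrix_(i, j) (if (i \in D) && (j \in D) then B i j else 0).

Definition comm_class i : {set 'I_m.+1} :=
  [set j | connect (edge P) i j && connect (edge P) j i].

(** Separates the communicating classes that are strongly connected from the singletons carrying no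
    loop, since a path must use at least one edge. *)
Definition on_cycle i : Prop := exists2 j, edge P i j & connect (edge P) j i.

Lemma mask_mx_ge0 D : nonneg_mx (mask_mx D).
Proof. by move=> i j; rewrite mxE; case: ifP. Qed.

Lemma mask_mx_le D i j : mask_mx D i j <= B i j.
Proof. by rewrite mxE; case: ifP. Qed.

Lemma sum_mask_mx D i (x : 'I_m.+1 -> R) :
  i \in D -> \sum_j mask_mx D i j * x j = \sum_(j in D) B i j * x j.
Proof.
move=> iD; rewrite [RHS]big_mkcond; apply: eq_bigr => j _.
by rewrite mxE iD /=; case: ifP; rewrite ?mul0r.
Qed.

Lemma sum_mask_mx_out D i (x : 'I_m.+1 -> R) :
  i \notin D -> \sum_j mask_mx D i j * x j = 0.
Proof.
by move=> /negbTE iD; apply: big1 => j _; rewrite mxE iD mul0r.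
Qed.

Lemma subeigenvalue_mono (l l' : R) (C : 'M[R]_m.+1) :
  l' <= l -> subeigenvalue C l -> subeigenvalue C l'.
Proof.
move=> ll [x [x0 xp xl]]; exists x; split => // i.
by apply: le_trans (xl i); rewrite ler_wpM2r.
Qed.

Lemma subeigenvalue_mask D l : subeigenvalue (mask_mx D) l -> subeigenvalue B l.
Proof.
move=> [x [x0 xp xl]]; exists x; split => // i.
apply: le_trans (xl i) _; apply: ler_sum => j _.
by rewrite ler_wpM2r// mask_mx_le.
Qed.

(** A path between two vertices of a communicating class never leaves it, because each vertex on the
    way still leads back to the class. *)
Lemma connect_edge_in H i j : H = comm_class i -> i \in H -> j \in H ->
  forall k, k \in H -> connect (edge_in P H) j k.
Proof.
move=> HE iH jH k kH.
have [w pw kE] : exists2 w, path (edge P) j w & k = last j w.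
  apply/connectP; move: jH kH; rewrite HE !inE => /andP[_ ji] /andP[ik _].
  exact: connect_trans ji ik.
elim: w j jH pw kE => [|a w IH] j jH /=; first by move=> _ ->.
move=> /andP[ja pw] kE.
have aH : a \in H.
  move: jH kH; rewrite HE !inE => /andP[ij _] /andP[_ ki].
  rewrite (connect_trans ij (connect1 ja))/=.
  by apply: connect_trans ki; apply/connectP; exists w.
by apply: connect_trans (IH a aH pw kE); apply: connect1; rewrite /edge_in jH aH.
Qed.

Lemma comm_class_refl i : i \in comm_class i.
Proof. by rewrite inE !connect0. Qed.

Lemma comm_classE i j : j \in comm_class i -> comm_class j = comm_class i.
Proof.
rewrite inE => /andP[ij ji]; apply/setP => k; rewrite !inE; apply/andP/andP => -[].
  by move=> jk kj; rewrite (connect_trans ij jk) (connect_trans kj ji).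
by move=> ik ki; rewrite (connect_trans ji ik) (connect_trans ki ij).
Qed.

Lemma strongly_connected_sub H i : strongly_connected P H -> i \in H ->
  H \subset comm_class i.
Proof.
move=> [_ scH] iH; apply/fintype.subsetP => j jH; rewrite inE.
have con a b : a \in H -> b \in H -> connect (edge P) a b.
  move=> aH bH; have [w [_ pw wb]] := scH a b aH bH.
  apply/connectP; exists w => //; apply: sub_path pw => x y.
  by rewrite /edge_in => /and3P[].
by rewrite !con.
Qed.

Lemma comm_class_strongly_connected i :
  on_cycle i -> strongly_connected P (comm_class i).
Proof.
move=> [j ij ji]; split.
  by apply/finset.set0Pn; exists i; exact: comm_class_refl.
move=> a b aH bH.
have jH : j \in comm_class i by rewrite inE ji connect1.
have iH := comm_class_refl i.
have /connectP[w1 p1 E1] := connect_edge_in erefl iH aH iH.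
have /connectP[w2 p2 E2] := connect_edge_in erefl iH jH bH.
exists (w1 ++ j :: w2); split; first by case: (w1).
  by rewrite cat_path p1 -E1 /= p2 /edge_in iH jH ij.
by rewrite last_cat /= -E2.
Qed.

Lemma SC_comm_class i : on_cycle i -> SC P (comm_class i).
Proof.
move=> ci; split; first exact: comm_class_strongly_connected.
move=> K scK sK; apply/eqP; rewrite finset.eqEsubset sK andbT.
apply: strongly_connected_sub => //.
exact: (fintype.subsetP sK) (comm_class_refl i).
Qed.

Lemma SC_on_cycle H i : SC P H -> i \in H -> on_cycle i.
Proof.
move=> [[_ scH] _] iH; have [w [w0 pw wi]] := scH i i iH iH.
case: w w0 pw wi => // j w _ /= /andP[ij pw] wi; exists j.
  by move: ij; rewrite /edge_in => /and3P[].
apply/connectP; exists w => //; apply: sub_path pw => x y.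
by rewrite /edge_in => /and3P[].
Qed.

Lemma SC_eq_comm_class H i : SC P H -> i \in H -> H = comm_class i.
Proof.
move=> scH iH; have ci := SC_on_cycle scH iH.
case: scH => scH maxH; symmetry; apply: maxH.
  exact: comm_class_strongly_connected.
exact: strongly_connected_sub.
Qed.

Lemma SC_eq H1 H2 i : SC P H1 -> SC P H2 -> i \in H1 -> i \in H2 -> H1 = H2.
Proof.
by move=> s1 s2 i1 i2; rewrite (SC_eq_comm_class s1 i1) (SC_eq_comm_class s2 i2).
Qed.

Lemma SC_connect H i j : SC P H -> i \in H -> j \in H -> connect (edge_in P H) i j.
Proof. by move=> s iH jH; apply: (connect_edge_in (SC_eq_comm_class s iH) iH iH jH). Qed.

Lemma connect_edge_inW H i j : connect (edge_in P H) i j -> connect (edge P) i j.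
Proof.
by apply: connect_sub => x y /and3P[_ _ ?]; apply: connect1.
Qed.

(* Within the support of a subeigenvector, a class with no successor outside
   itself carries a subeigenvector on its own. *)
Lemma subeigenvalue_class D (l : R) : 0 < l -> subeigenvalue (mask_mx D) l ->
  exists i, [/\ i \in D, on_cycle i & subeigenvalue (mask_mx (comm_class i)) l].
Proof.
move=> l0 [x [x0 [i1 xi1] xl]].
pose S := [set j | 0 < x j]%SET.
have SD j : j \in S -> j \in D.
  rewrite inE => xj; apply: contraLR xj => jD; rewrite -leNgt.
  by rewrite -(ler_pM2l l0) mulr0 (le_trans (xl j))// sum_mask_mx_out.
have xS k : k \notin S -> x k = 0.
  by rewrite inE -leNgt => xk; apply/eqP; rewrite eq_le xk x0.
have Bk j k : ~~ edge P j k -> B j k = 0.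
  by rewrite -BP -leNgt => H; apply/eqP; rewrite eq_le H B0.
pose e := edge_in P S.
have closedS j k : connect e j k -> j \in S -> k \in S.
  move=> /connectP[w pw ->] jS; elim: w j jS pw => //= a w IH j jS /andP[].
  by move=> /and3P[_ aS _] pw; apply: IH.
have i1S : i1 \in S by rewrite inE.
pose reach j := [set k | connect e j k]%SET.
(* A support vertex with the fewest reachable support vertices lies in a terminal class: whatever it
   reaches has the same reachable set, hence reaches back. *)
case: (@arg_minnP _ i1 (mem S) (fun j => #|reach j|) i1S) => i0 i0S imin.
have back k : k \in reach i0 -> i0 \in reach k.
  rewrite inE => i0k; have kS := closedS _ _ i0k i0S.
  suff -> : reach k = reach i0 by rewrite inE connect0.
  apply/eqP; rewrite finset.eqEcard imin// andbT.
  by apply/fintype.subsetP => a; rewrite !inE; apply: connect_trans.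
have reachC k : k \in reach i0 -> k \in comm_class i0.
  move=> ki; have := back _ ki; move: ki.
  by rewrite !inE => /connect_edge_inW -> /connect_edge_inW ->.
have succ j : j \in reach i0 -> forall k, edge P j k -> k \in S -> k \in reach i0.
  move=> jr k jk kS; rewrite inE; move: (jr); rewrite inE => i0j.
  have jS := closedS _ _ i0j i0S.
  by apply: connect_trans i0j (connect1 _); rewrite /e /edge_in jS kS.
have xreach j : j \in reach i0 -> l * x j <= \sum_(k in reach i0) B j k * x k.
  move=> jr; have jS : j \in S by apply: (closedS i0); rewrite // -[connect _ _ _]inE.
  apply: le_trans (xl j) _; rewrite sum_mask_mx ?SD//.
  rewrite [leRHS]big_mkcond [leLHS]big_mkcond; apply: ler_sum => k _.
  have [kr|kr] := boolP (k \in reach i0).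
    by case: ifP => // _; rewrite mulr_ge0.
  have [->|] := eqVneq (B j k * x k) 0; first by case: ifP.
  move=> H; case/negP: kr; apply: (succ j jr).
    by apply: contraR H => /Bk ->; rewrite mul0r.
  by apply: contraR H => /xS ->; rewrite mulr0.
have i0r : i0 \in reach i0 by rewrite inE connect0.
have xi0 : 0 < x i0 by have : i0 \in S := i0S; rewrite inE.
exists i0; split; first exact: SD.
  (* Since [l * x i0 > 0], some term is nonzero; it gives an edge from [i0] into the terminal class,
     from which [i0] is reached again. *)
  have : \sum_(k in reach i0) B i0 k * x k != 0.
    by rewrite gt_eqF// (lt_le_trans _ (xreach _ i0r))// mulr_gt0.
  apply: contra_neqP => nc; apply: big1 => k kr.
  have [ik|/Bk ->] := boolP (edge P i0 k); last by rewrite mul0r.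
  case: nc; exists k => //; apply: (@connect_edge_inW S).
  by have := back _ kr; rewrite inE.
exists (fun j => if j \in reach i0 then x j else 0); split.
- by move=> j; case: ifP.
- by exists i0; rewrite i0r.
move=> j; case: ifP => jr; last first.
  rewrite mulr0; apply: sumr_ge0 => k _.
  by apply: mulr_ge0; [exact: mask_mx_ge0|case: ifP].
rewrite sum_mask_mx ?reachC//; apply: le_trans (xreach j jr) _.
rewrite big_mkcond [leRHS]big_mkcond; apply: ler_sum => k _.
by case: ifP => [kr|_]; [rewrite reachC|case: ifP; rewrite ?mulr0].
Qed.

Lemma perron_root_mask_le D : perron_root (mask_mx D) <= perron_root B.
Proof.
apply: perron_root_ge => //; apply: (@subeigenvalue_mask D).
by apply: perron_subeigenvalue => //; exact: mask_mx_ge0.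
Qed.

(** Subeigenvectors are extended by zero in one direction and restricted to [H] in the other. *)
Lemma perron_root_submx H : H != finset.set0 ->
  perron_root (mxsub enum_val enum_val B : 'M[R]_#|H|) = perron_root (mask_mx H).
Proof.
move=> H0; have cH : (0 < #|H|)%N by rewrite card_gt0.
have sub0 : nonneg_mx (mxsub enum_val enum_val B : 'M[R]_#|H|).
  by move=> i j; rewrite mxE.
have [h0 h0H] : exists h, h \in H by apply/finset.set0Pn.
have sumE (F : 'I_m.+1 -> R) : \sum_(j < #|H|) F (enum_val j) = \sum_(j in H) F j.
  by rewrite [RHS]big_enum_val.
apply/eqP; rewrite eq_le; apply/andP; split.
  apply: perron_root_ge => //; first exact: mask_mx_ge0.
  have [x [x0 [i xi] xl]] := perron_subeigenvalue cH sub0.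
  exists (fun j => if j \in H then x (enum_rank_in h0H j) else 0); split.
  - by move=> j; case: ifP.
  - by exists (enum_val i); rewrite enum_valP enum_valK_in.
  move=> j; case: ifPn => jH; last by rewrite sum_mask_mx_out// mulr0.
  rewrite sum_mask_mx// -sumE; apply: le_trans (xl _) _.
  apply: ler_sum => k _.
  by rewrite mxE enum_rankK_in// enum_valP enum_valK_in.
(* Only a positive value forces a subeigenvector of the masked matrix to vanish off [H]; otherwise
   nonnegativity of the Perron root suffices. *)
have [rho0|rho_gt0] := leP (perron_root (mask_mx H)) 0.
  by apply: le_trans rho0 _; apply: perron_root_ge0.
apply: perron_root_ge => //.
have [x [x0 [i xi] xl]] := perron_subeigenvalue (ltn0Sn m) (@mask_mx_ge0 H).
have iH : i \in H.
  apply: contraLR xi => jD; rewrite -leNgt.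
  by rewrite -(ler_pM2l rho_gt0) mulr0 (le_trans (xl i))// sum_mask_mx_out.
exists (fun j : 'I_#|H| => x (enum_val j)); split => //.
  by exists (enum_rank_in h0H i); rewrite enum_rankK_in.
move=> j; apply: le_trans (xl _) _; rewrite sum_mask_mx ?enum_valP// -sumE.
by apply: ler_sum => k _; rewrite mxE.
Qed.

(** Positivity travels backwards along the edges of [H]: for an edge from [i] to [a],
    [l z_i >= B_ia z_a]. *)
Lemma class_positive H (l : R) (z : 'I_m.+1 -> R) : SC P H -> 0 < l ->
  (forall i, 0 <= z i) -> (exists2 i, i \in H & 0 < z i) ->
  (forall i, i \in H -> \sum_(j in H) B i j * z j <= l * z i) ->
  forall i, i \in H -> 0 < z i.
Proof.
move=> scH l0 z0 [i1 i1H zi1] zl i iH.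
have /connectP[w pw iE] := SC_connect scH iH i1H.
elim: w i iH pw iE => [|a w IH] i iH /=; first by move=> _ <-.
move=> /andP[/and3P[_ aH ia] pw] iE.
have za := IH a aH pw iE.
rewrite -(pmulr_rgt0 _ l0); apply: lt_le_trans (zl i iH).
rewrite (bigD1 a)//= ltr_pwDl//; first by rewrite mulr_gt0// BP.
by apply: sumr_ge0 => k _; rewrite mulr_ge0.
Qed.

Definition critical_class H : Prop := SC P H /\ perron_root (mask_mx H) = 1.

(** The number 2 serves as a value above the Perron root 1 of [H]; positivity on the whole class
    comes from [class_positive], started where [G > 0]. *)
Lemma class_resolvent H (G : 'I_m.+1 -> R) : critical_class H ->
  (forall i, 0 <= G i) -> (exists2 i, i \in H & 0 < G i) ->
  exists z : 'I_m.+1 -> R, [/\ forall i, 0 <= z i, forall i, i \in H -> 0 < z i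
    & forall i, i \in H -> 2 * z i = \sum_(j in H) B i j * z j + G i].
Proof.
move=> [scH rho1] G0 [i iH Gi].
have nl : ~ subeigenvalue (mask_mx H) 2.
  move=> /(perron_root_ge (ltn0Sn m) (@mask_mx_ge0 H)); rewrite rho1; lra.
have [z [z0 zE]] := resolvent_solve (@mask_mx_ge0 H) (ltr0Sn R 1) nl G0.
have zE' j : j \in H -> 2 * z j = \sum_(k in H) B j k * z k + G j.
  by move=> jH; rewrite zE sum_mask_mx.
exists z; split => //; apply: (class_positive scH (ltr0Sn R 1) z0).
  exists i => //; rewrite -(pmulr_rgt0 _ (ltr0Sn R 1)) zE'//.
  by rewrite ltr_wpDl// sumr_ge0// => k _; rewrite mulr_ge0.
by move=> j jH; rewrite zE'// lerDl.
Qed.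

(** If the subeigenvector [u] for the value 1 were strict at one vertex of [H], the resolvent at 2
    would spread the strictness over all of [H], and a value slightly above 1 would be a
    subeigenvalue. *)
Lemma critical_eigenvector H : critical_class H ->
  exists u : 'I_m.+1 -> R, [/\ forall i, i \in H -> 0 < u i,
    forall i, i \notin H -> u i = 0
    & forall i, i \in H -> \sum_(j in H) B i j * u j = u i].
Proof.
move=> cH; have [scH rho1] := cH.
have := perron_subeigenvalue (ltn0Sn m) (@mask_mx_ge0 H).
rewrite rho1 => -[u [u0 [i0 ui0] ul]].
have uout i : i \notin H -> u i = 0.
  move=> iH; apply/eqP; rewrite eq_le u0 andbT.
  by have := ul i; rewrite mul1r sum_mask_mx_out.
have i0H : i0 \in H by apply: contraLR ui0 => /uout ->; rewrite ltxx.
have ul' i : i \in H -> u i <= \sum_(j in H) B i j * u j.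
  by move=> iH; have := ul i; rewrite mul1r sum_mask_mx.
suff uE i : i \in H -> \sum_(j in H) B i j * u j = u i.
  exists u; split => //; apply: (class_positive scH ltr01 u0); first by exists i0.
  by move=> i iH; rewrite uE// mul1r.
move=> iH; apply/eqP; apply: contrapT => /negP neq; have {}neq : u i < \sum_(j in H) B i j * u j.
  by rewrite lt_neqAle eq_sym neq ul'.
have [v [v0 vp vE]] := class_resolvent cH u0 (ex_intro2 _ _ i0 i0H ui0).
(* [v = (2 - B)^-1 u] satisfies [B v > v] on [H], strictly. *)
have [w wdef] : exists w : 'I_m.+1 -> R,
    forall k, w k = \sum_(j in H) B k j * v j - v k by eexists.
have [G Gdef] : exists G : 'I_m.+1 -> R, forall k,
    G k = if k \in H then \sum_(j in H) B k j * u j - u k else 0 by eexists.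
have G0 k : 0 <= G k by rewrite Gdef; case: ifP => // kH; rewrite subr_ge0 ul'.
have wE k : k \in H -> 2 * w k = \sum_(j in H) B k j * w j + G k.
  move=> kH; rewrite Gdef kH wdef.
  have E1 : \sum_(j in H) B k j * w j = \sum_(j in H) B k j * (v j - u j).
    by apply: eq_bigr => j jH; rewrite wdef; congr (_ * _); have := vE j jH; lra.
  have E2 : \sum_(j in H) B k j * (v j - u j) =
    \sum_(j in H) B k j * v j - \sum_(j in H) B k j * u j.
    by rewrite -sumrB; apply: eq_bigr => j _; rewrite mulrBr.
  by rewrite E1 E2; have := vE k kH; lra.
have nl : ~ subeigenvalue (mask_mx H) 2.
  move=> /(perron_root_ge (ltn0Sn m) (@mask_mx_ge0 H)); rewrite rho1; lra.
have [w' [w'in w'out]] : exists w' : 'I_m.+1 -> R,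
    (forall k, k \in H -> w' k = w k) /\ (forall k, k \notin H -> w' k = 0).
  exists (fun k => if k \in H then w k else 0).
  by split => k kH; [rewrite kH|rewrite (negbTE kH)].
have w'E k : k \in H -> \sum_(j in H) B k j * w' j = \sum_(j in H) B k j * w j.
  by move=> kH; apply: eq_bigr => j jH; rewrite w'in.
have w'0 : forall k, 0 <= w' k.
  apply: (resolvent_monotone (@mask_mx_ge0 H) (ltr0Sn R 1) nl) => k.
  have [kH|kH] := boolP (k \in H); last first.
    by rewrite sum_mask_mx_out// w'out// mulr0.
  by rewrite sum_mask_mx// w'E// w'in// wE// lerDl.
have w'p : forall k, k \in H -> 0 < w' k.
  apply: (class_positive scH (ltr0Sn R 1) w'0); last first.
    by move=> k kH; rewrite w'E// w'in// wE// lerDl.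
  exists i => //; rewrite -(pmulr_rgt0 _ (ltr0Sn R 1)) w'in// wE//.
  rewrite -w'E// ltr_wpDl ?sumr_ge0//; last by rewrite Gdef iH subr_gt0.
  by move=> k _; rewrite mulr_ge0.
pose V := \sum_j v j.
have vV j : v j <= V by rewrite /V (bigD1 j)//= lerDl sumr_ge0.
have V0 : 0 < V by apply: lt_le_trans (vp i iH) (vV i).
pose d := \big[Num.min/1]_(j in H) w' j.
have d0 : 0 < d.
  by rewrite /d; elim/big_ind : _ => // a b a0 b0; rewrite lt_min a0 b0.
have dw j : j \in H -> d <= w' j by move=> jH; rewrite /d (bigD1 j)//= ge_min lexx.
(* The gap [w' = B v - v] is at least [d] on [H] and [v] is at most [V], so [v] tolerates the factor
   [1 + d / V]. *)
have : 1 + d / V <= perron_root (mask_mx H).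
  apply: perron_root_ge => //; first exact: mask_mx_ge0.
  exists (fun k => if k \in H then v k else 0); split.
  - by move=> k; case: ifP.
  - by exists i; rewrite iH vp.
  move=> k; have [kH|kH] := boolP (k \in H); last by rewrite sum_mask_mx_out// mulr0.
  rewrite sum_mask_mx// mulrDl mul1r.
  rewrite (_ : \sum_(_ in _) _ = v k + w' k); last first.
    by rewrite w'in// wdef addrC subrK; apply: eq_bigr => j jH; rewrite jH.
  rewrite lerD2l; apply: le_trans (dw k kH).
  by rewrite mulrAC ler_pdivrMr// ler_wpM2l// ltW.
rewrite rho1; have : 0 < d / V by rewrite divr_gt0.
lra.
Qed.

Hypothesis rhoB : perron_root B = 1.

(** A subeigenvalue 1 on [D] would be carried by a single class through a vertex of [D]; its Perron
    root would be squeezed between 1 and that of [B], so the class would be critical. *)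
Lemma subcritical_mask D : (forall H i, critical_class H -> i \in H -> i \notin D) ->
  perron_root (mask_mx D) < 1.
Proof.
move=> HD; rewrite ltNge; apply/negP => rho1.
have : subeigenvalue (mask_mx D) 1.
  apply: subeigenvalue_mono rho1 _; apply: perron_subeigenvalue => //.
  exact: mask_mx_ge0.
move=> /(subeigenvalue_class ltr01)[i [iD ci /(perron_root_ge (ltn0Sn m))]].
move=> /(_ (@mask_mx_ge0 _)) rge1.
have : critical_class (comm_class i).
  split; first exact: SC_comm_class.
  by apply/eqP; rewrite eq_le rge1 -rhoB perron_root_mask_le.
by move=> /HD /(_ (comm_class_refl i)); rewrite iD.
Qed.

Lemma exists_critical_class : exists H, critical_class H.
Proof.
apply: contrapT => nH.
have : perron_root (mask_mx [set: 'I_m.+1]%SET) < 1.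
  by apply: subcritical_mask => H i cH; case: nH; exists H.
suff -> : mask_mx [set: 'I_m.+1]%SET = B by rewrite rhoB ltxx.
by apply/matrixP => i j; rewrite mxE !inE.
Qed.

End Classes.

(** * Growth of the number of words in a cut *)

Ltac nonneg := solve [repeat first [ done | by apply: ltW | exact: powR_ge0
  | by rewrite subr_ge0 ltW
  | apply: mulr_ge0 | apply: addr_ge0 | rewrite invr_ge0 | lra ]].

Section RealLemmas.
Context {R : realType}.

(** Turns a goal into an earlier inequality plus a polynomial identity, which [ring] settles. *)
Lemma le_shift (x y a b : R) : x <= y -> b - a = y - x -> a <= b.
Proof. by move=> xy E; rewrite -subr_ge0 E subr_ge0. Qed.

Lemma exists_small_exponent (a l : R) : 0 < a -> a < 1 -> 0 < l -> l < 1 ->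
  exists k, [/\ 0 < k, k < 1 & a `^ (- k) * l <= 1].
Proof.
move=> a0 a1 l0 l1.
have lna : ln a < 0 by rewrite ln_lt0// a0 a1.
have lnl : ln l < 0 by rewrite ln_lt0// l0 l1.
(* In logarithms the condition is [k <= ln l / ln a]; dividing by [ln a + ln l] instead also keeps
   [k] below 1. *)
exists (ln l / (ln a + ln l)); split.
- by rewrite nmulr_rgt0// invr_lt0; lra.
- by rewrite ltr_ndivrMr ?mul1r; lra.
rewrite /powR gt_eqF// -[X in _ * X]lnK ?posrE// -expRD -[leRHS]expR0 ler_expR.
rewrite mulNr addrC subr_le0.
have -> : ln l / (ln a + ln l) * ln a = ln l * (ln a / (ln a + ln l)) by ring.
rewrite ler_nMr// ler_ndivrMr; lra.
Qed.

Lemma finite_pos_lb (I : finType) (A : pred I) (u : I -> R) :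
  (forall i, A i -> 0 < u i) -> exists2 d, 0 < d & forall i, A i -> d <= u i.
Proof.
move=> up; exists (\big[Num.min/1]_(i | A i) u i).
  by elim/big_ind : _ => // a b a0 b0; rewrite lt_min a0 b0.
by move=> i Ai; rewrite (bigD1 i)//= ge_min lexx.
Qed.

End RealLemmas.

Section Counting.
Context {R : realType} {m : nat}.
Variables (P B : 'M[R]_m.+1).
Implicit Types (D H : {set 'I_m.+1}) (i j k : 'I_m.+1).

(* The number of words that start at [i] and are stopped as soon as [y] times
   the product of the entries of [B] along the word drops below 1; the fuel
   [n] bounds the length of these words. *)
Fixpoint count_cut (n : nat) i (y : R) : nat :=
  if n is n'.+1 then
    if y < 1 then 1%N
    else (\sum_(j | (0 < B i j)%R) count_cut n' j (B i j * y)%R)%N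
  else 1%N.

(** Comparison from above. A step is made only from [y >= 1] and multiplies by at least [mu], so no
    branch ends with [y < mu], whether it stops by the rule or by lack of fuel. *)
Lemma count_cut_le (f : 'I_m.+1 -> R -> R) (mu : R) :
  (forall i j, 0 < B i j -> mu <= B i j) -> 0 < mu ->
  (forall i y, mu <= y -> 1 <= f i y) ->
  (forall i y, 1 <= y -> \sum_(j | 0 < B i j) f j (B i j * y) <= f i y) ->
  forall n i y, mu <= y -> (count_cut n i y)%:R <= f i y.
Proof.
move=> Bmu mu0 f1 fS; elim=> [|n IH] i y muy /=; first exact: f1.
case: ltP => y1; first exact: f1.
rewrite natr_sum; apply: le_trans (fS i y y1); apply: ler_sum => j bij.
by apply: IH; rewrite -[mu]mulr1 ler_pM ?Bmu// ltW.
Qed.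

(** Comparison from below on a set [S] closed under edges. The condition [beta ^+ n * y < 1]
    guarantees that a branch running out of fuel has already dropped below 1, where [g <= 1] is
    available. *)
Lemma count_cut_ge (S : 'I_m.+1 -> bool) (g : 'I_m.+1 -> R -> R) (beta : R) :
  (forall i j, S i -> 0 < B i j -> S j) ->
  (forall i j, B i j <= beta) -> 0 < beta ->
  (forall i y, S i -> 0 < y < 1 -> g i y <= 1) ->
  (forall i y, S i -> 1 <= y -> g i y <= \sum_(j | 0 < B i j) g j (B i j * y)) ->
  forall n i y, S i -> 0 < y -> beta ^+ n * y < 1 -> g i y <= (count_cut n i y)%:R.
Proof.
move=> SS Bb b0 g1 gS; elim=> [|n IH] i y Si y0 /=.
  by rewrite expr0 mul1r => y1; apply: g1 => //; rewrite y0 y1.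
move=> yb; case: ltP => y1; first by apply: g1 => //; rewrite y0 y1.
rewrite natr_sum; apply: le_trans (gS i y Si y1) _; apply: ler_sum => j bij.
apply: IH; [exact: SS Si bij|exact: mulr_gt0|].
apply: le_lt_trans yb; rewrite exprSr -mulrA ler_wpM2l ?exprn_ge0 ?(ltW b0)//.
by rewrite ler_wpM2r// ltW.
Qed.

Hypothesis B0 : nonneg_mx B.
Hypothesis BP : forall i j, (0 < B i j) = edge P i j.
Hypothesis rhoB : perron_root B = 1.
Variables mu beta : R.
Hypothesis mu0 : 0 < mu.
Hypothesis mu1 : mu < 1.
Hypothesis Bmu : forall i j, 0 < B i j -> mu <= B i j.
Hypothesis beta01 : 0 < beta < 1.
Hypothesis Bbeta : forall i j, B i j <= beta.

Let crit := critical_class P B.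

Lemma sum_support i (F : 'I_m.+1 -> R) :
  \sum_(j | 0 < B i j) B i j * F j = \sum_j B i j * F j.
Proof.
rewrite big_mkcond; apply: eq_bigr => j _; case: ltP => // bij.
by rewrite (_ : B i j = 0) ?mul0r//; apply/eqP; rewrite eq_le bij B0.
Qed.

(** The eigenvector of a critical class, extended by zero, gives a subsolution linear in [y], as
    edges leaving the class only add to the count. Division by the sum [U] makes it at most 1 for
    [y < 1]. *)
Lemma count_cut_linear_ge : exists i (c : R), 0 < c /\
  forall n y, 1 <= y -> beta ^+ n * y < 1 -> c * y <= (count_cut n i y)%:R.
Proof.
have [b0 b1] := andP beta01.
have [H cH] := exists_critical_class B0 BP rhoB.
have [scH _] := cH; have [[/finset.set0Pn[i0 i0H] _] _] := scH.
have [u [up uout uE]] := critical_eigenvector B0 BP cH.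
have u0 i : 0 <= u i.
  by have [/up/ltW//|/uout->] := boolP (i \in H).
pose U := \sum_i u i.
have uU i : u i <= U by rewrite /U (bigD1 i)//= lerDl sumr_ge0.
have U0 : 0 < U by apply: lt_le_trans (up i0 i0H) (uU i0).
exists i0, (u i0 / U); split; first by rewrite divr_gt0// up.
move=> n y y1 yb.
apply: (@count_cut_ge xpredT (fun i y => u i / U * y) beta) => //; last 1 first.
- by rewrite (lt_le_trans _ y1).
- move=> i {yb} {}y _ /andP[y0 {}y1]; apply: mulr_ile1; [|exact: ltW| |exact: ltW].
    by rewrite divr_ge0// ltW.
  by rewrite ler_pdivrMr// mul1r.
- move=> i {yb} {}y _ {}y1.
  have -> : \sum_(j | 0 < B i j) u j / U * (B i j * y) =
    (\sum_j B i j * u j) / U * y.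
    rewrite -sum_support !mulr_suml; apply: eq_bigr => j _.
    by rewrite mulrCA !mulrA.
  rewrite ler_wpM2r ?(le_trans ler01)// ler_wpM2r ?invr_ge0 ?(ltW U0)//.
  have [iH|iH] := boolP (i \in H); last first.
    by rewrite uout// sumr_ge0// => j _; rewrite mulr_ge0.
  rewrite -uE// big_mkcond; apply: ler_sum => j _.
  by case: ifP => // _; rewrite mulr_ge0.
Qed.

(** The extra exponent [t] yields a factor [beta ^ t < 1] per edge, leaving room for a resolvent
    strictly above the spectral radius 1. *)
Lemma power_factor_le i j (t y : R) : 0 <= t -> 0 < B i j -> 0 < y ->
  (B i j * y) `^ (1 + t) <= B i j * beta `^ t * y `^ (1 + t).
Proof.
move=> t0 bij /ltW y0; have bij' := ltW bij.
rewrite powRM// ler_wpM2r ?powR_ge0//.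
rewrite powRD ?(gt_eqF bij) ?implybT// powRr1 ?(ltW bij)//.
by rewrite ler_wpM2l ?(ltW bij)// ge0_ler_powR// nnegrE ltW// (lt_le_trans bij).
Qed.

(** The supersolution is [C0 v_i y^(1+t)] with [v] the resolvent at [l = beta^-t > 1] applied to the
    constant 1: the factor [l] lost in [B v <= l v] is regained by [power_factor_le]. As [v >= 1/l],
    the choice of [C0] makes it at least 1 for [y >= mu]. *)
Lemma count_cut_power_le (t : R) : 0 < t -> exists C : R, 0 < C /\
  forall n i y, 1 <= y -> (count_cut n i y)%:R <= C * y `^ (1 + t).
Proof.
have [b0 b1] := andP beta01.
move=> t0; pose l := (beta `^ t)^-1.
have bt0 : 0 < beta `^ t by rewrite powR_gt0.
have l1 : 1 < l.
  rewrite invf_gt1// /powR (gt_eqF b0) -[ltRHS]expR0 ltr_expR.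
  by rewrite pmulr_rlt0// ln_lt0// beta01.
have l0 : 0 < l by apply: lt_trans l1.
have nl : ~ subeigenvalue B l.
  by move=> /(perron_root_ge (ltn0Sn m) B0); rewrite rhoB leNgt l1.
have [v [v0 vE]] := resolvent_solve B0 l0 nl (fun=> ler01).
have vge i : l^-1 <= v i.
  rewrite -(ler_pM2l l0) mulfV ?gt_eqF// vE lerDr sumr_ge0// => j _.
  by rewrite mulr_ge0.
pose C0 := l / mu `^ (1 + t); pose V := \sum_i v i.
have C00 : 0 < C0 by rewrite divr_gt0// powR_gt0.
have vV i : v i <= V by rewrite /V (bigD1 i)//= lerDl sumr_ge0.
have V0 : 0 < V by apply: lt_le_trans (vV ord0); apply: lt_le_trans (vge ord0); rewrite invr_gt0.
exists (C0 * V); split; first exact: mulr_gt0.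
move=> n i y y1.
apply: (@le_trans _ _ (C0 * v i * y `^ (1 + t))); last first.
  by rewrite ler_wpM2r ?powR_ge0// ler_wpM2l// ltW.
have t10 : 0 <= 1 + t by rewrite addr_ge0// ltW.
apply: (@count_cut_le (fun i y => C0 * v i * y `^ (1 + t)) mu) => //.
- move=> {n y1} {}i {}y muy; have y0 : 0 < y by apply: lt_le_trans muy.
  apply: (@le_trans _ _ (C0 * l^-1 * mu `^ (1 + t))).
    by rewrite /C0 mulrAC mulfVK ?gt_eqF ?powR_gt0// mulfV ?gt_eqF.
  apply: ler_pM; rewrite ?powR_ge0//.
  + by rewrite mulr_ge0 ?ltW// invr_gt0.
  + by rewrite ler_wpM2l// ltW.
  + by rewrite ge0_ler_powR// nnegrE ltW.
- move=> {n} {}i {y1} {}y y1; have y0 : 0 < y by apply: lt_le_trans y1.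
  apply: (@le_trans _ _ (\sum_(j | 0 < B i j)
      B i j * (v j * (C0 * (beta `^ t * y `^ (1 + t)))))).
    apply: ler_sum => j bij.
    have -> : B i j * (v j * (C0 * (beta `^ t * y `^ (1 + t)))) =
      C0 * v j * (B i j * beta `^ t * y `^ (1 + t)) by ring.
    rewrite ler_wpM2l//; first by rewrite mulr_ge0// ltW.
    by apply: power_factor_le => //; rewrite ltW.
  rewrite sum_support; under eq_bigr do rewrite mulrA.
  rewrite -mulr_suml.
  have -> : C0 * v i * y `^ (1 + t) = l * v i * (C0 * (beta `^ t * y `^ (1 + t))).
    by rewrite /l; field; rewrite gt_eqF.
  rewrite ler_wpM2r//; last by rewrite vE lerDl.
  by apply: mulr_ge0; [exact: ltW|rewrite mulr_ge0 ?powR_ge0].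
- by rewrite (le_trans (ltW mu1)).
Qed.

(** The resolvent of the restriction, at [l] midway between its Perron root and 1, applied to the
    constant 1. From [l v >= 1] and [l < 1] follows [v >= 1]. *)
Lemma subcritical_supersolution D :
  (forall H i, crit H -> i \in H -> i \notin D) ->
  exists l (v : 'I_m.+1 -> R), [/\ 0 < l < 1, forall i, 1 <= v i
    & forall i, i \in D -> \sum_(j in D) B i j * v j <= l * v i].
Proof.
move=> /(subcritical_mask B0 BP rhoB); set rho := perron_root _ => rho1.
have rho0 : 0 <= rho by apply: perron_root_ge0 => //; exact: mask_mx_ge0.
pose l := (1 + rho) / 2; have l0 : 0 < l by rewrite /l; lra.
have l1 : l < 1 by rewrite /l; lra.
have nl : ~ subeigenvalue (mask_mx B D) l.
  move=> /(perron_root_ge (ltn0Sn m) (mask_mx_ge0 B0 D)).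
  by rewrite -/rho /l; lra.
have [v [v0 vE]] := resolvent_solve (mask_mx_ge0 B0 D) l0 nl (fun=> ler01).
exists l, v; split => [|i|i iD]; first by rewrite l0 l1.
  apply: (@le_trans _ _ (l * v i)); last by rewrite ler_piMl// ltW.
  rewrite vE lerDr sumr_ge0// => j _.
  by rewrite mulr_ge0// mask_mx_ge0.
by rewrite vE sum_mask_mx// lerDl.
Qed.

(* A supersolution on the three kinds of vertices: [y ^ p] with [p < 1] on those
   that reach no critical class, [y] minus a multiple of [y ^ p] on the critical
   classes, where the correction pays for the edges leaving the class, and a
   large multiple of [y] upstream of them. *)
Lemma count_cut_linear_le :
  (forall H1 H2, crit H1 -> crit H2 -> H1 != H2 -> ~ precedes P H1 H2) ->
  exists C : R, 0 < C /\
  forall n i y, 1 <= y -> (count_cut n i y)%:R <= C * y.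
Proof.
have [b0 b1] := andP beta01.
move=> incomp.
have [iscrit iscritP] : {f : pred 'I_m.+1 &
    forall i, reflect (exists2 H, crit H & i \in H) (f i)}.
  by exists (fun i => `[< exists2 H, crit H & i \in H >]) => i; apply: asboolP.
pose reaches i := [exists j, iscrit j && connect (edge P) i j].
pose C := [set i | iscrit i]%SET.
pose D := [set i | ~~ reaches i]%SET.
pose U := [set i | ~~ iscrit i && reaches i]%SET.
have CP i : i \in C -> crit (comm_class P i) .
  rewrite inE => /iscritP[H cH iH].
  by rewrite -(SC_eq_comm_class cH.1 iH).
have critC H i : crit H -> i \in H -> i \in C.
  by move=> cH iH; rewrite inE; apply/iscritP; exists H.
have Creach i : i \in C -> reaches i.
  by rewrite inE => iC; apply/existsP; exists i; rewrite iC connect0.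
have reachC i j : reaches j -> edge P i j -> reaches i.
  move=> /existsP[k /andP[kC jk]] ij; apply/existsP; exists k; rewrite kC.
  exact: connect_trans (connect1 ij) jk.
have [lD [vD [/andP[lD0 lD1] vD1 vDE]]] : exists l (v : 'I_m.+1 -> R),
    [/\ 0 < l < 1, forall i, 1 <= v i
    & forall i, i \in D -> \sum_(j in D) B i j * v j <= l * v i].
  apply: subcritical_supersolution => H i cH iH.
  by rewrite inE negbK; apply/Creach/(critC H).
have [lU [vU [/andP[lU0 lU1] vU1 vUE]]] : exists l (v : 'I_m.+1 -> R),
    [/\ 0 < l < 1, forall i, 1 <= v i
    & forall i, i \in U -> \sum_(j in U) B i j * v j <= l * v i].
  apply: subcritical_supersolution => H i cH iH.
  by have := critC H i cH iH; rewrite !inE => ->.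
have /choice[uu uuP] : forall H, exists u : 'I_m.+1 -> R, crit H ->
    [/\ forall i, i \in H -> 0 < u i, forall i, i \notin H -> u i = 0
    & forall i, i \in H -> \sum_(j in H) B i j * u j = u i].
  move=> H; have [cH|nH] := pselect (crit H); last by exists (fun=> 0).
  by have [u uP] := critical_eigenvector B0 BP cH; exists u.
(* The eigenvectors of all critical classes are glued together. By incomparability no edge joins two
   distinct critical classes ([CC]), so the glued vector is still an eigenvector on [C]. *)
pose u i := if i \in C then uu (comm_class P i) i else 0.
have up i : i \in C -> 0 < u i.
  move=> iC; rewrite /u iC; have [+ _ _] := uuP _ (CP i iC).
  by apply; exact: comm_class_refl.
have u0 i : 0 <= u i.
  by have [/up/ltW//|iC] := boolP (i \in C); rewrite /u (negbTE iC).
have CC i j : i \in C -> j \in C -> edge P i j -> j \in comm_class P i.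
  move=> iC jC ij; have [E|neq] := eqVneq (comm_class P i) (comm_class P j).
    by rewrite E comm_class_refl.
  case: (incomp _ _ (CP i iC) (CP j jC) neq); exists i, [:: j].
  by rewrite /= ij !comm_class_refl.
have uE i : i \in C -> \sum_(j in C) B i j * u j = u i.
  move=> iC; have [_ _ E] := uuP _ (CP i iC).
  rewrite {2}/u iC -E ?comm_class_refl//.
  rewrite [LHS]big_mkcond [RHS]big_mkcond; apply: eq_bigr => j _.
  have [jH|jH] := boolP (j \in comm_class P i).
    have jC : j \in C by apply: critC (CP i iC) jH.
    by rewrite jC /u jC (comm_classE jH).
  case: ifP => // jC; rewrite (_ : B i j = 0) ?mul0r//.
  apply/eqP; rewrite eq_le B0 andbT leNgt BP.
  by apply: contra jH; apply: CC.
(* A successor of a critical vertex that reaches a critical class lies in the class it came from;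
   hence edges leaving a critical class end in [D]. *)
have CU i j : i \in C -> edge P i j -> j \notin U.
  move=> iC ij; rewrite inE negb_and negbK; apply/orP.
  have [/existsP[k /andP[kC jk]]|] := boolP (reaches j); last by right.
  left; suff : j \in C by rewrite inE.
  have kC' : k \in C by rewrite inE.
  have [E|neq] := eqVneq (comm_class P i) (comm_class P k).
    apply: (critC (comm_class P i)) (CP i iC) _.
    rewrite inE connect1//=; apply: connect_trans jk _.
    have : k \in comm_class P i by rewrite E comm_class_refl.
    by rewrite inE => /andP[].
  have /connectP[w pw kw] := jk.
  case: (incomp _ _ (CP i iC) (CP k kC') neq); exists i, (j :: w).
  by rewrite /= ij pw -kw !comm_class_refl.
have DD i j : i \in D -> edge P i j -> j \in D.
  by rewrite !inE => + ij; apply: contra => /reachC; apply.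
have [d d0 du] := finite_pos_lb up.
(* On [D] one has [B^p <= B mu^-kap] for [p = 1 - kap]; [kap] is so small that the margin [lD < 1]
   absorbs [mu^-kap]. *)
have [kap [kap0 kap1 mukap]] := exists_small_exponent mu0 mu1 lD0 lD1.
pose p := 1 - kap.
have p0 : 0 < p by rewrite /p; lra.
have p1 : p < 1 by rewrite /p; lra.
have pw_edge i j : 0 < B i j -> B i j `^ p = B i j * B i j `^ (- kap).
  move=> bij; have Bn := gt_eqF bij.
  by rewrite /p powRD ?Bn ?implybT// powRr1// ltW.
have mono (x y : R) : 0 < x -> x <= y -> y `^ (- kap) <= x `^ (- kap).
  move=> x0 xy; have y0 : 0 < y by apply: lt_le_trans xy.
  rewrite !powRN lef_pV2 ?posrE ?powR_gt0//.
  by apply: ge0_ler_powR => //; rewrite ?nnegrE ltW.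
(* Relative gain of the power [p] over the linear term: [B^p >= (1 + eta) B]. The subtracted part on
   [C] thus leaves a surplus [A3 eta u y^p] at every step. *)
pose eta := beta `^ (- kap) - 1.
have eta0 : 0 < eta.
  rewrite subr_gt0 powRN invf_gt1 ?powR_gt0//.
  rewrite /powR gt_eqF// -expR0 ltr_expR pmulr_rlt0// ln_lt0//.
pose V := \sum_i vD i; pose W := \sum_i u i; pose Z := \sum_i vU i.
have vD0 i : 0 <= vD i by apply: le_trans (vD1 i).
have vU0 i : 0 <= vU i by apply: le_trans (vU1 i).
have vDV i : vD i <= V by rewrite /V (bigD1 i)//= lerDl sumr_ge0.
have V0 : 0 <= V by rewrite sumr_ge0.
have uW i : u i <= W by rewrite /W (bigD1 i)//= lerDl sumr_ge0.
have W0 : 0 <= W by rewrite sumr_ge0.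
have vUZ i : vU i <= Z by rewrite /Z (bigD1 i)//= lerDl sumr_ge0.
have Z0 : 0 <= Z by rewrite sumr_ge0.
have mp0 : 0 < mu `^ p by rewrite powR_gt0.
(* [A1] makes [f >= 1] on [D] at [y = mu]; [A3] makes the surplus [A3 eta d] on [C] equal to the
   bound [A1 V] for the children in [D]; [A2] keeps [f >= u y / (d mu) >= 1] on [C] after the
   subtraction; [A4] pays, through the margin [1 - lU], for the children in [C] and [D], and its
   summand [mu^-1] gives [f >= 1] on [U]. *)
pose A1 := (mu `^ p)^-1.
have A10 : 0 < A1 by rewrite invr_gt0.
pose A3 := A1 * V / (eta * d).
have A30 : 0 <= A3 by rewrite divr_ge0// ?mulr_ge0// ltW.
pose A2 := A3 * mu `^ (- kap) + (d * mu)^-1.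
have A20 : 0 <= A2.
  nonneg.
pose A4 := (A2 * W + A1 * V) / (1 - lU) + mu^-1.
have A4pos : 0 <= (A2 * W + A1 * V) / (1 - lU).
  nonneg.
have A40 : 0 <= A4 by rewrite addr_ge0// invr_ge0 ltW.
pose f i y := if i \in C then A2 * u i * y - A3 * u i * y `^ p
  else if i \in D then A1 * vD i * y `^ p else A4 * vU i * y.
have ypE y : 0 < y -> y `^ p = y * y `^ (- kap).
  by move=> y0; have yn := gt_eqF y0; rewrite /p powRD ?yn ?implybT// powRr1// ltW.
have yp_le y : 1 <= y -> y `^ p <= y by move=> y1; rewrite ler1_powR// ltW.
have Bp1 i j : 0 < B i j -> B i j `^ p <= 1.
  move=> /ltW bij; have <- : 1 `^ p = 1 :> R by rewrite powR1.
  apply: ge0_ler_powR; rewrite ?nnegrE ?(ltW p0)//.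
  by rewrite (le_trans (Bbeta i j))// ltW.
have CnD i : i \in C -> i \notin D by move=> /Creach; rewrite inE negbK.
have CnU i : i \in C -> i \notin U by rewrite !inE => ->.
have DnU i : i \in D -> i \notin U by rewrite !inE => /negbTE ->; rewrite andbF.
have cover i : [|| i \in C, i \in D | i \in U].
  by rewrite !inE; case: (iscrit i); case: (reaches i).
have sum_split (F : 'I_m.+1 -> R) i : \sum_(j | 0 < B i j) F j =
    \sum_(j | (0 < B i j) && (j \in C)) F j + \sum_(j | (0 < B i j) && (j \in D)) F j
    + \sum_(j | (0 < B i j) && (j \in U)) F j.
  rewrite (bigID (mem C))/= -addrA; congr (_ + _).
  rewrite (bigID (mem D))/=; congr (_ + _); apply: eq_bigl => j.
    have := @CnD j; case: (0 < B i j) => //=.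
    by case: (j \in C); case: (j \in D) => //= /(_ isT).
  have := cover j; have := @CnU j; have := @DnU j.
  by case: (0 < B i j) => //=; case: (j \in C); case: (j \in D); case: (j \in U) => //= h1 h2; rewrite ?(h1 isT) ?(h2 isT)//; have := h1 isT; have := h2 isT.
have drop (A : {set 'I_m.+1}) i (F : 'I_m.+1 -> R) : (forall j, 0 <= F j) ->
    \sum_(j | (0 < B i j) && (j \in A)) F j <= \sum_(j in A) F j.
  move=> F0; rewrite big_mkcond [leRHS]big_mkcond; apply: ler_sum => j _.
  by case: (0 < B i j); case: (j \in A).
have sum_D i y : 0 < y -> \sum_(j | (0 < B i j) && (j \in D)) f j (B i j * y) <= A1 * V * y `^ p.
  move=> y0; rewrite /V mulr_sumr mulr_suml.
  apply: (@le_trans _ _ (\sum_(j | (0 < B i j) && (j \in D)) A1 * vD j * y `^ p)).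
    apply: ler_sum => j /andP[bij jD].
    have /negbTE jC : j \notin C by apply: contraL jD => /CnD.
    rewrite /f jC jD powRM ?(ltW y0) ?(ltW bij)// ler_wpM2l//; first nonneg.
    by rewrite ler_piMl ?powR_ge0// Bp1.
  apply: (le_trans (drop _ _ _ _)) => [j|].
    nonneg.
  by rewrite big_mkcond; apply: ler_sum => j _; case: ifP => // _; nonneg.
have none (A : {set 'I_m.+1}) i (F : 'I_m.+1 -> R) :
    (forall j, edge P i j -> j \notin A) ->
    \sum_(j | (0 < B i j) && (j \in A)) F j = 0.
  move=> H; rewrite big_pred0// => j; rewrite BP.
  by apply/negP => /andP[/H/negbTE ->].
have sum_in (A : {set 'I_m.+1}) i (F : 'I_m.+1 -> R) :
    \sum_(j | (0 < B i j) && (j \in A)) B i j * F j = \sum_(j in A) B i j * F j.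
  rewrite big_mkcond [RHS]big_mkcond; apply: eq_bigr => j _.
  case: ltP => //= bij; case: ifP => // _.
  by rewrite (_ : B i j = 0) ?mul0r//; apply/eqP; rewrite eq_le bij B0.
have fsup i y : 1 <= y -> \sum_(j | 0 < B i j) f j (B i j * y) <= f i y.
  move=> y1; have y0 : 0 < y by apply: lt_le_trans y1.
  have yp0 : 0 <= y `^ p by apply: powR_ge0.
  rewrite sum_split; have [iC|iC] := boolP (i \in C).
    rewrite [X in _ + X]none ?addr0 => [|j]; last exact: CU.
    apply: (@le_trans _ _ (A2 * u i * y - A3 * (1 + eta) * u i * y `^ p + A1 * V * y `^ p)).
      apply: lerD; last exact: sum_D.
      apply: (@le_trans _ _ (\sum_(j | (0 < B i j) && (j \in C))
          B i j * (u j * (A2 * y - A3 * (1 + eta) * y `^ p)))).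
        apply: ler_sum => j /andP[bij jC]; rewrite /f jC powRM ?(ltW y0) ?(ltW bij)//.
        have : B i j * (1 + eta) <= B i j `^ p.
          rewrite pw_edge// ler_wpM2l ?(ltW bij)// /eta addrC subrK mono//.
        move=> /(ler_wpM2r (mulr_ge0 (mulr_ge0 A30 (u0 j)) yp0)) H.
        by apply: (le_shift H); ring.
      rewrite sum_in; under eq_bigr do rewrite mulrA.
      rewrite -mulr_suml uE// le_eqVlt; apply/orP; left; apply/eqP; ring.
    rewrite /f iC.
    have : A1 * V <= A3 * eta * u i.
      have -> : A1 * V = A3 * eta * d.
        by rewrite /A3; field; rewrite !gt_eqF.
      by rewrite ler_wpM2l ?du//; nonneg.
    move=> /(ler_wpM2r yp0); move=> H; by apply: (le_shift H); ring.
  have [iD|iD] := boolP (i \in D).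
    rewrite (none C) => [|j ij]; last first.
      by apply: contraL (DD i j iD ij) => /CnD.
    rewrite (none U) => [|j ij]; last by apply/DnU/(DD i).
    rewrite add0r addr0.
    apply: (@le_trans _ _ (\sum_(j | (0 < B i j) && (j \in D))
        B i j * (vD j * (A1 * mu `^ (- kap) * y `^ p)))).
      apply: ler_sum => j /andP[bij jD].
      have /negbTE jC : j \notin C by apply: contraL jD => /CnD.
      rewrite /f jC jD powRM ?(ltW y0) ?(ltW bij)// pw_edge//.
      have : B i j `^ (- kap) <= mu `^ (- kap) by rewrite mono// Bmu.
      have K0 : 0 <= A1 * vD j * B i j * y `^ p by nonneg.
      move=> /(ler_wpM2l K0) H.
      by apply: (le_shift H); ring.
    rewrite sum_in; under eq_bigr do rewrite mulrA.
    rewrite -mulr_suml /f (negbTE iC) iD.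
    apply: (@le_trans _ _ (lD * vD i * (A1 * mu `^ (- kap) * y `^ p))).
      by rewrite ler_wpM2r ?vDE//; nonneg.
    have K0 : 0 <= A1 * vD i * y `^ p by nonneg.
    have := ler_wpM2r K0 mukap; move=> H; by apply: (le_shift H); ring.
  have iU : i \in U by have := cover i; rewrite (negbTE iC) (negbTE iD).
  rewrite {4}/f (negbTE iC) (negbTE iD).
  apply: (@le_trans _ _ (A2 * W * y + A1 * V * y + A4 * lU * vU i * y)).
    apply: lerD; first apply: lerD.
    - apply: (@le_trans _ _ (\sum_(j in C) A2 * u j * y)).
        apply: le_trans (drop _ i _ _); last by move=> j; nonneg.
        apply: ler_sum => j /andP[bij jC]; rewrite /f jC.
        rewrite lerBlDr -[leLHS]addr0 lerD//; last nonneg.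
        rewrite ler_wpM2l ?mulr_ge0// ler_piMl ?(ltW y0)//.
        by rewrite (le_trans (Bbeta i j))// ltW.
      rewrite -mulr_suml ler_wpM2r ?(ltW y0)// -mulr_sumr ler_wpM2l//.
      by rewrite /W big_mkcond; apply: ler_sum => j _; case: ifP.
    - apply: le_trans (sum_D i y y0) _.
      by rewrite ler_wpM2l ?yp_le//; nonneg.
    - apply: (@le_trans _ _ (\sum_(j | (0 < B i j) && (j \in U))
          B i j * (vU j * (A4 * y)))).
        apply: ler_sum => j /andP[bij jU].
        have /negbTE jC : j \notin C by apply: contraL jU => /CnU.
        have /negbTE jD : j \notin D by apply: contraL jU => /DnU.
        by rewrite /f jC jD le_eqVlt; apply/orP; left; apply/eqP; ring.
      rewrite sum_in; under eq_bigr do rewrite mulrA.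
      rewrite -mulr_suml; have := ler_wpM2r (mulr_ge0 A40 (ltW y0)) (vUE i iU).
      by move=> H; apply: (le_shift H); ring.
  rewrite -!mulrDl ler_wpM2r ?(ltW y0)//.
  suff : A2 * W + A1 * V <= A4 * (1 - lU) * vU i.
    by move=> H; apply: (le_shift H); ring.
  apply: (@le_trans _ _ (A4 * (1 - lU))); last first.
    by rewrite ler_peMr//; nonneg.
  have lU0' : 0 < 1 - lU by rewrite subr_gt0.
  rewrite -{1}[A2 * W + A1 * V](divfK (lt0r_neq0 lU0')) ler_wpM2r ?(ltW lU0')//.
  by rewrite /A4 lerDl invr_ge0 ltW.
have f1 i y : mu <= y -> 1 <= f i y.
  move=> muy; have y0 : 0 < y by apply: lt_le_trans muy.
  rewrite /f; have [iC|iC] := boolP (i \in C).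
    apply: (@le_trans _ _ ((d * mu)^-1 * u i * y)).
      rewrite -mulrA ler_pdivlMl ?mulr_gt0// mulr1.
      by apply: ler_pM; rewrite ?du//; nonneg.
    rewrite ypE// /A2.
    have : y `^ (- kap) <= mu `^ (- kap) by apply: mono.
    have K0 : 0 <= A3 * u i * y by nonneg.
    move=> /(ler_wpM2l K0); move=> H; by apply: (le_shift H); ring.
  have [iD|iD] := boolP (i \in D).
    have yp : mu `^ p <= y `^ p.
      by apply: ge0_ler_powR; rewrite ?nnegrE//; nonneg.
    apply: (@le_trans _ _ (A1 * 1 * mu `^ p)).
      by rewrite mulr1 mulVf// gt_eqF.
    by apply: ler_pM => //; [nonneg|nonneg|rewrite ler_wpM2l// ltW].
  apply: (@le_trans _ _ (mu^-1 * 1 * mu)); first by rewrite mulr1 mulVf// gt_eqF.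
  apply: ler_pM => //; rewrite ?mulr1 ?invr_ge0 ?(ltW mu0)//.
  rewrite -[leLHS]mulr1; apply: ler_pM => //; first by rewrite invr_ge0 ltW.
  by rewrite /A4 lerDr.
exists (A1 * V + A2 * W + A4 * Z + 1); split.
  by rewrite ltr_wpDl//; nonneg.
move=> n i y y1; have y0 : 0 < y by apply: lt_le_trans y1.
apply: (@le_trans _ _ (f i y)).
  apply: (@count_cut_le f mu) => //.
  by rewrite (le_trans (ltW mu1)).
have T1 : 0 <= A1 * V * y by nonneg.
have T2 : 0 <= A2 * W * y by nonneg.
have T3 : 0 <= A4 * Z * y by nonneg.
rewrite /f; case: ifP => [iC|_].
  have : A2 * u i * y <= A2 * W * y by rewrite ler_wpM2r ?(ltW y0)// ler_wpM2l.
  have : 0 <= A3 * u i * y `^ p by nonneg.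
  by lra.
case: ifP => [iD|_].
  have : A1 * vD i * y `^ p <= A1 * V * y.
    by apply: ler_pM; rewrite ?yp_le ?ler_wpM2l//; nonneg.
  by lra.
have : A4 * vU i * y <= A4 * Z * y by rewrite ler_wpM2r ?(ltW y0)// ler_wpM2l.
by lra.
Qed.

(** The vector is [(1 + B)^(m+1) u] for the eigenvector [u] of [H]. Applying [1 + B] preserves
    [w <= B w] and spreads positivity one edge backwards; a path without repetition has at most [m]
    edges. *)
Lemma reaching_vector H : crit H -> exists w : 'I_m.+1 -> R,
  [/\ forall i, 0 <= w i, forall i, w i <= \sum_j B i j * w j
    & forall i j, j \in H -> connect (edge P) i j -> 0 < w i].
Proof.
move=> cH; have [u [up uout uE]] := critical_eigenvector B0 BP cH.
pose W n := iter n (fun (v : 'I_m.+1 -> R) i => v i + \sum_j B i j * v j) u.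
have WS n i : W n.+1 i = W n i + \sum_j B i j * W n j by [].
have W0 n i : 0 <= W n i.
  elim: n i => [|n IH] i.
    by have [/up/ltW//|iH] := boolP (i \in H); rewrite /W /= uout.
  by rewrite WS addr_ge0// sumr_ge0// => j _; rewrite mulr_ge0.
have Wsub n i : W n i <= \sum_j B i j * W n j.
  elim: n i => [|n IH] i.
    have [iH|iH] := boolP (i \in H); last first.
      rewrite {1}/W /= uout// sumr_ge0// => j _.
      by rewrite mulr_ge0// (W0 0%N).
    rewrite {1}/W /= -uE// big_mkcond; apply: ler_sum => j _.
    by case: ifP => // _; rewrite mulr_ge0// (W0 0%N).
  rewrite WS; apply: (@le_trans _ _ (\sum_j (B i j * W n j + B i j * \sum_k B j k * W n k))).
    rewrite big_split lerD//=; apply: ler_sum => j _.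
    by rewrite ler_wpM2l.
  by apply: ler_sum => j _; rewrite WS mulrDr.
have Wmono (n k : nat) i : W n i <= W (n + k)%N i.
  elim: k => [|k IH]; first by rewrite addn0.
  rewrite addnS WS; apply: le_trans IH _; rewrite lerDl sumr_ge0// => j _.
  by rewrite mulr_ge0.
exists (W m.+1); split => // i j jH /connectP[p pp jE].
move: jE; case: (shortenP pp) => q qp qu _ jE.
have sq : (size q <= m.+1)%N.
  by have := max_card (mem (i :: q)); rewrite card_ord (card_uniqP qu) => /ltnW.
rewrite -(subnKC sq); apply: lt_le_trans (Wmono _ _ _).
move: {qu pp sq p} qp jE; elim: q i => [|a q IH] i /=.
  by move=> _ <-; rewrite /W /= up.
move=> /andP[ia pq] jE; rewrite ltr_wpDl ?W0// (bigD1 a)//=.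
rewrite ltr_pwDl ?mulr_gt0 ?BP ?IH// sumr_ge0// => k _.
by rewrite mulr_ge0.
Qed.

(** Bounds the loss incurred when [y ln y] is evaluated at [B_ij y], where [ln B_ij] is negative. *)
Lemma neg_xlnx_le (b : R) : 0 < b -> - (b * ln b) <= 1.
Proof.
move=> bp; rewrite -mulrN -lnV ?posrE//.
apply: (@le_trans _ _ (b * b^-1)); last by rewrite mulfV ?gt_eqF.
by rewrite ler_wpM2l ?(ltW bp)// ltW// ln_sublinear// invr_gt0.
Qed.

(* Each step from [H1] towards [H2] feeds the count of [H1] with a linear
   term, and these contributions accumulate along the [ln y] steps made
   inside [H1]. *)
Lemma count_cut_superlinear H1 H2 : crit H1 -> crit H2 -> H1 != H2 ->
  precedes P H1 H2 ->
  exists i, forall K : R, exists y0 : R, forall n y, y0 <= y -> 1 <= y ->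
    beta ^+ n * y < 1 -> K * y <= (count_cut n i y)%:R.
Proof.
have [b0 b1] := andP beta01.
move=> c1 c2 neq [i1 [p [i1H pp ipH]]].
have [w [w0 wsub wp]] := reaching_vector c2.
have [u [up uout uE]] := critical_eigenvector B0 BP c1.
have u0 i : 0 <= u i.
  by have [/up/ltW//|iH] := boolP (i \in H1); rewrite uout.
(* Among the descendants of [i1] no edge enters [H1] from outside ([back]), so the two formulas
   defining [g] meet only along edges leaving [H1]. *)
pose S := [pred i | connect (edge P) i1 i].
have SS i j : S i -> 0 < B i j -> S j.
  by rewrite BP => i1i ij; apply: connect_trans i1i (connect1 ij).
have HS i : i \in H1 -> S i.
  by move=> iH; apply: (@connect_edge_inW _ _ P H1); exact: SC_connect c1.1 _ _.
have back i j : S i -> 0 < B i j -> j \in H1 -> i \in H1.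
  move=> Si; rewrite BP => ij jH; rewrite (SC_eq_comm_class c1.1 i1H) inE.
  rewrite [connect _ _ _]Si/=; apply: connect_trans (connect1 ij) _.
  by apply: (@connect_edge_inW _ _ P H1); exact: SC_connect c1.1 _ _.
pose G i := if i \in H1 then \sum_(j | j \notin H1) B i j * w j else 0.
have G0 i : 0 <= G i.
  by rewrite /G; case: ifP => // _; rewrite sumr_ge0// => j _; rewrite mulr_ge0.
(* A path from [H1] to [H2] has an edge leaving [H1], whose end still reaches [H2] and so has
   positive [w]. *)
have Gp : exists2 i, i \in H1 & 0 < G i.
  have [a [b [aH bH ab bj]]] : exists a b,
      [/\ a \in H1, b \notin H1, edge P a b & connect (edge P) b (last i1 p)].
    have lH : last i1 p \notin H1.
      by apply: contra neq => lH; rewrite (SC_eq c1.1 c2.1 lH ipH).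
    move: {ipH} pp i1H lH; elim: p i1 {S SS HS back} => [|a p IH] i /=.
      by move=> _ ->.
    move=> /andP[ia pa] iH lH; have [aH|aH] := boolP (a \in H1); first exact: IH.
    by exists i, a; split => //; apply/connectP; exists p.
  exists a => //; rewrite /G aH (bigD1 b)//= ltr_pwDl//.
    by rewrite mulr_gt0 ?BP// (wp _ _ ipH).
  by rewrite sumr_ge0// => j _; rewrite mulr_ge0.
(* Since [B z + G = 2 z], the linear part of [g] gains [z_i y] at each step in [H1]. With
   [eps = d / U] this covers the loss of the logarithmic part, at most [eps y sum_j u_j]. The factor
   [c] gives [g <= 1] for [y < 1], where [y ln y <= 0]. *)
have [z [z0 zp zE]] := class_resolvent B0 BP c1 G0 Gp.
have [d d0 dz] := finite_pos_lb zp.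
pose U := \sum_i u i + 1; pose Z := \sum_i z i; pose W := \sum_i w i.
have U0 : 0 < U by rewrite ltr_wpDl// sumr_ge0.
have Z0 : 0 <= Z by rewrite sumr_ge0.
have W0 : 0 <= W by rewrite sumr_ge0.
have zZ i : z i <= Z by rewrite /Z (bigD1 i)//= lerDl sumr_ge0.
have wW i : w i <= W by rewrite /W (bigD1 i)//= lerDl sumr_ge0.
pose eps := d / U; have eps0 : 0 < eps by rewrite divr_gt0.
pose c := (1 + Z + W)^-1.
have c0 : 0 < c by rewrite invr_gt0; lra.
pose g i y := if i \in H1 then c * (eps * u i * (y * ln y) + z i * y)
  else c * (w i * y).
have gle n i y : S i -> 0 < y -> beta ^+ n * y < 1 -> g i y <= (count_cut n i y)%:R.
  apply: (@count_cut_ge S g beta) => // {n i y} i y Si.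
    move=> /andP[y0 y1]; rewrite /g; case: ifP => _.
      apply: (@le_trans _ _ (c * (Z * 1))).
        rewrite ler_wpM2l ?(ltW c0)// -[leRHS]add0r lerD//.
          rewrite mulr_ge0_le0//; first nonneg.
          by rewrite mulr_ge0_le0// ?(ltW y0)// ln_le0// ltW.
        by rewrite ler_pM// ltW.
      by rewrite mulr1 /c ler_pdivrMl ?mulr1; lra.
    apply: (@le_trans _ _ (c * (W * 1))).
      by rewrite ler_wpM2l ?(ltW c0)// ler_pM// ltW.
    by rewrite mulr1 /c ler_pdivrMl ?mulr1; lra.
  move=> y1; have y0 : 0 < y by apply: lt_le_trans y1.
  have [iH|iH] := boolP (i \in H1); last first.
    rewrite {1}/g (negbTE iH).
    apply: (@le_trans _ _ (\sum_(j | 0 < B i j) B i j * (w j * (c * y)))).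
      rewrite sum_support; under [leRHS]eq_bigr do rewrite mulrA.
      rewrite -mulr_suml mulrCA ler_wpM2r//; nonneg.
    apply: ler_sum => j bij; rewrite /g ifN; last first.
      by apply: contra iH; apply: back bij.
    by rewrite le_eqVlt; apply/orP; left; apply/eqP; ring.
  have term j : B i j * ((if j \in H1 then u j else 0) * (c * eps * y * ln y))
      + B i j * ((if j \in H1 then z j else 0) * (c * y))
      + B i j * ((if j \in H1 then 0 else w j) * (c * y))
      - u j * (c * eps * y) <= if 0 < B i j then g j (B i j * y) else 0.
    case: (ltP 0 (B i j)) => bij; last first.
      have -> : B i j = 0 by apply/eqP; rewrite eq_le bij B0.
      by rewrite !mul0r !add0r oppr_le0; nonneg.
    rewrite /g; case: ifP => jH; last first.
      have : 0 <= u j * (c * eps * y) by nonneg.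
      by move=> H; apply: (le_shift H); ring.
    rewrite lnM ?posrE//.
    have := neg_xlnx_le bij.
    have K0 : 0 <= u j * (c * eps * y) by nonneg.
    by move=> /(ler_wpM2l K0) H; apply: (le_shift H); ring.
  rewrite [leRHS]big_mkcond; apply: le_trans (ler_sum _ (fun j _ => term j)).
  rewrite sumrB !big_split/=.
  have S1 (v : 'I_m.+1 -> R) (C : R) : \sum_j B i j * ((if j \in H1 then v j else 0) * C) =
      (\sum_(j in H1) B i j * v j) * C.
    rewrite mulr_suml [RHS]big_mkcond; apply: eq_bigr => j _.
    by case: ifP => _; ring.
  have S2 (C : R) : \sum_j B i j * ((if j \in H1 then 0 else w j) * C) = G i * C.
    rewrite /G iH mulr_suml [RHS]big_mkcond; apply: eq_bigr => j _.
    by case: ifP => _ /=; ring.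
  rewrite !S1 S2 uE// -mulr_suml /g iH.
  have -> : \sum_(j in H1) B i j * z j = 2 * z i - G i by have := zE i iH; lra.
  have : eps * \sum_j u j <= z i.
    apply: le_trans (dz i iH); rewrite /eps mulrAC ler_pdivrMr// ler_wpM2l ?(ltW d0)//.
    by rewrite /U lerDl.
  have K0 : 0 <= c * y by nonneg.
  by move=> /(ler_wpM2l K0) H; apply: (le_shift H); ring.
(* Beyond this threshold [c eps u_i1 ln y >= K]. *)
exists i1 => K; exists (expR (K / (c * eps * u i1))) => n y yK y1 yb.
have y0 : 0 < y by apply: lt_le_trans y1.
apply: le_trans (gle n i1 y (connect0 _ _) y0 yb).
have q0 : 0 < c * eps * u i1 by rewrite mulr_gt0 ?up// mulr_gt0.
have : K / (c * eps * u i1) <= ln y by rewrite -[leLHS]expRK ler_ln ?posrE ?expR_gt0.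
rewrite ler_pdivrMr// => /(ler_wpM2r (ltW y0)) H.
apply: le_trans H _; rewrite /g i1H.
have H : 0 <= c * (z i1 * y) by nonneg.
by apply: (le_shift H); ring.
Qed.

End Counting.

(** * Norms on row vectors *)

Section Norms.
Context {R : realType} {q : nat}.
Implicit Types (x y : 'rV[R]_q) (nrm : 'rV[R]_q -> R).

Lemma le_coord_mx_norm x i : `|x 0 i| <= `|x|.
Proof.
by rewrite [leRHS]/Num.norm /= mx_normrE; apply/bigmax_geP; right => /=; exists (0, i).
Qed.

Lemma le_coord_enorm x i : `|x 0 i| <= enorm x.
Proof.
rewrite /enorm -sqrtr_sqr ler_wsqrtr// (bigD1 i)//= lerDl sumr_ge0// => j _.
exact: sqr_ge0.
Qed.

Lemma enorm_ge0 x : 0 <= enorm x. Proof. exact: sqrtr_ge0. Qed.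

Lemma mx_norm_le_enorm x : `|x| <= enorm x.
Proof.
rewrite [leLHS]/Num.norm /= mx_normrE; apply/bigmax_leP; split.
  exact: enorm_ge0.
by move=> [i j] _ /=; rewrite (ord1 i) le_coord_enorm.
Qed.

Lemma enorm_le_mx_norm x : enorm x <= Num.sqrt q%:R * `|x|.
Proof.
rewrite /enorm -[X in _ * X]ger0_norm// -sqrtr_sqr -sqrtrM// ler_wsqrtr//.
rewrite -[q in q%:R]card_ord -sum1_card natr_sum mulr_suml; apply: ler_sum => i _.
by rewrite mul1r -real_normK ?num_real// ler_sqr ?nnegrE// le_coord_mx_norm.
Qed.

Lemma enorm0 : enorm (0 : 'rV[R]_q) = 0.
Proof. by rewrite /enorm big1 ?sqrtr0// => i _; rewrite mxE expr0n. Qed.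

Lemma lipschitz_continuous (V W : normedModType R) (f : V -> W) (C : R) :
  (forall x y : V, `|f x - f y| <= C * `|x - y|) -> continuous f.
Proof.
move=> fC x; apply/cvgrPdist_lt => e e0.
have C0 : 0 < `|C| + 1 by rewrite ltr_wpDl.
near=> y; apply: le_lt_trans (fC x y) _.
apply: (@le_lt_trans _ _ ((`|C| + 1) * `|x - y|)).
  by rewrite ler_wpM2r// (le_trans (ler_norm C))// lerDl.
rewrite mulrC -ltr_pdivlMr//; near: y.
by apply: (@cvgr_dist_lt _ _ _ (nbhs x) _ id x (@cvg_id _ _)); rewrite divr_gt0.
Unshelve. all: by end_near. Qed.

Section Norm.
Variable nrm : 'rV[R]_q -> R.
Hypothesis nrmP : is_norm nrm.

Lemma is_norm0 : nrm 0 = 0.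
Proof. by have [_ nZ _] := nrmP; rewrite -(scale0r 0) nZ normr0 mul0r. Qed.

Lemma is_normN x : nrm (- x) = nrm x.
Proof. by have [_ nZ _] := nrmP; rewrite -scaleN1r nZ normrN1 mul1r. Qed.

Lemma is_norm_ge0 x : 0 <= nrm x.
Proof.
have [nD _ _] := nrmP; have := nD x (- x).
by rewrite subrr is_norm0 is_normN; lra.
Qed.

Lemma is_norm_triangle x y z : nrm (x - z) <= nrm (x - y) + nrm (y - z).
Proof.
have [nD _ _] := nrmP; apply: le_trans (nD _ _).
by rewrite addrA subrK.
Qed.

Lemma is_normB x y : nrm (x - y) = nrm (y - x).
Proof. by rewrite -is_normN opprB. Qed.

Lemma is_norm_le_mx_norm : exists C : R, 0 < C /\ forall x, nrm x <= C * `|x|.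
Proof.
have [nD nZ _] := nrmP.
exists (\sum_i nrm (delta_mx 0 i) + 1); split.
  by rewrite ltr_wpDl// sumr_ge0// => i _; apply: is_norm_ge0.
move=> x; rewrite {1}(row_sum_delta x).
apply: (@le_trans _ _ (\sum_i nrm (x 0 i *: delta_mx 0 i))).
  elim/big_ind2 : _ => //; first by rewrite is_norm0.
  by move=> a b c d ab cd; apply: le_trans (nD _ _) (lerD ab cd).
rewrite mulrDl mul1r ler_wpDr// mulr_suml; apply: ler_sum => i _.
by rewrite nZ mulrC ler_wpM2l ?is_norm_ge0// le_coord_mx_norm.
Qed.

Lemma is_norm_lipschitz : exists C : R, 0 < C /\
  forall x y, `|nrm x - nrm y| <= C * `|x - y|.
Proof.
have [C [C0 nC]] := is_norm_le_mx_norm; exists C; split => // x y.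
rewrite ler_norml; apply/andP; split.
  rewrite lerNl opprB; have := is_norm_triangle y x 0; rewrite !subr0 is_normB.
  by have := nC (x - y); lra.
have := is_norm_triangle x y 0; rewrite !subr0.
by have := nC (x - y); lra.
Qed.

(** The constant is the minimum of [nrm] on the unit sphere of the sup norm, attained by compactness
    and positive by definiteness. When the sphere is empty ([q = 0]) every vector is zero. *)
Lemma mx_norm_le_is_norm : exists c : R, 0 < c /\ forall x, c * `|x| <= nrm x.
Proof.
have [_ nZ n0] := nrmP.
pose S := [set x : 'rV[R]_q | `|x| = 1].
have toS x : x != 0 -> S (`|x|^-1 *: x).
  by move=> x0; rewrite /S /= normrZ normfV normr_id mulVf// normr_eq0.
have [[s0 Ss0]|S0] := pselect (S !=set0); last first.
  exists 1; split => // x; have [->|x0] := eqVneq x 0.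
    by rewrite normr0 mulr0 is_norm0.
  by case: S0; exists (`|x|^-1 *: x); exact: toS.
have cS : compact S.
  apply: bounded_closed_compact.
    exists 1; split; first exact: num_real.
    by move=> M M1 x Sx; rewrite /= Sx ltW.
  rewrite (_ : S = Num.norm @^-1` [set 1])//; apply: closed_comp; last exact: closed_eq.
  by move=> x _; apply: norm_continuous.
have [C [C0 nC]] := is_norm_lipschitz.
have [] := @compact_EVT_min _ _ nrm S _ cS; first by exists s0.
  by apply: continuous_subspaceT; apply: (@lipschitz_continuous _ _ nrm C).
move=> s /set_mem Ss smin; exists (nrm s); split.
  rewrite lt_neqAle is_norm_ge0 andbT eq_sym; apply/eqP => /n0 s00.
  by move: Ss; rewrite /S /= s00 normr0 => /eqP; rewrite eq_sym oner_eq0.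
move=> x; have [->|x0] := eqVneq x 0; first by rewrite normr0 mulr0 is_norm0.
have := smin _ (mem_set (toS x x0)); rewrite nZ normfV normr_id.
by rewrite mulrC ler_pdivlMr// normr_gt0.
Qed.

Lemma is_norm_equiv_enorm : exists c C : R, [/\ 0 < c, 0 < C
  & forall x, c * enorm x <= nrm x <= C * enorm x].
Proof.
have [C [C0 nC]] := is_norm_le_mx_norm; have [c [c0 nc]] := mx_norm_le_is_norm.
have q0 : 0 < Num.sqrt q%:R + 1 :> R by rewrite ltr_wpDl.
exists (c / (Num.sqrt q%:R + 1)), C; split; [exact: divr_gt0|exact: C0|].
move=> x; apply/andP; split.
  apply: le_trans (nc x); rewrite -mulrA ler_wpM2l ?(ltW c0)//.
  rewrite ler_pdivrMl//; apply: le_trans (enorm_le_mx_norm x) _.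
  by rewrite ler_wpM2r// lerDl.
by apply: le_trans (nC x) _; rewrite ler_wpM2l ?(ltW C0)// mx_norm_le_enorm.
Qed.

Lemma pointdist_ge0 x (alpha : set 'rV[R]_q) : 0 <= pointdist nrm x alpha.
Proof.
have [->|/set0P[a aa]] := eqVneq alpha set0.
  by rewrite /pointdist image_set0 inf0.
apply: lb_le_inf; first by exists (nrm (x - a)), a.
by move=> _ [b _ <-]; apply: is_norm_ge0.
Qed.

Lemma pointdist_le x a (alpha : set 'rV[R]_q) : alpha a ->
  pointdist nrm x alpha <= nrm (x - a).
Proof.
move=> aa; apply: ge_inf; last by exists a.
by exists 0 => _ [b _ <-]; apply: is_norm_ge0.
Qed.

Lemma pointdist_lb x (alpha : set 'rV[R]_q) (e : R) : alpha !=set0 ->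
  (forall a, alpha a -> e <= nrm (x - a)) -> e <= pointdist nrm x alpha.
Proof.
move=> [a aa] H; apply: lb_le_inf; first by exists (nrm (x - a)), a.
by move=> _ [b bb <-]; apply: H.
Qed.

(** The distance to a set is 1-Lipschitz for [nrm]; continuity supplies the measurability of the
    integrand. *)
Lemma pointdist_continuous (alpha : set 'rV[R]_q) : alpha !=set0 ->
  continuous (pointdist nrm ^~ alpha).
Proof.
move=> a0; have [C [C0 nC]] := is_norm_le_mx_norm.
have le x y : pointdist nrm x alpha - pointdist nrm y alpha <= C * `|x - y|.
  rewrite lerBlDl -lerBlDr; apply: pointdist_lb => // a aa.
  rewrite lerBlDl; apply: le_trans (pointdist_le x aa) _.
  by apply: le_trans (is_norm_triangle x y a) _; rewrite lerD2r.
apply: (@lipschitz_continuous _ _ (pointdist nrm ^~ alpha) C) => x y.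
by rewrite ler_norml le andbT lerNl opprB distrC le.
Qed.

End Norm.

Lemma closed_measurable_borel (A : set 'rV[R]_q) : closed A ->
  measurable (A : set (borel R q)).
Proof.
move=> cA; rewrite -[A]setCK; apply: measurableC.
by apply: sub_sigma_algebra; exact: closed_openC.
Qed.

Lemma continuous_measurable_borel (f : 'rV[R]_q -> R) : continuous f ->
  measurable_fun [set: borel R q] f.
Proof.
move=> /continuousP cf; apply: (measurability _ (measurable_realfun.RGenOpens.measurableE R)).
move=> _ [_ [a [b ->] <-]]; rewrite setTI; apply: sub_sigma_algebra.
by apply: cf; exact: interval_open.
Qed.

End Norms.

(** * Cylinder sets *)

Section Words.
Context {R : realType} {m : nat}.
Implicit Types (P M : 'M[R]_m.+1) (s t sigma : seq 'I_m.+1) (i j : 'I_m.+1).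

(** For [M = c] this is the diameter of the cylinder of an admissible non-empty word. *)
Definition edge_prod M s : R := \prod_(e <- zip s (behead s)) M e.1 e.2.

Lemma edge_prod1 M i : edge_prod M [:: i] = 1.
Proof. by rewrite /edge_prod big_nil. Qed.

Lemma edge_prod_rcons M s i j :
  edge_prod M (rcons (rcons s i) j) = edge_prod M (rcons s i) * M i j.
Proof.
rewrite /edge_prod; elim: s => [|a [|b s] IH] /=.
- by rewrite big_cons !big_nil mulr1 mul1r.
- by rewrite !big_cons !big_nil !mulr1.
- by rewrite big_cons IH /= [in RHS]big_cons mulrA.
Qed.

Lemma word_weight_rcons P (chi : 'I_m.+1 -> R) s i j :
  word_weight P chi (rcons (rcons s i) j) = word_weight P chi (rcons s i) * P i j.
Proof.
case: s => [|a s].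
  by rewrite /word_weight /= big_cons !big_nil !mulr1.
by have := edge_prod_rcons P (a :: s) i j; rewrite /edge_prod /= => ->; rewrite mulrA.
Qed.

Lemma admissible_rcons P s i j : admissible P (rcons (rcons s i) j) =
  admissible P (rcons s i) && edge P i j.
Proof.
rewrite /admissible; case: s => [|a s] /=; first by rewrite andbT.
by rewrite rcons_path last_rcons.
Qed.

Lemma admissible_catl P s t : admissible P (s ++ t) -> admissible P s.
Proof. by rewrite /admissible; case: s => //= a s; rewrite cat_path => /andP[]. Qed.

Lemma edge_prod_ge0 M s : (forall i j, 0 <= M i j) -> 0 <= edge_prod M s.
Proof. by move=> M0; rewrite /edge_prod prodr_ge0. Qed.

Definition incomparable s t := ~~ prefix s t && ~~ prefix t s.

(** The words branch after a longest common prefix; the separation property applies at that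
    branching. *)
Lemma incomparable_split s t : incomparable s t ->
  exists u i j s' t', [/\ i != j, s = rcons u i ++ s' & t = rcons u j ++ t'].
Proof.
rewrite /incomparable; elim: s t => [|a s IH] [|b t] //=.
have [->|ab] := eqVneq a b; last by exists [::], a, b, s, t.
rewrite /= => /IH[u [i [j [s' [t' [ij -> ->]]]]]].
by exists (b :: u), i, j, s', t'.
Qed.

Lemma mkseq_rcons (T : Type) (f : nat -> T) n :
  mkseq f n.+1 = rcons (mkseq f n) (f n).
Proof. by rewrite /mkseq -addn1 iotaD map_cat cats1. Qed.

Lemma admissible_mkseq P (omega : nat -> 'I_m.+1) k :
  Omega_inf P omega -> admissible P (mkseq omega k.+1).
Proof.
move=> Po; elim: k => // k IH; rewrite mkseq_rcons mkseq_rcons admissible_rcons.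
by rewrite -mkseq_rcons IH /=; apply: Po.
Qed.

End Words.

(** * Diameters, distances and similar copies of compact sets *)

Section Diameter.
Context {R : realType} {q : nat}.
Implicit Types (A B : set 'rV[R]_q) (x y : 'rV[R]_q).

Lemma le_diam A x y : compact A -> A x -> A y -> enorm (x - y) <= diam A.
Proof.
move=> cA Ax Ay; apply: ub_le_sup; last by exists (x, y).
have [M [_ HM]] := compact_bounded cA.
have HM1 z : A z -> `|z| <= M + 1 by apply: HM; rewrite ltrDl.
exists (Num.sqrt q%:R * ((M + 1) + (M + 1))) => _ [[a b] [Aa Ab] <-] /=.
apply: le_trans (enorm_le_mx_norm _) _; rewrite ler_wpM2l ?sqrtr_ge0//.
by apply: le_trans (ler_normB _ _) _; rewrite lerD ?HM1.
Qed.

Lemma le_setdist A B x y : A x -> B y -> setdist A B <= enorm (x - y).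
Proof.
move=> Ax By; apply: ge_inf; last by exists (x, y).
by exists 0 => _ [[a b] _ <-]; apply: enorm_ge0.
Qed.

Lemma geom_similar_compact A B : geom_similar A B -> compact A -> compact B.
Proof.
move=> [f [rho [rho0 fE ->]]] cA; apply: continuous_compact => //.
apply: continuous_subspaceT.
apply: (@lipschitz_continuous _ _ _ f (rho * Num.sqrt q%:R)) => x y.
apply: le_trans (mx_norm_le_enorm _) _; rewrite fE -mulrA.
by rewrite ler_wpM2l ?(ltW rho0)// enorm_le_mx_norm.
Qed.

Lemma geom_similar_nonempty A B : geom_similar A B -> A !=set0 -> B !=set0.
Proof. by move=> [f [rho [_ _ ->]]] [a Aa]; exists (f a), a. Qed.

End Diameter.

(** * Separation and measure of the cylinders *)

Section CylinderSystem.
Context {R : realType} {q m : nat}.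
Variables (P c : 'M[R]_m.+1) (J : seq 'I_m.+1 -> set 'rV[R]_q).
Implicit Types (s t sigma tau : seq 'I_m.+1) (i j : 'I_m.+1).
Hypothesis cP : is_ratio_matrix P c.
Hypothesis JP : is_cylinder_system P c J.

Lemma ratio_ge0 i j : 0 <= c i j. Proof. by have [/andP[]] := cP i j. Qed.

Lemma ratio_gt0 i j : edge P i j -> 0 < c i j.
Proof. by move=> ij; have [_ ->] := cP i j. Qed.

Lemma ratio_lt1 i j : c i j < 1. Proof. by have [/andP[]] := cP i j. Qed.

Lemma cylinder_diam s i : admissible P (rcons s i) ->
  diam (J (rcons s i)) = edge_prod c (rcons s i).
Proof.
have [J1 J2 _] := JP; elim/last_ind: s i => [|s a IH] i.
  by move=> _; have [_ _ _ ->] := J1 i; rewrite edge_prod1.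
move=> adm; have [_ _ ->] := J2 _ _ _ adm.
by rewrite edge_prod_rcons mulrC IH//; move: adm; rewrite admissible_rcons => /andP[].
Qed.

Lemma cylinder_compact s i : admissible P (rcons s i) ->
  compact (J (rcons s i)) /\ J (rcons s i) !=set0.
Proof.
have [J1 J2 _] := JP; case/lastP: s => [|s a] adm.
  by have [? ? _ _] := J1 i.
have [_ sim _] := J2 _ _ _ adm; have [n0 cp _ _] := J1 i; split.
  exact: geom_similar_compact sim cp.
exact: geom_similar_nonempty sim n0.
Qed.

Lemma cylinder_sub s i t : admissible P (rcons s i ++ t) ->
  J (rcons s i ++ t) `<=` J (rcons s i).
Proof.
have [_ J2 _] := JP; elim/last_ind: t => [|t j IH]; first by rewrite cats0 => _.
rewrite -rcons_cat; case/lastP E : (rcons s i ++ t) IH => [|u k] IH.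
  by move: E; case: (s).
move=> adm; have [sub _ _] := J2 _ _ _ adm.
by apply: subset_trans sub (IH _); move: adm; rewrite admissible_rcons => /andP[].
Qed.

Lemma edge_prod_gt0 s i : admissible P (rcons s i) -> 0 < edge_prod c (rcons s i).
Proof.
elim/last_ind: s i => [|s a IH] i; first by rewrite edge_prod1.
rewrite admissible_rcons => /andP[adm ai].
by rewrite edge_prod_rcons mulr_gt0 ?IH// ratio_gt0.
Qed.

Lemma edge_prod_catr s i t : admissible P (rcons s i ++ t) ->
  edge_prod c (rcons s i ++ t) <= edge_prod c (rcons s i).
Proof.
elim/last_ind: t => [|t j IH]; first by rewrite cats0.
rewrite -rcons_cat; case/lastP E : (rcons s i ++ t) IH => [|u k] IH.
  by move: E; case: (s).
rewrite admissible_rcons edge_prod_rcons => /andP[adm kj].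
apply: le_trans (IH adm); rewrite ler_piMr ?ltW ?ratio_lt1//.
exact: edge_prod_gt0.
Qed.

Lemma cylinder_diam_cat s i t : admissible P (rcons s i ++ t) ->
  diam (J (rcons s i ++ t)) <= diam (J (rcons s i)).
Proof.
move=> adm; rewrite [leRHS]cylinder_diam; last exact: admissible_catl adm.
have := edge_prod_catr adm; case/lastP E : (rcons s i ++ t) adm => [|u k] adm.
  by move: E; case: (s).
by rewrite cylinder_diam.
Qed.

Definition separated_by (d : R) : Prop :=
  forall sigma i1 i2, i1 != i2 ->
    admissible P (rcons sigma i1) -> admissible P (rcons sigma i2) ->
    d * Num.max (diam (J (rcons sigma i1))) (diam (J (rcons sigma i2)))
      <= setdist (J (rcons sigma i1)) (J (rcons sigma i2)).

(** Both cylinders lie inside the sibling cylinders where the words branch; these are at least as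
    large and are separated by hypothesis. In particular incomparable cylinders are disjoint. *)
Lemma incomparable_separated (d : R) sigma tau x y : 0 < d -> separated_by d ->
  incomparable sigma tau -> admissible P sigma -> admissible P tau ->
  J sigma x -> J tau y ->
  d * Num.max (diam (J sigma)) (diam (J tau)) <= enorm (x - y).
Proof.
move=> d0 sep inc; have [u [i [j [s [t [ij -> ->]]]]]] := incomparable_split inc.
move=> admS admT Jx Jy.
have adms := admissible_catl admS; have admt := admissible_catl admT.
have := sep u i j ij adms admt.
move=> /(fun h => le_trans h (le_setdist (cylinder_sub admS Jx) (cylinder_sub admT Jy))).
apply: le_trans; rewrite ler_wpM2l ?(ltW d0)//.
rewrite ge_max !le_max (cylinder_diam_cat admS) (cylinder_diam_cat admT).
by rewrite orbT.
Qed.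

(** The cylinders along [omega] are nested, compact and non-empty, so a cluster point of points
    chosen in them lies in all; [xget] therefore returns a common point and not its default. *)
Lemma coding_map_mem omega k : Omega_inf P omega ->
  J (mkseq omega k.+1) (coding_map J omega).
Proof.
move=> Po.
have adm n : admissible P (rcons (mkseq omega n) (omega n)).
  by rewrite -mkseq_rcons; exact: admissible_mkseq.
have ne n : J (mkseq omega n.+1) !=set0.
  by rewrite mkseq_rcons; exact: (cylinder_compact (adm n)).2.
have cp n : compact (J (mkseq omega n.+1)).
  by rewrite mkseq_rcons; exact: (cylinder_compact (adm n)).1.
have dec n l : J (mkseq omega (n + l).+1) `<=` J (mkseq omega n.+1).
  have -> : mkseq omega (n + l).+1 =
      rcons (mkseq omega n) (omega n) ++ map omega (iota n.+1 l).
    by rewrite -mkseq_rcons /mkseq -addSn iotaD map_cat.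
  rewrite [mkseq omega n.+1]mkseq_rcons; apply: cylinder_sub.
  rewrite -mkseq_rcons -[map omega (iota n.+1 l)]/(map omega (iota (0 + n.+1) l)).
  by rewrite /mkseq -map_cat -iotaD addSn; exact: admissible_mkseq.
have [x xP] : exists x : nat -> 'rV[R]_q, forall n, J (mkseq omega n.+1) (x n).
  by exists (fun n => projT1 (cid (ne n))) => n; exact: projT2 (cid (ne n)).
have [p [_ clp]] : J (mkseq omega 1) `&` cluster (x @ \oo) !=set0.
  apply: (cp 0%N); exists 0%N => // n _ /=.
  by apply: (dec 0%N n); rewrite add0n.
have Jp n : J (mkseq omega n.+1) p.
  have cl : closed (J (mkseq omega n.+1)) by apply: compact_closed (cp n); exact: norm_hausdorff.
  apply: cl; move: clp; rewrite clusterE; apply.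
  exists n => // l /= nl; rewrite -(subnKC nl) in xP *.
  by apply: (dec n (l - n)%N); exact: xP.
rewrite /coding_map; case: xgetP => [y _ yP|/(_ p)[]]; first exact: yP.
by case.
Qed.

Variables (chi : 'I_m.+1 -> R) (mu : probability (borel R q) R).
Hypothesis sepJ : separation_property P J.
Hypothesis muP : is_markov_type_measure P J chi mu.

Lemma cylinder_measurable s i : admissible P (rcons s i) ->
  measurable (J (rcons s i) : set (borel R q)).
Proof.
move=> adm; apply: closed_measurable_borel.
apply: compact_closed; first exact: norm_hausdorff.
exact: (cylinder_compact adm).1.
Qed.

(** A sequence coded into [J sigma] must begin with [sigma]: otherwise its prefix of the same length
    would be incomparable to [sigma], yet the two cylinders would share a point. *)
Lemma markov_type_cylinder s i : admissible P (rcons s i) ->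
  mu (J (rcons s i)) = (word_weight P chi (rcons s i))%:E.
Proof.
move=> adm; have [mut [_ mutP] muE] := muP; have [d [/andP[d0 _] sep]] := sepJ.
rewrite muE; last exact: cylinder_measurable.
rewrite -mutP//; last by case: (s).
congr (mut _); apply/seteqP; split => omega [Po].
  rewrite /= => Jo; split => //; rewrite /cylinder /=.
  set tau := mkseq _ _; apply: contrapT => /eqP neq.
  have szt : size tau = size (rcons s i) by rewrite size_mkseq.
  have taur : tau = rcons (mkseq omega (size s)) (omega (size s)).
    by rewrite /tau size_rcons mkseq_rcons.
  have admt : admissible P tau by rewrite /tau size_rcons; exact: admissible_mkseq.
  have inc : incomparable tau (rcons s i).
    have pre u v : size u = size v -> u != v -> ~~ prefix u v.
      move=> uv; apply: contra => /prefixP[w vE]; move: uv; rewrite vE size_cat.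
      by move=> /esym/eqP; rewrite -[X in _ == X]addn0 eqn_add2l size_eq0 => /eqP ->; rewrite cats0.
    by rewrite /incomparable !pre// eq_sym.
  have Jt : J tau (coding_map J omega).
    by rewrite /tau size_rcons; exact: coding_map_mem.
  have := incomparable_separated d0 sep inc admt adm Jt Jo.
  rewrite subrr enorm0 leNgt => /negP; apply.
  by rewrite mulr_gt0// lt_max (cylinder_diam adm) edge_prod_gt0// orbT.
rewrite /cylinder /= => E; split => //=; rewrite -E size_rcons.
exact: coding_map_mem.
Qed.

End CylinderSystem.

(** * Cuts and quantization errors *)

Lemma pairwise_flatten_map (T I : eqType) (e : rel T) (f : I -> seq T) (s : seq I) :
  uniq s -> {in s, forall a, pairwise e (f a)} ->
  {in s &, forall a b, a != b -> allrel e (f a) (f b)} ->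
  pairwise e (flatten [seq f a | a <- s]).
Proof.
elim: s => //= a s IH /andP[ans us] pf af; rewrite pairwise_cat.
rewrite pf ?mem_head//= IH//; last 2 first.
- by move=> b sb; apply: pf; rewrite inE sb orbT.
- by move=> b c sb sc; apply: af; rewrite inE (sb, sc) orbT.
rewrite andbT; apply/allrelP => x y xa /flattenP[l /mapP[b sb ->] yl].
have ab : a != b by apply: contraNneq ans => ->.
have /allrelP : allrel e (f a) (f b) by apply: af => //; rewrite inE ?eqxx ?sb ?orbT.
exact.
Qed.

Lemma mem_itv0y (R : realType) (x : \bar R) : (0 <= x)%E -> x \in `[0%E, +oo%E].
Proof. by move=> x0; rewrite in_itv/= x0 leey. Qed.

Section Cut.
Context {R : realType} {m : nat}.
Variables (P c : 'M[R]_m.+1) (chi : 'I_m.+1 -> R) (r : R).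
Implicit Types (s t sigma tau : seq 'I_m.+1) (i j : 'I_m.+1).
Hypothesis PP : is_transition_matrix P.
Hypothesis cP : is_ratio_matrix P c.
Hypothesis chiP : is_positive_probability_vector chi.

(* [mu (J sigma) * diam (J sigma) ^ r] *)
Definition energy sigma : R := word_weight P chi sigma * edge_prod c sigma `^ r.

(** The concrete counterpart of [count_cut]. Starting from the one-letter words of [full_cut],
    [last] always reads an actual letter. *)
Fixpoint cut (n : nat) (e : R) sigma : seq (seq 'I_m.+1) :=
  if n is n'.+1 then
    if energy sigma < e then [:: sigma]
    else flatten [seq cut n' e (rcons sigma j)
                 | j <- enum 'I_m.+1 & edge P (last ord0 sigma) j]
  else [:: sigma].

Definition full_cut (n : nat) (e : R) : seq (seq 'I_m.+1) :=
  flatten [seq cut n e [:: i] | i <- enum 'I_m.+1].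

Lemma word_weight_gt0 s i : admissible P (rcons s i) -> 0 < word_weight P chi (rcons s i).
Proof.
elim/last_ind: s i => [|s a IH] i.
  by rewrite /word_weight /= big_nil mulr1; have [] := chiP.
rewrite admissible_rcons => /andP[adm ai].
by rewrite word_weight_rcons mulr_gt0// IH.
Qed.

Lemma energy_rcons s i j : energy (rcons (rcons s i) j) =
  energy (rcons s i) * (P i j * c i j `^ r).
Proof.
rewrite /energy word_weight_rcons edge_prod_rcons powRM; first ring.
  by apply: edge_prod_ge0 => k l; exact: ratio_ge0 cP _ _.
exact: ratio_ge0 cP _ _.
Qed.

Lemma energy_gt0 s i : admissible P (rcons s i) -> 0 < energy (rcons s i).
Proof.
by move=> adm; rewrite mulr_gt0 ?word_weight_gt0// powR_gt0// (edge_prod_gt0 cP).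
Qed.

Lemma energy1 i : energy [:: i] = chi i.
Proof. by rewrite /energy /word_weight /= edge_prod1 powR1 big_nil !mulr1. Qed.

Lemma cut_ext n e s i tau : admissible P (rcons s i) -> tau \in cut n e (rcons s i) ->
  exists2 t, tau = rcons s i ++ t & admissible P tau.
Proof.
elim: n s i => [|n IH] s i adm /=.
  by rewrite inE => /eqP ->; exists [::]; rewrite ?cats0.
case: ifP => _; first by rewrite inE => /eqP ->; exists [::]; rewrite ?cats0.
move=> /flattenP[l /mapP[j]]; rewrite mem_filter last_rcons => /andP[ij _] -> tl.
have [|t -> admt] := IH _ _ _ tl; first by rewrite admissible_rcons adm.
by exists (j :: t) => //; rewrite cat_rcons.
Qed.

Lemma incomparable_rcons u j k s t : j != k ->
  incomparable (rcons u j ++ s) (rcons u k ++ t).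
Proof.
move=> jk; rewrite /incomparable; elim: u => [|a u IH] /=.
  by rewrite (negbTE jk) eq_sym (negbTE jk).
by rewrite eqxx.
Qed.

Lemma cut_pairwise n e s i : admissible P (rcons s i) ->
  pairwise (@incomparable m) (cut n e (rcons s i)).
Proof.
elim: n s i => [//|n IH] s i adm /=; case: ifP => // _.
apply: pairwise_flatten_map => [|j|j k].
- by rewrite filter_uniq// enum_uniq.
- by rewrite mem_filter last_rcons => /andP[ij _]; apply: IH; rewrite admissible_rcons adm.
rewrite !mem_filter !last_rcons => /andP[ij _] /andP[ik _] jk.
apply/allrelP => x y xc yc.
have [|t -> _] := cut_ext _ xc; first by rewrite admissible_rcons adm.
have [|t' -> _] := cut_ext _ yc; first by rewrite admissible_rcons adm.
exact: incomparable_rcons.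
Qed.

Lemma sum_edge (F : 'I_m.+1 -> R) i :
  \sum_(j <- enum 'I_m.+1 | edge P i j) P i j * F j = \sum_j P i j * F j.
Proof.
have [P0 _ _] := PP; rewrite big_enum_cond/= big_mkcond; apply: eq_bigr => j _.
case: ifP => // /negbT; rewrite /edge -leNgt => Pij.
by rewrite (_ : P i j = 0) ?mul0r//; apply/eqP; rewrite eq_le Pij P0.
Qed.

(** Rows of [P] sum to 1, so replacing a word by its one-letter extensions preserves the total
    weight, at any fuel. *)
Lemma cut_weight n e s i : admissible P (rcons s i) ->
  \sum_(tau <- cut n e (rcons s i)) word_weight P chi tau =
  word_weight P chi (rcons s i).
Proof.
have [_ P1 _] := PP; elim: n s i => [|n IH] s i adm /=; first by rewrite big_seq1.
case: ifP => _; first by rewrite big_seq1.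
rewrite big_flatten big_map big_filter last_rcons /=.
under eq_bigr => j ij.
  rewrite IH ?admissible_rcons ?adm ?ij// word_weight_rcons mulrC.
  over.
by rewrite sum_edge -mulr_suml P1 mul1r.
Qed.

(** With [y = (energy / e)^a] the two recursions agree: [y < 1] is [energy < e], and appending a
    letter multiplies [y] by an entry of [B]. *)
Lemma cut_size (B : 'M[R]_m.+1) (a : R) n e s i : 0 < a -> 0 < e ->
  (forall i j, B i j = (P i j * c i j `^ r) `^ a) ->
  admissible P (rcons s i) ->
  size (cut n e (rcons s i)) = count_cut B n i ((energy (rcons s i) / e) `^ a).
Proof.
move=> a0 e0 BE; have [P0 _ _] := PP.
have BP k l : (0 < B k l) = edge P k l.
  rewrite BE /edge; apply/idP/idP => [|Pkl].
    apply: contraTT; rewrite -leNgt => Pkl.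
    have -> : P k l = 0 by apply/eqP; rewrite eq_le Pkl P0.
    by rewrite mul0r powR0 ?ltxx// gt_eqF.
  by rewrite powR_gt0// mulr_gt0// powR_gt0// (ratio_gt0 cP).
elim: n s i => [//|n IH] s i adm /=.
have E0 := energy_gt0 adm.
have -> : ((energy (rcons s i) / e) `^ a < 1) = (energy (rcons s i) < e).
  apply/idP/idP => [|lt].
    apply: contraTT; rewrite -!leNgt => le.
    have <- : 1 `^ a = 1 :> R by rewrite powR1.
    by apply: ge0_ler_powR; rewrite ?nnegrE ?ler_pdivlMr ?mul1r//; nonneg.
  have <- : 1 `^ a = 1 :> R by rewrite powR1.
  by apply: gt0_ltr_powR; rewrite ?nnegrE ?ltr_pdivrMr ?mul1r//; nonneg.
case: ifP => // _; rewrite size_flatten /shape -map_comp sumnE big_map big_filter.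
rewrite last_rcons big_enum_cond/=; under eq_bigl do rewrite -BP.
apply: eq_bigr => j; rewrite BP => ij /=.
rewrite IH ?admissible_rcons ?adm//; congr (count_cut _ _ _ _).
rewrite energy_rcons BE -powRM.
- by congr (_ `^ _); ring.
- by rewrite mulr_ge0// powR_ge0.
- by rewrite divr_ge0// ltW.
Qed.

(** Each letter multiplies the energy by at most [b], so under the fuel condition even the words
    left when the fuel is exhausted have energy below [e]. *)
Lemma cut_lt (b : R) n e s i tau : 0 < b ->
  (forall i j, P i j * c i j `^ r <= b) ->
  admissible P (rcons s i) -> b ^+ n * energy (rcons s i) < e ->
  tau \in cut n e (rcons s i) -> energy tau < e.
Proof.
move=> b0 Pb; elim: n s i => [|n IH] s i adm /=.
  by rewrite expr0 mul1r inE => lt /eqP ->.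
case: ifP => [lt _|_ lt]; first by rewrite inE => /eqP ->.
move=> /flattenP[l /mapP[j]]; rewrite mem_filter last_rcons => /andP[ij _] -> tl.
have admj : admissible P (rcons (rcons s i) j) by rewrite admissible_rcons adm.
apply: (IH _ _ admj _ tl); apply: le_lt_trans lt.
rewrite energy_rcons exprSr -mulrA ler_wpM2l ?exprn_ge0 ?(ltW b0)//.
by rewrite mulrC ler_wpM2r// ltW// energy_gt0.
Qed.

(** Only words of energy at least [e] are extended, and one letter loses at most the factor [g]. *)
Lemma cut_ge (g : R) n e s i tau : 0 < g -> g <= 1 -> 0 < e ->
  (forall i j, edge P i j -> g <= P i j * c i j `^ r) ->
  admissible P (rcons s i) -> e * g <= energy (rcons s i) ->
  tau \in cut n e (rcons s i) -> e * g <= energy tau.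
Proof.
move=> g0 g1 e0 Pg; elim: n s i => [|n IH] s i adm ge /=.
  by rewrite inE => /eqP ->.
case: ltP => [lt|le]; first by rewrite inE => /eqP ->.
move=> /flattenP[l /mapP[j]]; rewrite mem_filter last_rcons => /andP[ij _] -> tl.
have admj : admissible P (rcons (rcons s i) j) by rewrite admissible_rcons adm.
apply: (IH _ _ admj _ tl); rewrite energy_rcons; apply: ler_pM => //.
- exact: ltW.
- exact: ltW.
- exact: Pg.
Qed.

Lemma full_cut_pairwise n e : pairwise (@incomparable m) (full_cut n e).
Proof.
apply: pairwise_flatten_map => [|i _|i j _ _ ij].
- exact: enum_uniq.
- exact: (@cut_pairwise n e [::]).
apply/allrelP => x y xc yc.
have [t -> _] := @cut_ext n e [::] i x isT xc.
have [t' -> _] := @cut_ext n e [::] j y isT yc.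
exact: (@incomparable_rcons [::]).
Qed.

Lemma full_cut_admissible n e tau : tau \in full_cut n e ->
  exists s i, tau = rcons s i /\ admissible P tau.
Proof.
move=> /flattenP[l /mapP[i _] -> tl].
have [t E adm] := @cut_ext n e [::] i tau isT tl.
case/lastP: tau E adm {tl} => [//|s j] _ adm; by exists s, j.
Qed.

Lemma full_cut_weight n e : \sum_(tau <- full_cut n e) word_weight P chi tau = 1.
Proof.
rewrite big_flatten big_map big_enum/=; have [_ <-] := chiP.
apply: eq_bigr => i _; rewrite (@cut_weight n e [::] i isT).
by rewrite /word_weight /= big_nil mulr1.
Qed.

Lemma full_cut_size (B : 'M[R]_m.+1) (a : R) n e : 0 < a -> 0 < e ->
  (forall i j, B i j = (P i j * c i j `^ r) `^ a) ->
  size (full_cut n e) = (\sum_i count_cut B n i ((chi i / e) `^ a))%N.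
Proof.
move=> a0 e0 BE; rewrite size_flatten /shape -map_comp sumnE big_map big_enum/=.
by apply: eq_bigr => i _; rewrite /= (@cut_size B a n e [::] i)// energy1.
Qed.

Lemma chi_le1 i : chi i <= 1.
Proof.
have [chi0 <-] := chiP; rewrite (bigD1 i)//= lerDl sumr_ge0// => j _.
exact: ltW.
Qed.

Lemma full_cut_lt (b : R) n e tau : 0 < b ->
  (forall i j, P i j * c i j `^ r <= b) -> b ^+ n < e ->
  tau \in full_cut n e -> energy tau < e.
Proof.
move=> b0 Pb be /flattenP[l /mapP[i _] -> tl].
apply: (@cut_lt b n e [::] i tau b0 Pb isT _ tl); apply: le_lt_trans be.
by rewrite energy1 ler_piMr ?exprn_ge0 ?(ltW b0)// chi_le1.
Qed.

Lemma full_cut_ge (g : R) n e tau : 0 < g -> g <= 1 -> 0 < e ->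
  (forall i j, edge P i j -> g <= P i j * c i j `^ r) ->
  (forall i, e * g <= chi i) ->
  tau \in full_cut n e -> e * g <= energy tau.
Proof.
move=> g0 g1 e0 Pg ge /flattenP[l /mapP[i _] -> tl].
by apply: (@cut_ge g n e [::] i tau g0 g1 e0 Pg isT _ tl); rewrite energy1.
Qed.

End Cut.

(** * Quantization error compared with a family of disjoint cylinders *)

Section Estimates.
Context {R : realType} {q m : nat}.
Variables (nrm : 'rV[R]_q -> R) (r : R) (P c : 'M[R]_m.+1).
Variables (chi : 'I_m.+1 -> R) (J : seq 'I_m.+1 -> set 'rV[R]_q).
Variable mu : probability (borel R q) R.
Hypothesis nrmP : is_norm nrm.
Hypothesis r0 : 0 < r.
Hypothesis cP : is_ratio_matrix P c.
Hypothesis JP : is_cylinder_system P c J.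
Hypothesis sepJ : separation_property P J.
Hypothesis muP : is_markov_type_measure P J chi mu.

(** What the estimates retain of a cut. Total weight 1 expresses covering in the measure sense: the
    disjoint cylinders fill all the mass of [mu]. *)
Definition cylinder_cover (L : seq (seq 'I_m.+1)) : Prop :=
  [/\ pairwise (@incomparable m) L,
      forall tau, tau \in L -> exists s i, tau = rcons s i /\ admissible P tau
    & \sum_(tau <- L) word_weight P chi tau = 1].

Lemma incomparable_irreflexive : irreflexive (@incomparable m).
Proof. by move=> s; rewrite /incomparable prefix_refl. Qed.

Lemma incomparable_sym : symmetric (@incomparable m).
Proof. by move=> s t; rewrite /incomparable andbC. Qed.

Lemma pairwise_mem (T : eqType) (e : rel T) (s : seq T) x y : symmetric e ->
  pairwise e s -> x \in s -> y \in s -> x != y -> e x y.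
Proof.
move=> esym; elim: s => //= a s IH /andP[/allP ea pe].
rewrite !inE => /predU1P[->|xs] /predU1P[->|ys].
- by rewrite eqxx.
- by move=> _; apply: ea.
- by move=> _; rewrite esym; apply: ea.
- exact: IH.
Qed.

Section Cover.
Variable L : seq (seq 'I_m.+1).
Hypothesis LP : cylinder_cover L.

(** The value [set0] off [L] makes [F] measurable at every word. *)
Let F tau : set (borel R q) := if tau \in L then J tau else set0.
Let D : set (borel R q) := \big[setU/set0]_(tau <- L) F tau.

Let F_measurable tau : measurable (F tau).
Proof.
rewrite /F; case: ifP => // tL; have [_ Ladm _] := LP.
have [s [i [E adm]]] := Ladm _ tL; rewrite E in adm *.
exact: (cylinder_measurable JP adm).
Qed.

Let D_measurable : measurable D.
Proof. by apply: bigsetU_measurable => tau _; exact: F_measurable. Qed.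

Let L_uniq : uniq L.
Proof. by have [pL _ _] := LP; apply: pairwise_uniq pL; exact: incomparable_irreflexive. Qed.

Let F_trivIset : trivIset [set` L] F.
Proof.
have [pL Ladm _] := LP; have [d [/andP[d0 _] sep]] := sepJ.
apply/trivIsetP => s t /= sL tL st; apply/seteqP; split => // x [].
rewrite /F sL tL => Js Jt.
have inc := pairwise_mem incomparable_sym pL sL tL st.
have [s' [i [sE adms]]] := Ladm _ sL; have [t' [j [tE admt]]] := Ladm _ tL.
have := incomparable_separated cP JP d0 sep inc adms admt Js Jt.
rewrite subrr enorm0 leNgt => /negP; apply.
rewrite sE in adms *; rewrite mulr_gt0// lt_max (cylinder_diam JP adms).
by rewrite (edge_prod_gt0 cP adms).
Qed.

Let mu_F tau : tau \in L -> mu (F tau) = (word_weight P chi tau)%:E.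
Proof.
have [_ Ladm _] := LP; move=> tL; rewrite /F tL; have [s [i [E adm]]] := Ladm _ tL.
by rewrite E in adm *; exact: (markov_type_cylinder cP JP sepJ muP adm).
Qed.

Let integral_F_cst tau (z : R) : tau \in L ->
  (\int[mu]_(x in F tau) cst z%:E x = (z * word_weight P chi tau)%:E)%E.
Proof. by move=> tL; rewrite integral_cst// EFinM; congr (_ * _)%E; exact: mu_F. Qed.

Let integral_D (f : borel R q -> \bar R) : measurable_fun setT f ->
  (forall x, 0 <= f x)%E ->
  (\int[mu]_(x in D) f x = \sum_(tau <- L) \int[mu]_(x in F tau) f x)%E.
Proof.
move=> mf f0; apply: ge0_integral_bigsetU => //.
exact: measurable_funTS.
Qed.

Let mu_D : mu D = 1%E.
Proof.
have := integral_D (measurable_cst 1%E) (fun=> lee01).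
rewrite integral_cst// mul1e => ->.
rewrite (eq_big_seq (fun tau => (word_weight P chi tau)%:E)) => [|tau tL].
  by rewrite sumEFin; have [_ _ ->] := LP.
by rewrite integral_cst// mul1e; exact: mu_F.
Qed.

Let mu_DC : mu (~` D) = 0%E.
Proof. by rewrite probability_setC// mu_D subee. Qed.

Let pd_measurable (alpha : set 'rV[R]_q) : alpha !=set0 ->
  measurable_fun [set: borel R q] (fun x => (pointdist nrm x alpha `^ r)%:E).
Proof.
move=> a0; apply/measurable_EFinP.
apply: (measurableT_comp (measurable_powR r)).
exact: continuous_measurable_borel (pointdist_continuous nrmP a0).
Qed.

Let powR_lee0 (alpha : set 'rV[R]_q) x : (0 <= (pointdist nrm x alpha `^ r)%:E)%E.
Proof. by rewrite lee_fin powR_ge0. Qed.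

(** On [J tau] the distance to the chosen point is at most [C] times the diameter, so its share of
    the integral is at most [C^r] times its energy; the complement of the cylinders is
    negligible. *)
Lemma quant_error_le (C e : R) n : 0 < C -> 0 <= e -> (size L <= n)%N ->
  (forall x, nrm x <= C * enorm x) ->
  (forall tau, tau \in L -> energy P c chi r tau <= e) ->
  (poweR (quant_error nrm r mu n) r <= (C `^ r * (size L)%:R * e)%:E)%E.
Proof.
move=> C0 e0 Ln nC Le; have [_ Ladm Lw] := LP.
pose pt tau := xget 0 (J tau).
pose alpha := pt @` [set` L].
have [tau0 tau0L] : exists tau, tau \in L.
  move: Lw; case: (L) => [|t l]; last by exists t; rewrite mem_head.
  by rewrite big_nil => /eqP; rewrite eq_sym oner_eq0.
have a0 : alpha !=set0 by exists (pt tau0), tau0.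
have acard : (alpha #<= `I_n)%card.
  apply/pcard_surjP; exists (fun k => pt (nth [::] L k)) => _ [tau tL <-].
  exists (index tau L) => /=; last by rewrite nth_index.
  by apply: leq_trans Ln; rewrite index_mem.
have int_le : (\int[mu]_x (pointdist nrm x alpha `^ r)%:E <=
    (C `^ r * (size L)%:R * e)%:E)%E.
  rewrite (ge0_negligible_integral (measurableC D_measurable) measurableT
    (pd_measurable a0) (fun x _ => powR_lee0 alpha x) mu_DC).
  rewrite setTD setCK integral_D//; last exact: pd_measurable.
  have -> : ((C `^ r * (size L)%:R * e)%:E = \sum_(tau <- L) (C `^ r * e)%:E)%E.
    rewrite sumEFin; congr (_%:E).
    by rewrite big_const_seq count_predT iter_addr_0 -mulr_natr; ring.
  rewrite big_seq [leRHS]big_seq; apply: lee_sum => tau tL.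
  have [s [i [E adm]]] := Ladm _ tL.
  have diamE : diam (J tau) = edge_prod c tau.
    by rewrite E in adm *; exact: (cylinder_diam JP).
  have [cJ nJ] : compact (J tau) /\ J tau !=set0.
    by rewrite E in adm *; exact: (cylinder_compact JP).
  apply: (@le_trans _ _ (\int[mu]_(x in F tau) cst (((C * edge_prod c tau) `^ r)%:E) x)%E).
    apply: ge0_le_integral => //.
      by apply: measurable_funTS; exact: pd_measurable.
    move=> x; rewrite /F tL => Jx; rewrite lee_fin.
    have c0 : 0 <= edge_prod c tau by apply: edge_prod_ge0 => k l; exact: (ratio_ge0 cP).
    apply: ge0_ler_powR; rewrite ?nnegrE ?pointdist_ge0 ?(ltW r0)//.
      by rewrite mulr_ge0// ltW.
    have at_ : alpha (pt tau) by exists tau.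
    apply: le_trans (pointdist_le nrmP x at_) _; apply: le_trans (nC _) _.
    rewrite ler_wpM2l ?(ltW C0)// -diamE; apply: le_diam => //.
    by rewrite /pt; case: nJ => y yJ; exact: (xgetPex 0 (ex_intro _ y yJ)).
  rewrite integral_F_cst// lee_fin.
  rewrite powRM ?(ltW C0)//; last by apply: edge_prod_ge0 => k l; exact: (ratio_ge0 cP).
  have := Le _ tL; rewrite /energy => H.
  by rewrite -mulrA ler_wpM2l ?powR_ge0// mulrC.
have : (quant_error nrm r mu n <= (C `^ r * (size L)%:R * e)%:E `^ r^-1)%E.
  apply: (@le_trans _ _ ((\int[mu]_x (pointdist nrm x alpha `^ r)%:E) `^ r^-1)%E).
    by apply: ereal_inf_lbound; exists alpha.
  apply: gt0_ler_poweR => //; first by rewrite invr_ge0 ltW.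
    by apply: mem_itv0y; apply: integral_ge0.
  by apply: mem_itv0y; rewrite lee_fin mulr_ge0// mulr_ge0 ?powR_ge0.
have qe0 : (0 <= quant_error nrm r mu n)%E.
  by apply: le_ereal_inf_tmp => _ [a _ <-]; exact: poweR_ge0.
move=> H; have := gt0_ler_poweR (ltW r0) _ _ H.
rewrite -poweRrM mulVf ?gt_eqF// poweRe1; last first.
  by rewrite lee_fin mulr_ge0// mulr_ge0 ?powR_ge0.
by apply; apply: mem_itv0y => //; exact: poweR_ge0.
Qed.

(** A cylinder is [bad] if a point of [alpha] comes within [k] times its diameter. The factor 1/2 in
    [k] prevents one point from spoiling two cylinders, which would then be closer than the
    separation allows. So [nb] is injective on bad cylinders, at most [n] are bad, and each of the
    at least [n] others contributes [k^r e] or more. *)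
Lemma quant_error_ge (c1 d e : R) n : 0 < c1 -> 0 < d -> 0 <= e ->
  separated_by P J d ->
  (2 * n <= size L)%N -> (forall x, c1 * enorm x <= nrm x) ->
  (forall tau, tau \in L -> e <= energy P c chi r tau) ->
  (((c1 * d / 2) `^ r * n%:R * e)%:E <= poweR (quant_error nrm r mu n) r)%E.
Proof.
move=> c10 d0 e0 sep Ln nc Le; have [pL Ladm Lw] := LP.
pose k := c1 * d / 2; have k0 : 0 < k by rewrite /k !mulr_gt0.
suff H : (((k `^ r * n%:R * e) `^ r^-1)%:E <= quant_error nrm r mu n)%E.
  have := gt0_ler_poweR (ltW r0) _ _ H; rewrite poweR_EFin -powRrM mulVf ?gt_eqF//.
  have K0 : 0 <= k `^ r * n%:R * e by rewrite !mulr_ge0 ?powR_ge0.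
  rewrite powRr1//; apply; apply: mem_itv0y.
    by rewrite lee_fin powR_ge0.
  by apply: le_trans H; rewrite lee_fin powR_ge0.
apply: le_ereal_inf_tmp => _ [alpha [a0 acard] <-].
have K0 : 0 <= k `^ r * n%:R * e by rewrite !mulr_ge0 ?powR_ge0.
rewrite -poweR_EFin; apply: gt0_ler_poweR; rewrite ?invr_ge0 ?(ltW r0)//.
- by apply: mem_itv0y; rewrite lee_fin.
- by apply: mem_itv0y; apply: integral_ge0.
have fa : finite_set alpha by apply/finite_set_leP; exists n.
pose A : seq 'rV[R]_q := finmap.enum_fset (fset_set alpha).
have Asz : (size A <= n)%N by exact: geq_card_fset_set.
have AP a : alpha a -> a \in A by move=> aa; exact: etrans (in_fset_set fa a) (mem_set aa).
pose bad tau := `[< exists a x, [/\ alpha a, J tau x & nrm (x - a) < k * diam (J tau)] >].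
have badP : forall tau, exists a, bad tau ->
    alpha a /\ exists2 x, J tau x & nrm (x - a) < k * diam (J tau).
  move=> tau; have [/asboolP[a [x [aa Jx ax]]]|_] := boolP (bad tau).
    by exists a => _; split => //; exists x.
  by exists 0.
have [nb nbP] := choice badP.
have bad_size : (size [seq tau <- L | bad tau] <= n)%N.
  apply: leq_trans Asz; rewrite -(size_map nb); apply: uniq_leq_size.
    rewrite map_inj_in_uniq ?filter_uniq// => s t.
    rewrite !mem_filter => /andP[bs sL] /andP[bt tL] E.
    apply: contrapT => /eqP st.
    have [as_ [x Jx xs]] := nbP _ bs; have [at_ [y Jy yt]] := nbP _ bt.
    have inc := pairwise_mem incomparable_sym pL sL tL st.
    have [s' [i [sE adms]]] := Ladm _ sL; have [t' [j [tE admt]]] := Ladm _ tL.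
    have := incomparable_separated cP JP d0 sep inc adms admt Jx Jy.
    have : nrm (x - y) < 2 * k * Num.max (diam (J s)) (diam (J t)).
      apply: le_lt_trans (is_norm_triangle nrmP x (nb s) y) _.
      rewrite (is_normB nrmP (nb s)) E -E.
      apply: lt_le_trans (ltrD xs (_ : nrm (y - nb s) < k * diam (J t))) _.
        by rewrite E.
      have [h1 h2] : diam (J s) <= Num.max (diam (J s)) (diam (J t)) /\
          diam (J t) <= Num.max (diam (J s)) (diam (J t)).
        by rewrite !le_max !lexx orbT.
      have H := lerD (ler_wpM2l (ltW k0) h1) (ler_wpM2l (ltW k0) h2).
      by apply: (le_shift H); ring.
    move=> H1 H2; have := nc (x - y); move: H1.
    have -> : 2 * k = c1 * d by rewrite /k; field.
    move: H2 => /(ler_wpM2l (ltW c10)); rewrite mulrA => H2 H1 H3.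
    by have := le_lt_trans (le_trans H2 H3) H1; rewrite ltxx.
  by move=> a /mapP[tau]; rewrite mem_filter => /andP[bt _] ->; apply/AP/(nbP _ bt).1.
pose good := [seq tau <- L | ~~ bad tau].
have good_size : (n <= size good)%N.
  have := count_predC bad L; rewrite -!size_filter => E.
  rewrite -(leq_add2l (size [seq tau <- L | bad tau])) E.
  by apply: leq_trans Ln; rewrite mul2n -addnn leq_add2r.
apply: (@le_trans _ _ (\int[mu]_(x in D) (pointdist nrm x alpha `^ r)%:E)%E); last first.
  apply: ge0_subset_integral => //; exact: pd_measurable.
rewrite integral_D//; last exact: pd_measurable.
apply: (@le_trans _ _ (\sum_(tau <- L | ~~ bad tau) (k `^ r * e)%:E)%E).
  rewrite -big_filter sumEFin big_const_seq count_predT iter_addr_0 lee_fin.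
  rewrite -[leRHS]mulr_natr [leLHS]mulrAC; apply: ler_wpM2l; last by rewrite ler_nat.
  by rewrite mulr_ge0 ?powR_ge0.
rewrite big_mkcond big_seq [leRHS]big_seq; apply: lee_sum => tau tL.
case: ifPn => [nbad|_]; last by apply: integral_ge0.
have [s [i [E adm]]] := Ladm _ tL.
have diamE : diam (J tau) = edge_prod c tau.
  by rewrite E in adm *; exact: (cylinder_diam JP).
have c0 : 0 <= edge_prod c tau by apply: edge_prod_ge0 => ? ?; exact: (ratio_ge0 cP).
apply: (@le_trans _ _ (\int[mu]_(x in F tau) cst (((k * edge_prod c tau) `^ r)%:E) x)%E).
  rewrite integral_F_cst// lee_fin powRM ?(ltW k0)//.
  rewrite -mulrA ler_wpM2l ?powR_ge0// mulrC.
  exact: Le.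
apply: ge0_le_integral => //.
- by move=> x _; rewrite /= lee_fin powR_ge0.
- by apply: measurable_funTS; exact: pd_measurable.
move=> x; rewrite /F tL => Jx; rewrite lee_fin.
apply: ge0_ler_powR; rewrite ?nnegrE ?pointdist_ge0 ?(ltW r0)//.
  by rewrite mulr_ge0// ltW.
apply: pointdist_lb => // a aa; rewrite leNgt; apply/negP => lt.
by move/asboolP: nbad; apply; exists a, x; split => //; rewrite diamE.
Qed.

End Cover.
End Estimates.

(** * Asymptotics *)

Section Eventually.
Context {R : realType}.

Lemma limn_esup_le (u : (\bar R)^nat) (x : \bar R) n0 :
  (forall n, (n0 <= n)%N -> (u n <= x)%E) -> (limn_esup u <= x)%E.
Proof.
move=> ux; apply: (@le_trans _ _ (ereal_sup (u @` [set n | (n0 <= n)%N]))).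
  by apply: ereal_inf_lbound; exists [set n | (n0 <= n)%N] => //; exists n0.
by apply: ge_ereal_sup => _ [n /= nn <-]; exact: ux.
Qed.

Lemma limn_einf_ge (u : (\bar R)^nat) (x : \bar R) n0 :
  (forall n, (n0 <= n)%N -> (x <= u n)%E) -> (x <= limn_einf u)%E.
Proof.
move=> ux; rewrite leeNr; apply: (@limn_esup_le _ _ n0) => n nn.
by rewrite leeN2 ux.
Qed.

Lemma exists_natr_ge (X : R) : exists n0, forall n, (n0 <= n)%N -> X <= n%:R.
Proof.
exists (Num.Def.archi_bound `|X|) => n nn.
apply: (le_trans (ler_norm X)); apply: le_trans (ltW (archi_boundP (normr_ge0 X))) _.
by rewrite ler_nat.
Qed.

Lemma exists_ln_ge (X : R) : exists n0, forall n, (n0 <= n)%N -> X <= ln n%:R :> R.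
Proof.
have [n0 H] := exists_natr_ge (expR X); exists n0 => n nn.
have n_gt0 : 0 < n%:R :> R by apply: lt_le_trans (expR_gt0 X) (H n nn).
by rewrite -[X]expRK ler_ln ?posrE ?expR_gt0// H.
Qed.

Lemma exists_expr_lt (b e : R) : 0 < b < 1 -> 0 < e -> exists n, b ^+ n < e.
Proof.
move=> /andP[b0 b1] e0; have b1' : `|b| < 1 by rewrite ger0_norm// ltW.
have /cvgrPdist_lt/(_ e e0)[n _ /(_ n (leqnn n))] := cvg_expr b1'.
by rewrite /= sub0r normrN ger0_norm ?exprn_ge0 ?(ltW b0)// => ?; exists n.
Qed.

End Eventually.

(* [u] plays the role of the sequence of quantization errors. *)
Section Asymptotics.
Context {R : realType}.
Variables (u : (\bar R)^nat) (r s : R).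
Hypothesis r0 : 0 < r.
Hypothesis s0 : 0 < s.
Hypothesis u0 : forall n, (0 <= u n)%E.

Let scaled s n := ((n%:R `^ (r / s))%:E * poweR (u n) r)%E.
Let ratio n := ((ln n%:R)%:E / (- lne (u n)))%E.

(** In logarithms the two bounds place [- ln (u n)] between [ln n / s' - K] and [ln n / s + K]. The
    constants disappear in the ratio, and [s'] may be taken arbitrarily close to [s]. *)
Lemma dimension_of_bounds (A : R) n0 : 0 < A ->
  (forall n, (n0 <= n)%N -> (A%:E <= scaled s n)%E) ->
  (forall s', s < s' -> exists (C : R) n1, forall n, (n1 <= n)%N ->
     (scaled s' n <= C%:E)%E) ->
  limn_esup ratio = s%:E /\ limn_einf ratio = s%:E.
Proof.
move=> A0 lo up.
have logs s' : s < s' -> exists (K : R) n1, forall n, (n1 <= n)%N ->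
    exists l : R, [/\ (- lne (u n))%E = l%:E, ln n%:R / s' - K <= l
      & l <= ln n%:R / s + K].
  move=> ss'; have s'0 : 0 < s' by apply: lt_trans ss'.
  have [C [n1 upC]] := up s' ss'.
  exists ((`|ln C| + `|ln A|) / r), (maxn (maxn n0 n1) 1) => n.
  rewrite !geq_max => /andP[/andP[nn0 nn1] n1'].
  have n_gt0 : 0 < n%:R :> R by rewrite ltr0n.
  (* The upper bound excludes an infinite error and the positive lower bound excludes a zero one, so
     logarithms are real. *)
  have := upC n nn1; have := lo n nn0; have := u0 n; rewrite /scaled.
  case: (u n) => [q| |] //; last first.
    by move=> _ _; rewrite poweRyr ?gt_eqF// gt0_muley ?lte_fin ?powR_gt0// leye_eq.
  rewrite lee_fin poweR_EFin -!EFinM !lee_fin => q0 Aq qC.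
  have qr0 : 0 < q `^ r.
    rewrite lt_neqAle powR_ge0 andbT eq_sym; apply/eqP => E.
    by move: Aq; rewrite E mulr0 leNgt A0.
  have qp : 0 < q.
    rewrite lt_neqAle q0 andbT eq_sym; apply/eqP => E.
    by move: qr0; rewrite E powR0 ?gt_eqF// ltxx.
  have ns0 t : 0 < n%:R `^ t :> R by rewrite powR_gt0.
  have C0 : 0 < C by apply: lt_le_trans qC; rewrite mulr_gt0.
  exists (- ln q); rewrite lne_EFin//; split => //.
    have := qC; rewrite -ler_ln ?posrE ?mulr_gt0// lnM ?posrE// !ln_powR => H.
    have := ler_norm (ln C); have := normr_ge0 (ln A) => h1 h2.
    rewrite -(ler_pM2l r0) mulrBr.
    have -> : r * (ln n%:R / s') = r / s' * ln n%:R by ring.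
    have -> : r * ((`|ln C| + `|ln A|) / r) = `|ln C| + `|ln A|.
      by field; rewrite gt_eqF.
    by lra.
  have : ln A <= ln (n%:R `^ (r / s) * q `^ r).
    by rewrite ler_ln ?posrE ?mulr_gt0.
  rewrite lnM ?posrE// !ln_powR => H.
  have := ler_norm (- ln A); rewrite normrN; have := normr_ge0 (ln C) => h1 h2.
  rewrite -(ler_pM2l r0) mulrDr.
  have -> : r * (ln n%:R / s) = r / s * ln n%:R by ring.
  have -> : r * ((`|ln C| + `|ln A|) / r) = `|ln C| + `|ln A|.
    by field; rewrite gt_eqF.
  by lra.
have bounds eta : 0 < eta -> exists n1, forall n, (n1 <= n)%N ->
    ((s - eta)%:E <= ratio n <= (s + eta)%:E)%E.
  move=> eta0; pose s' := s + eta / 2.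
  have ss' : s < s' by rewrite /s'; lra.
  have s'0 : 0 < s' by apply: lt_trans ss'.
  have [K [n1 H]] := logs s' ss'.
  pose del := (s + eta) / s' - 1.
  have del0 : 0 < del by rewrite subr_gt0 ltr_pdivlMr// mul1r /s'; lra.
  (* The first threshold makes [- ln (u n)] positive; the other two absorb [K] in the upper and in
     the lower estimate of the ratio. *)
  have [n2 H2] := exists_ln_ge (Num.max (s' * (`|K| + 1))
     (Num.max ((s + eta) * `|K| / del) (s * (s + eta) * `|K| / eta))).
  exists (maxn n1 n2) => n; rewrite geq_max => /andP[nn1 nn2].
  have := H2 n nn2; rewrite !ge_max => /and3P[b1 b2 b3].
  have [l [lE l1 l2]] := H n nn1.
  have Kn := ler_norm K; have Kn0 := normr_ge0 K.
  have lp : 0 < l.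
    apply: lt_le_trans l1; rewrite subr_gt0 ltr_pdivlMr//.
    apply: lt_le_trans b1; rewrite mulrC ltr_pM2l//; lra.
  have L0 : 0 <= ln n%:R :> R.
    by apply: le_trans b1; rewrite mulr_ge0// ?(ltW s'0)//; lra.
  rewrite /ratio lE inver gt_eqF// -EFinM !lee_fin; apply/andP; split.
    rewrite ler_pdivlMr//; have [se|se] := leP (s - eta) 0.
      by apply: le_trans L0; rewrite mulr_le0_ge0// ltW.
    apply: (@le_trans _ _ ((s - eta) * (ln n%:R / s + K))).
      by rewrite ler_wpM2l// ltW.
    have : eta / s * ln n%:R >= (s + eta) * `|K|.
      move: b3; rewrite ler_pdivrMr// => b3.
      rewrite mulrAC ler_pdivlMr//; apply: le_trans (_ : ln n%:R * eta <= _); last by rewrite mulrC.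
      by apply: le_trans b3; rewrite le_eqVlt; apply/orP; left; apply/eqP; ring.
    have -> : (s - eta) * (ln n%:R / s + K) =
        ln n%:R - eta / s * ln n%:R + (s - eta) * K.
      by field; rewrite gt_eqF.
    have : (s - eta) * K <= (s + eta) * `|K|.
      apply: (@le_trans _ _ ((s - eta) * `|K|)).
        by rewrite ler_wpM2l// ltW.
      by rewrite ler_wpM2r//; lra.
    by lra.
  rewrite ler_pdivrMr//; apply: (@le_trans _ _ ((s + eta) * (ln n%:R / s' - K))); last first.
    by rewrite ler_wpM2l// addr_ge0// ltW.
  have : del * ln n%:R >= (s + eta) * `|K|.
    by rewrite (mulrC del) -ler_pdivrMr.
  have : (s + eta) * K <= (s + eta) * `|K|.
    by rewrite ler_wpM2l// addr_ge0// ltW.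
  have -> : (s + eta) * (ln n%:R / s' - K) = (del + 1) * ln n%:R - (s + eta) * K.
    by rewrite /del; field; rewrite gt_eqF.
  by lra.
have sup_le : (limn_esup ratio <= s%:E)%E.
  apply/lee_addgt0Pr => e e0; have [n1 H] := bounds e e0.
  by rewrite -EFinD; apply: (@limn_esup_le _ _ _ n1) => n nn; have /andP[] := H n nn.
have inf_ge : (s%:E <= limn_einf ratio)%E.
  apply/lee_subgt0Pr => e e0; have [n1 H] := bounds e e0.
  by rewrite -EFinB; apply: (@limn_einf_ge _ _ _ n1) => n nn; have /andP[] := H n nn.
have := limn_einf_sup ratio => le; split; apply/eqP; rewrite eq_le.
  by rewrite sup_le (le_trans inf_ge).
by rewrite inf_ge (le_trans le).
Qed.

End Asymptotics.

(** * Rates of the cut sizes and of the quantization errors *)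

Section Main.
Context {R : realType} {q m : nat}.
Variables (nrm : 'rV[R]_q -> R) (r : R) (P c : 'M[R]_m.+1).
Variables (chi : 'I_m.+1 -> R) (J : seq 'I_m.+1 -> set 'rV[R]_q).
Variables (mu : probability (borel R q) R) (s : R).
Hypothesis nrmP : is_norm nrm.
Hypothesis r0 : 0 < r.
Hypothesis PP : is_transition_matrix P.
Hypothesis cP : is_ratio_matrix P c.
Hypothesis chiP : is_positive_probability_vector chi.
Hypothesis JP : is_cylinder_system P c J.
Hypothesis sepJ : separation_property P J.
Hypothesis muP : is_markov_type_measure P J chi mu.
Hypothesis sP : is_sr P c r s.

Let B := weight_mx P c r s.
Let a := s / (s + r).

Let s0 : 0 < s. Proof. by have [] := sP. Qed.
Let a0 : 0 < a. Proof. by rewrite divr_gt0// addr_gt0. Qed.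

Lemma weight_mxE i j : B i j = (P i j * c i j `^ r) `^ a.
Proof. by rewrite mxE. Qed.

Lemma weight_mx_ge0 : nonneg_mx B.
Proof. by move=> i j; rewrite weight_mxE powR_ge0. Qed.

Lemma weight_mx_gt0 i j : (0 < B i j) = edge P i j.
Proof.
have [P0 _ _] := PP; rewrite weight_mxE /edge; apply/idP/idP => [|Pij].
  apply: contraTT; rewrite -leNgt => Pij.
  have -> : P i j = 0 by apply/eqP; rewrite eq_le Pij P0.
  by rewrite mul0r powR0 ?ltxx// gt_eqF.
by rewrite powR_gt0// mulr_gt0// powR_gt0// (ratio_gt0 cP).
Qed.

Lemma perron_root_weight_mx : perron_root B = 1.
Proof.
by have [_ <-] := sP; rewrite spectral_radiusE//; exact: weight_mx_ge0.
Qed.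

Lemma criticalP H : critical P c r s H <-> critical_class P B H.
Proof.
have sub0 : H != finset.set0 ->
    spectral_radius (weight_submx P c r H s) = perron_root (mask_mx B H).
  move=> H0; rewrite spectral_radiusE.
  - by rewrite -(perron_root_submx weight_mx_ge0 H0).
  - by rewrite card_gt0.
  - by move=> i j; rewrite mxE weight_mx_ge0.
split => -[scH sp]; have [[H0 _] _] := scH.
  by split => //; case: sp => _; rewrite (sub0 H0).
by split => //; split => //; rewrite (sub0 H0).
Qed.

(** [g] limits the overshoot of one letter below [e], [b] is the decay rate that determines the
    fuel; minima with 1/2 keep both strictly between 0 and 1. *)
Lemma exists_energy_bounds : exists g b : R, [/\ 0 < g < 1, 0 < b < 1,
  forall i j, edge P i j -> g <= P i j * c i j `^ r
  & forall i j, P i j * c i j `^ r <= b].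
Proof.
have [P0 P1 _] := PP.
have Ple1 i j : P i j <= 1.
  by rewrite -(P1 i) (bigD1 j)//= lerDl sumr_ge0.
have c_lt1 i j : c i j `^ r < 1.
  have <- : 1 `^ r = 1 :> R by rewrite powR1.
  apply: gt0_ltr_powR; rewrite ?nnegrE ?ler01 ?(ratio_ge0 cP)//.
  exact: ratio_lt1 cP _ _.
have lt1 ij : 0 < 1 - P ij.1 ij.2 * c ij.1 ij.2 `^ r.
  rewrite subr_gt0; apply: le_lt_trans (c_lt1 ij.1 ij.2).
  by rewrite ler_piMl ?powR_ge0.
have [d d0 dle] := @finite_pos_lb R ('I_m.+1 * 'I_m.+1)%type xpredT _ (fun ij _ => lt1 ij).
have [|g g0 gle] := @finite_pos_lb R ('I_m.+1 * 'I_m.+1)%type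
    (fun ij => edge P ij.1 ij.2) (fun ij => P ij.1 ij.2 * c ij.1 ij.2 `^ r).
  by move=> ij e; rewrite mulr_gt0// powR_gt0// (ratio_gt0 cP).
exists (Num.min g (1 / 2)), (1 - Num.min d (1 / 2)); split.
- by rewrite lt_min g0 gt_min; lra.
- have : Num.min d (1 / 2) <= 1 / 2 by rewrite ge_min lexx orbT.
  have : 0 < Num.min d (1 / 2) by rewrite lt_min d0; lra.
  by lra.
- by move=> i j ij; apply: le_trans (gle (i, j) ij); rewrite ge_min lexx.
- move=> i j; have := dle (i, j) isT => /=.
  have : Num.min d (1 / 2) <= d by rewrite ge_min lexx.
  by lra.
Qed.

Section Bounds.
Variables g b : R.
Hypothesis g01 : 0 < g < 1.
Hypothesis b01 : 0 < b < 1.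
Hypothesis gP : forall i j, edge P i j -> g <= P i j * c i j `^ r.
Hypothesis bP : forall i j, P i j * c i j `^ r <= b.

Let g0 : 0 < g. Proof. by case/andP: g01. Qed.
Let b0 : 0 < b. Proof. by case/andP: b01. Qed.

Let powa_lt1 x : 0 < x < 1 -> x `^ a < 1.
Proof.
move=> /andP[x0 x1]; have <- : 1 `^ a = 1 :> R by rewrite powR1.
by apply: gt0_ltr_powR => //; rewrite nnegrE// ltW.
Qed.

Let powa_le x y : 0 <= x -> x <= y -> x `^ a <= y `^ a.
Proof.
move=> x0 xy; apply: ge0_ler_powR => //; first exact: ltW.
by rewrite nnegrE (le_trans x0).
Qed.

Let edge_ge0 i j : 0 <= P i j * c i j `^ r.
Proof. by have [P0 _ _] := PP; rewrite mulr_ge0// powR_ge0. Qed.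

Let ga0 : 0 < g `^ a. Proof. exact: powR_gt0. Qed.
Let ga1 : g `^ a < 1. Proof. exact: powa_lt1. Qed.
Let Bga i j : 0 < B i j -> g `^ a <= B i j.
Proof.
by rewrite weight_mx_gt0 weight_mxE => ij; apply: powa_le; [exact: ltW|exact: gP].
Qed.
Let ba01 : 0 < b `^ a < 1. Proof. by rewrite powR_gt0//= powa_lt1. Qed.
Let Bba i j : B i j <= b `^ a.
Proof. by rewrite weight_mxE; apply: powa_le. Qed.

Let cut_n n e := full_cut P c chi r n e.

Let cut_nE n e : 0 < e ->
  (size (cut_n n e))%:R = \sum_i (count_cut B n i ((chi i / e) `^ a))%:R :> R.
Proof.
move=> e0; rewrite /cut_n (full_cut_size PP cP chiP n a0 e0 weight_mxE).
by rewrite natr_sum.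
Qed.

Let chi_pow e i : 0 < e -> (chi i / e) `^ a = chi i `^ a * e^-1 `^ a.
Proof.
by move=> e0; rewrite powRM ?invr_ge0 ?(ltW e0)//; have [chi0 _] := chiP; rewrite ltW.
Qed.

Let cut_fuel n e i : 0 < e -> b ^+ n < e -> (b `^ a) ^+ n * (chi i / e) `^ a < 1.
Proof.
move=> e0 be; have [chi0 _] := chiP.
have -> : (b `^ a) ^+ n = (b ^+ n) `^ a.
  by rewrite -powR_mulrn ?powR_ge0// -powRrM mulrC powRrM powR_mulrn// ltW.
rewrite -powRM ?exprn_ge0 ?(ltW b0)//; last by rewrite divr_ge0 ?ltW.
apply: powa_lt1; rewrite mulr_gt0 ?exprn_gt0 ?divr_gt0//= mulrA ltr_pdivrMr// mul1r.
apply: le_lt_trans be; rewrite ler_piMr ?exprn_ge0 ?(ltW b0)//.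
exact: chi_le1 chiP i.
Qed.

Let chi_lb : exists2 e0, 0 < e0 & forall i, e0 <= chi i.
Proof.
have [chi0 _] := chiP.
have [e0 e00 H] := @finite_pos_lb R 'I_m.+1 xpredT chi (fun i _ => chi0 i).
by exists e0 => // i; exact: H.
Qed.

Let y_ge1 e e0 i : 0 < e -> e <= e0 -> e0 <= chi i -> 1 <= (chi i / e) `^ a.
Proof.
move=> ep ee0 e0c; have <- : 1 `^ a = 1 :> R by rewrite powR1.
by apply: powa_le => //; rewrite ler_pdivlMr// mul1r (le_trans ee0).
Qed.

Let size_ge_term n e i : 0 < e ->
  (count_cut B n i ((chi i / e) `^ a))%:R <= (size (cut_n n e))%:R :> R.
Proof.
by move=> e0; rewrite cut_nE// (bigD1 i)//= lerDl sumr_ge0.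
Qed.

(** The fuel must suffice for all words to drop below [e]; upper bounds on the size hold at every
    fuel. *)
Definition cut_ge_bound (K : R) : Prop := exists e1, 0 < e1 /\
  forall n e, 0 < e -> e <= e1 -> b ^+ n < e ->
    K * e^-1 `^ a <= (size (full_cut P c chi r n e))%:R.

Definition cut_le_bound (p K : R) : Prop := exists e1, 0 < e1 /\
  forall n e, 0 < e -> e <= e1 -> (size (full_cut P c chi r n e))%:R <= K * e^-1 `^ p.

Lemma cut_lower : exists2 K, 0 < K & cut_ge_bound K.
Proof.
have [chi0 _] := chiP; have [e0 e00 e0P] := chi_lb.
have [i [k [k0 kP]]] := count_cut_linear_ge weight_mx_ge0 weight_mx_gt0
  perron_root_weight_mx ba01 Bba.
exists (k * chi i `^ a); first by rewrite mulr_gt0// powR_gt0.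
exists e0; split => // n e ep ee0 be.
apply: le_trans (size_ge_term n i ep); rewrite -mulrA -chi_pow//.
by apply: kP; [exact: y_ge1 ee0 (e0P i)|exact: cut_fuel].
Qed.

Lemma cut_superlinear :
  (exists H1 H2, [/\ critical_class P B H1, critical_class P B H2, H1 != H2
    & precedes P H1 H2]) -> forall K, cut_ge_bound K.
Proof.
move=> [H1 [H2 [c1 c2 neq prec]]] K.
have [chi0 _] := chiP; have [e0 e00 e0P] := chi_lb.
have [i iP] := count_cut_superlinear weight_mx_ge0 weight_mx_gt0
  ba01 Bba c1 c2 neq prec.
have [y0 y0P] := iP (K / chi i `^ a).
have ci0 : 0 < chi i `^ a by rewrite powR_gt0.
(* Once [e^-a >= z], the starting value [(chi i / e)^a] is at least [|y0| + 1], beyond the threshold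
   [y0]. *)
pose z := (`|y0| + 1) / chi i `^ a.
have z0 : 0 < z by rewrite divr_gt0// ltr_wpDl.
have za0 : 0 < z `^ a^-1 by rewrite powR_gt0.
exists (Num.min e0 (z `^ a^-1)^-1); split; first by rewrite lt_min e00 invr_gt0.
move=> n e ep; rewrite le_min => /andP[ee0 ez] be.
apply: le_trans (size_ge_term n i ep).
have := y0P n ((chi i / e) `^ a) _ (y_ge1 ep ee0 (e0P i)) (cut_fuel i ep be).
rewrite chi_pow// mulrA divfK ?gt_eqF//; apply.
have : z <= e^-1 `^ a.
  have -> : z = (z `^ a^-1) `^ a by rewrite -powRrM mulVf ?gt_eqF// powRr1// ltW.
  by apply: powa_le; [exact: ltW|rewrite -[leLHS]invrK lef_pV2 ?posrE ?invr_gt0].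
rewrite /z ler_pdivrMr// mulrC; apply: le_trans.
by rewrite (le_trans (ler_norm y0))// lerDl.
Qed.

Lemma cut_upper_of (t C : R) : 0 < C -> 0 < t ->
  (forall n i y, 1 <= y -> (count_cut B n i y)%:R <= C * y `^ t) ->
  exists2 K, 0 < K & cut_le_bound (a * t) K.
Proof.
move=> C0 t0 CP; have [chi0 _] := chiP; have [e0 e00 e0P] := chi_lb.
exists (m.+1%:R * C); first by rewrite mulr_gt0.
exists e0; split => // n e ep ee0; rewrite cut_nE//.
have -> : m.+1%:R * C * e^-1 `^ (a * t) = \sum_(i < m.+1) C * e^-1 `^ (a * t).
  by rewrite sumr_const card_ord -[RHS]mulr_natl mulrA.
apply: ler_sum => i _; apply: le_trans (CP n i _ (y_ge1 ep ee0 (e0P i))) _.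
rewrite ler_wpM2l ?(ltW C0)// powRrM; apply: ge0_ler_powR.
- exact: ltW.
- by rewrite nnegrE powR_ge0.
- by rewrite nnegrE powR_ge0.
apply: powa_le; first by rewrite divr_ge0 ?ltW.
by rewrite ler_piMl ?invr_ge0 ?(ltW ep)// (chi_le1 chiP).
Qed.

Lemma cut_upper_power t : 0 < t -> exists2 K, 0 < K & cut_le_bound (a * (1 + t)) K.
Proof.
move=> t0; have [C [C0 CP]] := count_cut_power_le weight_mx_ge0
  perron_root_weight_mx ga0 ga1 Bga ba01 Bba t0.
by apply: (cut_upper_of C0 _ CP); rewrite addr_gt0.
Qed.

Lemma cut_upper_linear :
  (forall H1 H2, critical_class P B H1 -> critical_class P B H2 -> H1 != H2 ->
    ~ precedes P H1 H2) -> exists2 K, 0 < K & cut_le_bound a K.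
Proof.
move=> inc; have [C [C0 CP]] := count_cut_linear_le weight_mx_ge0 weight_mx_gt0
  perron_root_weight_mx ga0 ga1 Bga ba01 Bba inc.
rewrite -[a]mulr1; apply: (cut_upper_of C0 ltr01) => n i y y1.
by rewrite powRr1 ?(le_trans ler01)// CP.
Qed.

Let coverP n e : cylinder_cover P chi (cut_n n e).
Proof.
split; first exact: full_cut_pairwise.
  by move=> tau; exact: full_cut_admissible.
exact: (full_cut_weight _ _ PP chiP).
Qed.

(** The scale [e = (K/n)^(1 + r/s')] solves [K e^(-s'/(s'+r)) = n] and makes the scaled error bound
    independent of [n]. *)
Let scale_identity (K n s' : R) : 0 < K -> 0 < n -> 0 < s' ->
  n `^ (r / s') * n * (K / n) `^ (1 + r / s') = K `^ (1 + r / s').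
Proof.
move=> K0 n0 s'0; have -> : n `^ (r / s') * n = n `^ (1 + r / s').
  by rewrite powRD ?(gt_eqF n0) ?implybT// powRr1 ?(ltW n0)// mulrC.
rewrite -powRM ?(ltW n0) ?divr_ge0 ?(ltW K0) ?(ltW n0)//.
by congr (_ `^ _); field; rewrite gt_eqF.
Qed.

(** For given [n], the scale [e] solves [K e^-a = 2 n], so the cut has at least [2 n] words. The
    constant [k] is fixed before [K]: when [K] can be arbitrarily large, the lower coefficient
    becomes infinite. *)
Lemma scaled_error_lower : exists k, 0 < k /\ forall K, 0 < K -> cut_ge_bound K ->
  exists n0, forall n, (n0 <= n)%N ->
    ((k * (K / 2) `^ (1 + r / s))%:E <= scaled_error nrm r mu s n)%E.
Proof.
have [c1 [c2 [c10 _ cE]]] := is_norm_equiv_enorm nrmP.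
have [d [/andP[d0 _] sep]] := sepJ.
have [e0 e00 e0P] := chi_lb.
pose k := (c1 * d / 2) `^ r * g.
have k0 : 0 < k by rewrite mulr_gt0// powR_gt0// !mulr_gt0// invr_gt0.
exists k; split => // K K0 [e1 [e10 e1P]].
pose p := 1 + r / s; have p0 : 0 < p by rewrite addr_gt0// divr_gt0.
have ap : p * a = 1 by rewrite /p /a; field; rewrite !gt_eqF// addr_gt0.
pose e2 := Num.min e0 e1; have e20 : 0 < e2 by rewrite lt_min e00.
have [n0 n0P] := exists_natr_ge (Num.max 1 (K / 2 / e2 `^ a)).
exists n0 => n nn; have := n0P n nn; rewrite ge_max => /andP[n1 nK].
have np : 0 < n%:R :> R by apply: lt_le_trans n1.
pose e := (K / 2 / n%:R) `^ p.
have Kn0 : 0 < K / 2 / n%:R by rewrite !divr_gt0.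
have ep : 0 < e by rewrite powR_gt0.
have ea : e `^ a = K / 2 / n%:R by rewrite -powRrM ap powRr1// ltW.
have ee2 : e <= e2.
  have -> : e2 = (e2 `^ a) `^ p by rewrite -powRrM mulrC ap powRr1// ltW.
  apply: ge0_ler_powR; rewrite ?nnegrE ?powR_ge0 ?(ltW p0) ?(ltW Kn0)//.
  by rewrite ler_pdivrMr// (mulrC (e2 `^ a)) -ler_pdivrMr// powR_gt0.
move: ee2; rewrite le_min => /andP[ee0 ee1].
have [l lP] := exists_expr_lt b01 ep.
have := e1P l e ep ee1 lP.
have -> : K * e^-1 `^ a = (2 * n)%:R.
  rewrite -[e^-1]powR_inv1 ?(ltW ep)// -powRrM mulN1r powRN ea natrM.
  by field; rewrite !gt_eqF.
rewrite ler_nat => size_ge.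
have := @quant_error_ge R q m nrm r P c chi J mu nrmP r0 cP JP sepJ muP _ (coverP l e)
  c1 d (e * g) n c10 d0 (mulr_ge0 (ltW ep) (ltW g0)) sep size_ge.
have nc x : c1 * enorm x <= nrm x by have /andP[] := cE x.
have ge tau : tau \in cut_n l e -> e * g <= energy P c chi r tau.
  apply: (full_cut_ge cP g0 _ ep gP); first by case/andP: g01 => _ /ltW.
  move=> i; apply: le_trans (e0P i); apply: le_trans ee0.
  by rewrite ler_piMr ?(ltW ep)//; case/andP: g01 => _ /ltW.
move=> /(_ nc ge) H; rewrite /scaled_error.
have np0 : (0 <= (n%:R `^ (r / s))%:E :> \bar R)%E by rewrite lee_fin powR_ge0.
apply: le_trans (lee_wpmul2l np0 H); rewrite -EFinM lee_fin.
rewrite -(@scale_identity (K / 2) n%:R s)//; last by rewrite divr_gt0.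
by rewrite le_eqVlt; apply/orP; left; apply/eqP; rewrite -/p -/e /k; ring.
Qed.

(** Here [e] solves [K e^(-s'/(s'+r)) = n], so the cut has at most [n] words. The exponent [s'] is
    free: [s] gives the coefficient, every [s' > s] the dimension. *)
Lemma scaled_error_upper s' K : 0 < s' -> 0 < K -> cut_le_bound (s' / (s' + r)) K ->
  exists (C : R) n0, forall n, (n0 <= n)%N -> (scaled_error nrm r mu s' n <= C%:E)%E.
Proof.
move=> s'0 K0 [e1 [e10 e1P]].
have [c1 [c2 [_ c20 cE]]] := is_norm_equiv_enorm nrmP.
pose a' := s' / (s' + r).
have a'0 : 0 < a' by rewrite divr_gt0// addr_gt0.
pose p := 1 + r / s'; have p0 : 0 < p by rewrite addr_gt0// divr_gt0.
have ap : p * a' = 1 by rewrite /p /a'; field; rewrite !gt_eqF// addr_gt0.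
exists (c2 `^ r * K `^ p).
have [n0 n0P] := exists_natr_ge (Num.max 1 (K / e1 `^ a')).
exists n0 => n nn; have := n0P n nn; rewrite ge_max => /andP[n1 nK].
have np : 0 < n%:R :> R by apply: lt_le_trans n1.
pose e := (K / n%:R) `^ p.
have Kn0 : 0 < K / n%:R by rewrite divr_gt0.
have ep : 0 < e by rewrite powR_gt0.
have ea : e `^ a' = K / n%:R by rewrite -powRrM ap powRr1// ltW.
have ee1 : e <= e1.
  have -> : e1 = (e1 `^ a') `^ p by rewrite -powRrM mulrC ap powRr1// ltW.
  apply: ge0_ler_powR; rewrite ?nnegrE ?powR_ge0 ?(ltW p0) ?(ltW Kn0)//.
  by rewrite ler_pdivrMr//; move: nK; rewrite ler_pdivrMr ?powR_gt0// mulrC.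
have [l lP] := exists_expr_lt b01 ep.
have := e1P l e ep ee1.
have -> : K * e^-1 `^ (s' / (s' + r)) = n%:R.
  rewrite -/a' -[e^-1]powR_inv1 ?(ltW ep)// -powRrM mulN1r powRN ea.
  by field; rewrite !gt_eqF.
rewrite ler_nat => size_le.
have nc x : nrm x <= c2 * enorm x by have /andP[] := cE x.
have lt tau : tau \in cut_n l e -> energy P c chi r tau <= e.
  by move=> tl; apply/ltW/(full_cut_lt cP chiP b0 bP lP tl).
have H := @quant_error_le R q m nrm r P c chi J mu nrmP r0 cP JP sepJ muP _ (coverP l e)
  c2 e n c20 (ltW ep) size_le nc lt.
rewrite /scaled_error.
have np0 : (0 <= (n%:R `^ (r / s'))%:E :> \bar R)%E by rewrite lee_fin powR_ge0.
apply: le_trans (lee_wpmul2l np0 H) _; rewrite -EFinM lee_fin.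
rewrite -(@scale_identity K n%:R s')//.
apply: (@le_trans _ _ (n%:R `^ (r / s') * (c2 `^ r * n%:R * e))).
  rewrite ler_wpM2l ?powR_ge0// ler_wpM2r ?(ltW ep)// ler_wpM2l ?powR_ge0//.
  by rewrite ler_nat.
by rewrite le_eqVlt; apply/orP; left; apply/eqP; rewrite -/p -/e; ring.
Qed.

End Bounds.

Lemma quantization_asymptotics :
  [/\ has_quant_dim nrm r mu s%:E,
      (0 < lower_quant_coef nrm r mu s)%E,
      (forall H1 H2, critical P c r s H1 -> critical P c r s H2 -> H1 != H2 ->
         ~ precedes P H1 H2) -> (upper_quant_coef nrm r mu s < +oo)%E
    & (exists H1 H2, [/\ critical P c r s H1, critical P c r s H2, H1 != H2
         & precedes P H1 H2]) -> lower_quant_coef nrm r mu s = +oo%E].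
Proof.
have [g [b [g01 b01 gP bP]]] := exists_energy_bounds.
have [k [k0 kP]] := scaled_error_lower g01 b01 gP.
have [K K0 KP] := cut_lower b01 bP.
have [n0 n0P] := kP K K0 KP.
have A0 : 0 < k * (K / 2) `^ (1 + r / s) by rewrite mulr_gt0// powR_gt0// divr_gt0.
split.
- apply: (dimension_of_bounds r0 s0 _ A0 n0P).
    by move=> n; apply: le_ereal_inf_tmp => _ [alpha _ <-]; exact: poweR_ge0.
  move=> s' ss'; have s'0 : 0 < s' by apply: lt_trans ss'.
  (* The value of [t] for which [a (1 + t) = s' / (s' + r)]; it is positive since [x / (x + r)]
     increases with [x]. *)
  have t0 : 0 < s' / (s' + r) / a - 1.
    rewrite subr_gt0 ltr_pdivlMr// mul1r /a ltr_pdivrMr ?addr_gt0//.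
    rewrite mulrAC ltr_pdivlMr ?addr_gt0//.
    have : s * r < s' * r by rewrite ltr_pM2r.
    by lra.
  have [K' K'0] := cut_upper_power g01 b01 gP bP t0.
  have -> : a * (1 + (s' / (s' + r) / a - 1)) = s' / (s' + r).
    by field; rewrite !gt_eqF// addr_gt0.
  exact: (scaled_error_upper b01 bP s'0 K'0).
- apply: (@lt_le_trans _ _ (k * (K / 2) `^ (1 + r / s))%:E); first by rewrite lte_fin.
  exact: (limn_einf_ge n0P).
- move=> inc; have [H1 H2 c1 c2|K' K'0 K'P] := cut_upper_linear g01 b01 gP bP.
    by apply: inc; apply/criticalP.
  have [C [n1 n1P]] := scaled_error_upper b01 bP s0 K'0 K'P.
  by apply: (@le_lt_trans _ _ C%:E); [exact: (limn_esup_le n1P)|rewrite ltry].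
- move=> [H1 [H2 [/criticalP c1 /criticalP c2 neq prec]]].
  apply/eqyP => X X0.
  pose p := 1 + r / s; have p0 : 0 < p by rewrite addr_gt0// divr_gt0.
  have Xk : 0 < X / k by rewrite divr_gt0.
  (* Chosen so that [k (K'/2)^p] equals the prescribed level [X]. *)
  pose K' := 2 * (X / k) `^ p^-1.
  have K'0 : 0 < K' by rewrite mulr_gt0// powR_gt0.
  have KP' : cut_ge_bound b K'.
    by apply: (cut_superlinear b01 bP); exists H1, H2.
  have [n1 n1P] := kP K' K'0 KP'.
  have XE : k * (K' / 2) `^ (1 + r / s) = X.
    rewrite -/p (_ : K' / 2 = (X / k) `^ p^-1); last by rewrite /K'; field.
    rewrite -powRrM mulVf ?gt_eqF// powRr1 ?(ltW Xk)//.
    by field; rewrite gt_eqF.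
  by rewrite XE in n1P; exact: (limn_einf_ge n1P).
Qed.

End Main.

Unset Implicit Arguments.
Set Strict Implicit.
Set Printing Implicit Defensive.

Theorem theorem1p1 (R : realType) (q m : nat)
    (nrm : 'rV[R]_q -> R) (r : R)
    (P c : 'M[R]_m.+1) (chi : 'I_m.+1 -> R)
    (J : seq 'I_m.+1 -> set 'rV[R]_q)
    (mu : probability (borel R q) R) (s_r : R) :
  is_norm nrm ->
  0 < r ->
  is_transition_matrix P ->
  is_ratio_matrix P c ->
  is_positive_probability_vector chi ->
  is_cylinder_system P c J ->
  separation_property P J ->
  is_markov_type_measure P J chi mu ->
  is_sr P c r s_r ->
  [/\ has_quant_dim nrm r mu s_r%:E,
      (0 < lower_quant_coef nrm r mu s_r)%E,
      (upper_quant_coef nrm r mu s_r < +oo)%E <->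
      (forall H1 H2 : {set 'I_m.+1},
         critical P c r s_r H1 -> critical P c r s_r H2 -> H1 != H2 ->
         ~ comparable_components P H1 H2)
    & (exists H1 H2 : {set 'I_m.+1},
         [/\ critical P c r s_r H1, critical P c r s_r H2, H1 != H2
           & comparable_components P H1 H2]) ->
      lower_quant_coef nrm r mu s_r = +oo%E].
Proof.
move=> nrmP r0 PP cP chiP JP sepJ muP sP.
have [dim low up comp] := quantization_asymptotics nrmP r0 PP cP chiP JP sepJ muP sP.
have compE : (exists H1 H2 : {set 'I_m.+1},
     [/\ critical P c r s_r H1, critical P c r s_r H2, H1 != H2
       & comparable_components P H1 H2]) ->
   lower_quant_coef nrm r mu s_r = +oo%E.
  move=> [H1 [H2 [c1 c2 neq [prec|prec]]]]; apply: comp.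
    by exists H1, H2.
  by exists H2, H1; rewrite eq_sym.
split => //; split.
  (* A comparable pair would make the lower coefficient infinite, and with it the upper one. *)
  move=> upfin H1 H2 c1 c2 neq cmp.
  have lowy : lower_quant_coef nrm r mu s_r = +oo%E by apply: compE; exists H1, H2.
  have := limn_einf_sup (scaled_error nrm r mu s_r).
  rewrite -/(lower_quant_coef nrm r mu s_r) lowy leye_eq => /eqP E.
  by move: upfin; rewrite /upper_quant_coef E ltxx.
move=> inc; apply: up => H1 H2 c1 c2 neq prec.
by apply: (inc H1 H2 c1 c2 neq); left.
Qed.
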